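(* Let $d\in\mathbb{N}$, $1\le p\le\infty$, and let $w_\alpha$ be the Jacobi weight on the simplex $S\subset\mathbb{R}^d$ with parameters $\alpha=(\alpha_1,\dots,\alpha_{d+1})$, $\alpha_i>-1$ for $i=1,\dots,d+1$. Then for all $f\in L_{p,w_\alpha}(S)$ and all $n\in\mathbb{N}$ (with $n\ge 1$) $$\|M_{n,\alpha}f-f\|_{p,w_\alpha}\le 2\,K_\alpha(f,n^{-1})_p.$$
   Context: For $x=(x_1,\dots,x_d)\in\mathbb{R}^d$ write $|x|:=\sum_{i=1}^d x_i$ (used for $x\in S$ and for multi-indices). The standard simplex is $S:=\{x\in\mathbb{R}^d: x_i\ge 0,\ i=1,\dots,d,\ |x|\le 1\}$. Jacobi weight: $w_\alpha(x):=x_1^{\alpha_1}\cdots x_d^{\alpha_d}(1-|x|)^{\alpha_{d+1}}$. Spaces: for $1\le p<\infty$, $L_{p,w_\alpha}(S)$ is the space of Lebesgue measurable $f$ on $S$ with $\|f\|_{p,w_\alpha}:=\left(\int_S|f(x)|^p w_\alpha(x)\,dx\right)^{1/p}<\infty$; for $p=\infty$, $L_{\infty,w_\alpha}(S):=L_\infty(S)$ with $\|f\|_{\infty,w_\alpha}:=\mathrm{ess\,sup}_{x\in S}|f(x)|$. Bernstein-Durrmeyer operators: for $n\in\mathbb{N}_0$ and $\mathbf{k}=(k_1,\dots,k_d)\in\mathbb{N}_0^d$ with $|\mathbf{k}|\le n$ let $$p_{n,\mathbf{k}}(x):=\frac{n!}{k_1!\cdots k_d!\,(n-|\mathbf{k}|)!}\prod_{i=1}^d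 x_i^{k_i}\,(1-|x|)^{n-|\mathbf{k}|},$$ $$M_{n,\alpha}f(x):=\sum_{|\mathbf{k}|\le n}p_{n,\mathbf{k}}(x)\left(\int_S p_{n,\mathbf{k}}(y)w_\alpha(y)\,dy\right)^{-1}\int_S f(y)p_{n,\mathbf{k}}(y)w_\alpha(y)\,dy.$$ Differential operator: $$P_\alpha(D):=\sum_{\xi\in E_S}w_\alpha(x)^{-1}\frac{\partial}{\partial\xi}\,\tilde d(\xi,x)\,w_\alpha(x)\,\frac{\partial}{\partial\xi},$$ i.e. $P_\alpha(D)g=\sum_{\xi\in E_S}w_\alpha^{-1}\,\partial_\xi\big(\tilde d(\xi,\cdot)\,w_\alpha\,\partial_\xi g\big)$, where $E_S$ is the set of directions (unit vectors, one for each edge of $S$, the choice of sign being immaterial) parallel to the edges of $S$, and $$\tilde d(\xi,x):=\sup_{\lambda\ge 0,\ x+\lambda\xi\in S}d(x,x+\lambda\xi)\cdot\sup_{\lambda\ge 0,\ x-\lambda\xi\in S}d(x,x-\lambda\xi),$$ with $d(x,y)$ the Euclidean distance. $K$-functional: for $t>0$, $$K_\alpha(f,t)_p:=\inf_{g\in C^2(S)}\left\{\|f-g\|_{p,w_\alpha}+t\,\|P_\alpha(D)g\|_{p,w_\alpha}\right\}.$$ *)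

(* Defs.v *)
From HB Require Import structures.
From mathcomp Require Import all_boot all_order all_algebra.
From mathcomp Require Import all_classical all_reals all_analysis.
From mathcomp Require Import measurable_realfun ess_sup_inf.

Set Implicit Arguments.
Unset Strict Implicit.
Unset Printing Implicit Defensive.

Import Order.TTheory GRing.Theory Num.Theory.
Import numFieldNormedType.Exports.

Local Open Scope classical_set_scope.
Local Open Scope ring_scope.

(* The sigma-algebra on 'rV[R]_n generated by the n coordinate maps, that is
   the Borel sigma-algebra of R^n; it mirrors the library's n.-tuple T. *)
Definition rV_display : measure_display.
Proof. exact: default_measure_display. Qed.

Section measurable_rV.
Context {R : realType} (n : nat).

Let coord (i : 'I_n) (v : 'rV[R]_n) : measurableTypeR R := v ord0 i.

Let rV_set0 : g_sigma_preimage coord set0.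
Proof. exact: sigma_algebra0. Qed.

Let rV_setC A : g_sigma_preimage coord A -> g_sigma_preimage coord (~` A).
Proof. exact: sigma_algebraC. Qed.

Let rV_bigcup (F : _^nat) : (forall i, g_sigma_preimage coord (F i)) ->
  g_sigma_preimage coord (\bigcup_i (F i)).
Proof. exact: sigma_algebra_bigcup. Qed.

HB.instance Definition _ := @isMeasurable.Build rV_display
  'rV[R]_n (g_sigma_preimage coord) rV_set0 rV_setC rV_bigcup.

Lemma measurable_coord (i : 'I_n) :
  measurable_fun [set: 'rV[R]_n] (fun v => v ord0 i : measurableTypeR R).
Proof.
move=> _ Y mY; rewrite setTI; apply: sub_sigma_algebra => /=.
rewrite -bigcup_seq/=; exists i => /=; first by rewrite mem_index_enum.
by exists Y => //; rewrite setTI.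
Qed.

Lemma measurable_fun_rVP d (T : measurableType d) (f : T -> 'rV[R]_n) :
  (forall i, measurable_fun [set: T] (fun t => f t ord0 i : measurableTypeR R)) ->
  measurable_fun [set: T] f.
Proof.
move=> mf _ B mB; rewrite setTI.
suff : measurable `<=` [set A : set 'rV[R]_n | measurable (f @^-1` A)] by apply.
apply: smallest_sub.
  split => /=.
  - by rewrite preimage_set0; exact: measurable0.
  - by move=> A mA; rewrite setTD preimage_setC; exact: measurableC.
  - by move=> F mF; rewrite preimage_bigcup; exact: bigcup_measurable.
rewrite -bigcup_seq => A [i _ [C mC <-]] /=.
rewrite setTI; have := mf i measurableT C mC.
by rewrite setTI.
Qed.

End measurable_rV.

(* Lebesgue measure on R^n: the point mass for n = 0, and the image of
   (Lebesgue on R) x (Lebesgue on R^n) under (t, v) |-> (t, v_1, ..., v_n). *)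
Definition cons_rV {R : realType} n (p : measurableTypeR R * 'rV[R]_n) :
  'rV[R]_n.+1 := row_mx (p.1 : R)%:M p.2.

Lemma measurable_cons_rV {R : realType} n :
  measurable_fun setT (@cons_rV R n).
Proof.
apply: measurable_fun_rVP => i.
have [j ij|j ij] := split_ordP (i : 'I_(1 + n)).
  rewrite (_ : (fun _ => _) = fst); first exact: measurable_fst.
  apply/funext => p; rewrite ij; apply: etrans (row_mxEl _ _ _ _) _.
  by rewrite (ord1 j) mxE eqxx mulr1n.
rewrite (_ : (fun _ => _) = (fun v : 'rV[R]_n => v ord0 j) \o snd).
  by apply: measurableT_comp; [exact: measurable_coord|exact: measurable_snd].
by apply/funext => p; rewrite ij; exact: row_mxEr.
Qed.

Section lebesgue_cons.
Context {R : realType} (n : nat).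
Variable mu : {sigma_finite_measure set 'rV[R]_n -> \bar R}.

Definition lebesgue_cons : set 'rV[R]_n.+1 -> \bar R :=
  pushforward (@lebesgue_measure R \x mu)%E (@cons_rV R n).

Let lebesgue_cons0 : lebesgue_cons set0 = 0%E.
Proof. by rewrite /lebesgue_cons /pushforward preimage_set0 measure0. Qed.

Let lebesgue_cons_ge0 A : (0 <= lebesgue_cons A)%E.
Proof. exact: (measure_ge0 (@lebesgue_measure R \x mu)%E). Qed.

Let lebesgue_cons_sigma_additive : semi_sigma_additive lebesgue_cons.
Proof.
have mc A : measurable A -> measurable (@cons_rV R n @^-1` A).
  by move=> mA; rewrite -[_ @^-1` _]setTI; exact: measurable_cons_rV.
move=> F mF tF mUF; rewrite /lebesgue_cons /pushforward preimage_bigcup.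
apply: measure_semi_sigma_additive => [i||]; first exact: mc.
- by move=> i j Di Dj [p [Fip Fjp]]; apply: tF => //; exists (cons_rV p).
- by rewrite -preimage_bigcup; exact: mc.
Qed.

HB.instance Definition _ := isMeasure.Build _ _ _
  lebesgue_cons lebesgue_cons0 lebesgue_cons_ge0 lebesgue_cons_sigma_additive.

Let lebesgue_cons_sigma_finite : sigma_finite setT lebesgue_cons.
Proof.
have /sigma_finiteP[F [TF ndF Foo]] := sigma_finiteT (@lebesgue_measure R).
have /sigma_finiteP[G [TG ndG Goo]] := sigma_finiteT mu.
pose g (v : 'rV[R]_n.+1) : measurableTypeR R * 'rV[R]_n :=
  (v ord0 ord0, \row_j v ord0 (lift ord0 j)).
have mg : measurable_fun setT g.
  apply/measurable_fun_pairP; split; first exact: measurable_coord.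
  apply: measurable_fun_rVP => i /=; under eq_fun do rewrite mxE.
  exact: measurable_coord.
have gK p : g (cons_rV p) = p.
  case: p => t v; rewrite /g /cons_rV; congr pair => /=.
    by rewrite mxE; case: splitP => // j _; rewrite (ord1 j) mxE eqxx mulr1n.
  by apply/rowP => j; rewrite mxE -rshift1; exact: row_mxEr.
exists (fun k => g @^-1` (F k `*` G k)).
  rewrite -preimage_bigcup -[LHS](preimage_setT g); congr (_ @^-1` _).
  rewrite -setXTT TF TG predeqE => -[x y]; split.
    move=> [/= [i _ Fix] [j _ Gjy]]; exists (maxn i j) => //; split.
    - by move: x Fix; exact/subsetPset/ndF/leq_maxl.
    - by move: y Gjy; exact/subsetPset/ndG/leq_maxr.
  by move=> [i _ []/= ? ?]; split; exists i.
move=> k; have [mF Fk] := Foo k; have [mG Gk] := Goo k; split.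
  by rewrite -[_ @^-1` _]setTI; apply: mg => //; exact: measurableX.
rewrite /lebesgue_cons /pushforward -comp_preimage.
rewrite (_ : g \o _ = id); last by apply/funext => p /=; rewrite gK.
by rewrite preimage_id product_measure1E// lte_mul_pinfty// ge0_fin_numE.
Qed.

HB.instance Definition _ := Measure_isSigmaFinite.Build _ _ _
  lebesgue_cons lebesgue_cons_sigma_finite.

End lebesgue_cons.

Fixpoint lebesgue_rV (R : realType) (n : nat) :
    {sigma_finite_measure set 'rV[R]_n -> \bar R} :=
  match n with
  | 0 => dirac (0 : 'rV[R]_0)
  | n'.+1 => lebesgue_cons (lebesgue_rV R n')
  end.

(* Lebesgue (as opposed to Borel) measurability on D: the preimages of Borel
   sets lie in the completion of the Borel sigma-algebra. The integral of a
   nonnegative function is the supremum over Borel simple minorants, so it has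
   its usual value on Lebesgue measurable functions. *)
Definition lebesgue_measurable_fun (R : realType) (d : nat)
    (D : set 'rV[R]_d) (f : 'rV[R]_d -> R) : Prop :=
  forall B : set (measurableTypeR R), measurable B ->
    completed_algebra_gen (lebesgue_rV R d) (D `&` f @^-1` B).

Section simplex.
Context {R : realType} {d : nat}.
Implicit Types (x y xi : 'rV[R]_d) (f g : 'rV[R]_d -> R) (p : \bar R).

Definition sumx x : R := \sum_(i < d) x ord0 i.

Definition simplex : set 'rV[R]_d :=
  [set x : 'rV[R]_d | (forall i, 0 <= x ord0 i) /\ sumx x <= 1].

(* alpha is indexed from 0: the exponent of x_i is alpha (lift ord_max i), of
   value i, and the exponent of 1 - |x| is alpha ord_max, of value d. *)
Definition jacobi_weight (alpha : 'I_d.+1 -> R) x : R :=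
  (\prod_(i < d) x ord0 i `^ alpha (lift ord_max i)) *
  (1 - sumx x) `^ alpha ord_max.

(* The sup norm is unweighted; extending |f| >= 0 by 0 outside the simplex does
   not change its essential supremum. The value at p = -oo is junk. *)
Definition wnorm (alpha : 'I_d.+1 -> R) p f : \bar R :=
  match p with
  | r%:E => ((\int[lebesgue_rV R d]_(x in simplex)
               (`|f x| `^ r * jacobi_weight alpha x)%:E) `^ r^-1)%E
  | +oo%E => ess_sup (lebesgue_rV R d) (fun x => `|(f \_ simplex) x|%:E)
  | -oo%E => 0%E
  end.

Definition Lpw (alpha : 'I_d.+1 -> R) p : set ('rV[R]_d -> R) :=
  [set f | lebesgue_measurable_fun simplex f /\ (wnorm alpha p f < +oo)%E].

Definition bernstein (n : nat) (k : {ffun 'I_d -> 'I_n.+1}) x : R :=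
  let absk := (\sum_(i < d) k i)%N in
  n`!%:R / ((\prod_(i < d) (k i)`!) * (n - absk)`!)%N%:R *
  (\prod_(i < d) x ord0 i ^+ k i) * (1 - sumx x) ^+ (n - absk).

Definition bernstein_durrmeyer (alpha : 'I_d.+1 -> R) (n : nat) f x : R :=
  let mu := lebesgue_rV R d in let w := jacobi_weight alpha in
  \sum_(k : {ffun 'I_d -> 'I_n.+1} | (\sum_(i < d) k i <= n)%N)
    bernstein k x *
    (\int[mu]_(y in simplex) (bernstein k y * w y))^-1 *
    \int[mu]_(y in simplex) (f y * bernstein k y * w y).

Definition enorm x : R := Num.sqrt (\sum_(i < d) x ord0 i ^+ 2).

(* The vertices of the simplex: the origin for i = 0 and the i-th (counted
   from 1) unit vector for i > 0. *)
Definition vertex (i : 'I_d.+1) : 'rV[R]_d :=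
  \row_(j < d) (i == lift ord0 j)%:R.

Definition edge_dir (i j : 'I_d.+1) : 'rV[R]_d :=
  (enorm (vertex j - vertex i))^-1 *: (vertex j - vertex i).

Definition dtilde xi x : R :=
  sup [set enorm (x - (x + l *: xi)) |
        l in [set l : R | 0 <= l /\ simplex (x + l *: xi)]] *
  sup [set enorm (x - (x - l *: xi)) |
        l in [set l : R | 0 <= l /\ simplex (x - l *: xi)]].

(* The edges of the simplex are the segments joining the vertices i < j; no two
   are parallel. *)
Definition PD (alpha : 'I_d.+1 -> R) g x : R :=
  let w := jacobi_weight alpha in
  \sum_(i < d.+1) \sum_(j < d.+1 | (i < j)%N)
    let xi := edge_dir i j in
    (w x)^-1 * 'D_xi (fun y => dtilde xi y * w y * 'D_xi g y) x.

(* g is continuous on the closed simplex, and its partial derivatives of order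
   at most 2 exist in the interior and extend continuously to the closed
   simplex (as D1, D2). *)
Definition C2_simplex : set ('rV[R]_d -> R) :=
  [set g | {within simplex, continuous g} /\
    exists (D1 : 'I_d -> 'rV[R]_d -> R) (D2 : 'I_d -> 'I_d -> 'rV[R]_d -> R),
    [/\ forall i, {within simplex, continuous (D1 i)},
        forall i j, {within simplex, continuous (D2 i j)},
        forall i x, simplex° x ->
          is_derive x (delta_mx ord0 i) g (D1 i x) &
        forall i j x, simplex° x ->
          is_derive x (delta_mx ord0 j) (D1 i) (D2 i j x)]].

Definition Kfunctional (alpha : 'I_d.+1 -> R) f (t : R) p : \bar R :=
  ereal_inf [set (wnorm alpha p (fun x => f x - g x)%R +
                  t%:E * wnorm alpha p (PD alpha g))%E | g in C2_simplex].

End simplex.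

(* Main.v *)
Require Import Defs.
From mathcomp Require Import all_boot all_order all_algebra.
From mathcomp Require Import all_classical all_reals all_analysis.
From mathcomp Require Import measurable_realfun ess_sup_inf.
From mathcomp Require Import ring lra.

Set Implicit Arguments.
Unset Strict Implicit.
Unset Printing Implicit Defensive.

Import Order.TTheory GRing.Theory Num.Theory.
Import numFieldNormedType.Exports.

Local Open Scope classical_set_scope.
Local Open Scope ring_scope.

(** Write lambda_0 = 1 - |x|, lambda_1 = x_1, ..., lambda_d = x_d for the
barycentric coordinates, a_0, ..., a_d for the exponents of the weight w in
these coordinates, A = sum_i (a_i + 1), and M_n for the Durrmeyer operator.

The Euclidean lengths of the edges cancel between dtilde and the two normalised
directional derivatives, so that inside the simplex P_alpha(D) is
L g = sum_(i < j) w^-1 d_ij (lambda_i lambda_j w d_ij g), with d_ij the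
derivative along the edge from the vertex i to the vertex j [PD_osimplex].
The flux lambda_i lambda_j w u vanishes at both ends of every chord parallel to
the edge, because a_i, a_j > -1; hence d_ij of it has integral zero over the simplex
[w_int_div], and L is symmetric against the monomials lambda^k [edge_op_sym].
For deg k = n + 1 one computes L lambda^k = sum_j k_j (k_j + a_j) lambda^(k - e_j)
- (n + 1) (n + A) lambda^k. Together with the recursion for the moments of the
weight [bmom_incr] this expresses the k-th weighted mean of L g by the means of
g of degrees n and n + 1, and averaging over the multinomial law with parameters
lambda(x) gives the step identity [durrmeyer_step]

  M_(n+1) (L g) = (n + A) (n + 1) (M_n g - M_(n+1) g).

Since M_(k+1) is a contraction of the weighted L_p space [wnorm_durrmeyer]
(Jensen's inequality pointwise, and M_n preserves the weighted integral),
|| M_k g - M_(k+1) g || <= || L g || / (k (k + 1)). The bounds telescope to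
|| M_n g - M_N g || <= || L g || / n, and M_N g tends to g uniformly
[durrmeyer_cvg], so || M_n g - g || <= || P_alpha(D) g || / n for every g of
class C^2 [wnorm_durrmeyer_C2]. Finally M_n f - f = M_n (f - g) + (M_n g - g)
+ (g - f), where the outer terms are at most || f - g || each. *)

(** * Integration along parallel lines *)

Section lebesgue_rV_theory.
Context {R : realType}.
Implicit Types n : nat.

Lemma integral_lebesgue_shift (f : R -> \bar R) (a : R) :
  measurable_fun setT f -> (forall t, 0 <= f t)%E ->
  (\int[lebesgue_measure]_t f (t + a)%R = \int[lebesgue_measure]_t f t)%E.
Proof.
move=> mf f0.
have mphi : measurable_fun setT
    ((fun t => t + a) : measurableTypeR R -> measurableTypeR R).
  exact: measurable_funD.
rewrite -[LHS]/(\int[lebesgue_measure]_(t in (fun t => (t + a)%R) @^-1` setT)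
  (f \o (fun t => (t + a)%R)) t)%E.
have := @ge0_integral_pushforward _ _ (measurableTypeR R) (measurableTypeR R) R
  _ mphi lebesgue_measure setT f measurableT mf (fun y _ => f0 y).
move=> /= <-.
apply: eq_measure_integral => //= A mA _; apply/esym/lebesgue_measure_unique => //.
move=> _ [[u v]] _ <-; rewrite /= /pushforward /=.
rewrite (_ : _ @^-1` _ = `]u - a, v - a]%classic); last first.
  by apply/seteqP; split=> t /=; rewrite !in_itv/=; lra.
rewrite !lebesgue_measure_itv/= !lte_fin ltrD2r; case: ifP => // _.
by congr (_%:E); rewrite /=; ring.
Qed.

Lemma integral_lebesgue_rVS n (f : 'rV[R]_n.+1 -> \bar R) :
  measurable_fun setT f -> (forall t, 0 <= f t)%E ->
  (\int[lebesgue_rV R n.+1]_x f x =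
   \int[lebesgue_measure]_t \int[lebesgue_rV R n]_v f (cons_rV (t, v)))%E.
Proof.
move=> mf f0.
have := @ge0_integral_pushforward _ _ _ _ R
  _ (@measurable_cons_rV R n) (lebesgue_measure \x lebesgue_rV R n)%E
   setT f measurableT mf (fun y _ => f0 y).
rewrite preimage_setT => e.
transitivity (\int[lebesgue_measure \x lebesgue_rV R n]_x (f \o @cons_rV R n) x)%E.
  by rewrite -e.
rewrite fubini_tonelli1//; last by move=> x; exact: f0.
exact: measurableT_comp mf (@measurable_cons_rV R n).
Qed.

Lemma measurable_shift_rV n (v : 'rV[R]_n) :
  measurable_fun setT (fun x : 'rV[R]_n => x + v).
Proof.
apply: measurable_fun_rVP => i; under eq_fun do rewrite mxE.
by apply: measurable_funD => //; exact: measurable_coord.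
Qed.

(** Translation invariance, by induction on the dimension: the measure is an
iterated one-dimensional Lebesgue measure, and the last coordinates are shifted
inside the inner integral. *)
Lemma integral_rV_shift n (v : 'rV[R]_n) (f : 'rV[R]_n -> \bar R) :
  measurable_fun setT f -> (forall t, 0 <= f t)%E ->
  (\int[lebesgue_rV R n]_x f (x + v)%R = \int[lebesgue_rV R n]_x f x)%E.
Proof.
elim: n v f => [|n IH] v f mf f0.
  by apply: eq_integral => x _; rewrite (thinmx0 (x + v)) (thinmx0 x).
have mfv : measurable_fun setT (fun x : 'rV[R]_n.+1 => f (x + v)).
  exact: measurableT_comp mf (measurable_shift_rV v).
rewrite (integral_lebesgue_rVS mfv); last by move=> t; exact: f0.
rewrite (integral_lebesgue_rVS mf f0).
pose G (t : R) := (\int[lebesgue_rV R n]_x f (cons_rV (t, x)))%E.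
have mG : measurable_fun setT G.
  apply: (@measurable_fun_fubini_tonelli_F _ _ _ _ _ (lebesgue_rV R n)
    (f \o @cons_rV R n)); last by move=> z; exact: f0.
  exact: measurableT_comp mf (@measurable_cons_rV R n).
transitivity (\int[lebesgue_measure]_t G (t + v ord0 ord0)%R)%E; last first.
  by apply: integral_lebesgue_shift => // t; apply: integral_ge0.
apply: eq_integral => t _.
pose u : 'rV[R]_n := \row_j v ord0 (lift ord0 j).
rewrite /G -[RHS](IH u) //; last first.
  apply: measurableT_comp mf _.
  apply: (measurableT_comp (@measurable_cons_rV R n)).
  exact: measurable_pair1.
apply: eq_integral => x _; congr f.
apply/rowP => i; rewrite !mxE.
case: splitP => j ij.
  have -> : i = ord0 by apply/val_inj; rewrite /= ij ord1.
  by rewrite !mxE/= ord1 eqxx !mulr1n.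
have -> : i = lift ord0 j by apply/val_inj.
by rewrite !mxE/=.
Qed.
End lebesgue_rV_theory.

Section lines.
Context {R : realType} {n : nat}.
Implicit Types (x v : 'rV[R]_n) (c : 'I_n).
Local Notation mu := (lebesgue_rV R n).

Definition slab c : set 'rV[R]_n := [set x | 0 <= x ord0 c <= 1].

Lemma measurable_slab c : measurable (slab c).
Proof.
rewrite -[slab c]setTI (_ : slab c = (fun x => x ord0 c) @^-1` `[0, 1]); last first.
  by apply/seteqP; split=> x /=; rewrite in_itv.
exact: measurable_coord.
Qed.

Lemma measurable_line v :
  measurable_fun setT (fun z : 'rV[R]_n * measurableTypeR R => z.1 + (z.2 : R) *: v).
Proof.
apply: measurable_fun_rVP => i; under eq_fun do rewrite !mxE.
apply: measurable_funD.
  apply: (measurableT_comp (measurable_coord i)); exact: measurable_fst.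
by apply: measurable_funM => //; exact: measurable_snd.
Qed.

Lemma measurable_line1 x v :
  measurable_fun setT (fun t : measurableTypeR R => x + (t : R) *: v).
Proof.
exact: (measurableT_comp (measurable_line v) (measurable_pair1 x)).
Qed.

(** A line in direction [v] crosses the slab at unit speed. *)
Lemma lebesgue_line_slab v c (y : 'rV[R]_n) : `|v ord0 c| = 1 ->
  lebesgue_measure [set t : R | slab c (y - t *: v)] = 1%E.
Proof.
move=> vc; pose yc := y ord0 c; have := ler_norm (v ord0 c).
have [v0 _|v0 _] := leP 0 (v ord0 c).
  rewrite ger0_norm// in vc.
  rewrite (_ : [set _ | _] = `[yc - 1, yc]%classic).
    rewrite lebesgue_measure_itv/= lte_fin ifT; last by lra.
    by congr (_%:E); rewrite /=; ring.
  apply/seteqP; split=> t /=; rewrite /slab/= !mxE in_itv/= vc mulr1 /yc; lra.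
rewrite ltr0_norm// in vc.
rewrite (_ : [set _ | _] = `[- yc, 1 - yc]%classic).
  rewrite lebesgue_measure_itv/= lte_fin ifT; last by lra.
  by congr (_%:E); rewrite /=; ring.
have vE : v ord0 c = -1 by lra.
apply/seteqP; split=> t /=; rewrite /slab/= !mxE in_itv/= vE mulrN1 opprK /yc; lra.
Qed.

(** Integration over R^n by lines of direction [v], without a change of
coordinates. By Fubini and translation invariance the right-hand side is
the integral of [G x] times the length of the set of parameters [t] with
[x - t *: v] in the slab, and this length is 1. *)
Lemma integral_slab v c (G : 'rV[R]_n -> \bar R) : `|v ord0 c| = 1 ->
  measurable_fun setT G -> (forall t, 0 <= G t)%E ->
  (\int[mu]_x G x =
   \int[mu]_(x in slab c) \int[lebesgue_measure]_t G (x + t *: v)%R)%E.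
Proof.
move=> vc mG G0.
pose H (z : 'rV[R]_n * measurableTypeR R) : \bar R :=
  ((\1_(slab c) z.1)%:E * G (z.1 + (z.2 : R) *: v)%R)%E.
have H0 z : (0 <= H z)%E by rewrite mule_ge0// lee_fin.
have mH : measurable_fun setT H.
  apply: emeasurable_funM.
    apply/measurable_EFinP; apply: measurableT_comp => //.
    by apply: measurable_indic; exact: measurable_slab.
  exact: measurableT_comp mG (measurable_line v).
have m1 : measurable_fun setT (\1_(slab c) : 'rV[R]_n -> R).
  by apply: measurable_indic; exact: measurable_slab.
transitivity (\int[mu]_x \int[lebesgue_measure]_t H (x, t))%E; last first.
  rewrite [RHS]integral_mkcond; apply: eq_integral => x _.
  have mGx := measurableT_comp mG (measurable_line1 x v).
  rewrite /H/= (ge0_integralZl lebesgue_measure measurableT mGx)//; last by move=> t _; exact: G0.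
  rewrite patchE indicE; case: ifPn => _; first by rewrite mul1e.
  by rewrite mul0e.
have := @fubini_tonelli _ _ _ _ R mu lebesgue_measure _ mH H0; rewrite /fubini_F /fubini_G => ->.
pose K (z : 'rV[R]_n * measurableTypeR R) : \bar R :=
  ((\1_(slab c) (z.1 - (z.2 : R) *: v))%:E * G z.1)%E.
have K0 z : (0 <= K z)%E by rewrite mule_ge0// lee_fin.
have mK : measurable_fun setT K.
  apply: emeasurable_funM.
    apply/measurable_EFinP.
    apply: (measurableT_comp m1).
    have := measurable_line (- v); apply: eq_measurable_fun => z _ /=.
    by rewrite scalerN.
  by apply: (measurableT_comp mG); exact: measurable_fst.
transitivity (\int[lebesgue_measure]_t \int[mu]_x K (x, t))%E; last first.
  apply: eq_integral => t _.
  rewrite -(@integral_rV_shift R n (t *: v) (fun x => K (x, t))).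
  - by apply: eq_integral => x _; rewrite /K/H/= addrK.
  - exact: measurableT_comp mK (measurable_pair2 t).
  - by move=> x; exact: K0.
have := @fubini_tonelli _ _ _ _ R mu lebesgue_measure _ mK K0; rewrite /fubini_F /fubini_G => <-.
apply: eq_integral => x _.
have mKx : measurable_fun setT
    (fun t : measurableTypeR R => (\1_(slab c) (x - (t : R) *: v))%:E : \bar R).
  apply/measurable_EFinP; apply: (measurableT_comp m1).
  have := measurable_line1 x (- v); apply: eq_measurable_fun => z _ /=.
  by rewrite scalerN.
rewrite /K/= (ge0_integralZr lebesgue_measure measurableT mKx) ?G0//.
rewrite (_ : (\int[_]_x0 _)%E = 1%E) ?mul1e//.
have mA : measurable [set t : measurableTypeR R | slab c (x - (t : R) *: v)].
  rewrite (_ : [set _ | _] = (fun t : measurableTypeR R => x - (t : R) *: v) @^-1` slab c)//.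
  rewrite -[_ @^-1` _]setTI.
  have /(_ measurableT _ (measurable_slab c)) := measurable_line1 x (- v).
  by congr (measurable (_ `&` _)); apply/seteqP; split=> t /=; rewrite scalerN.
transitivity (lebesgue_measure ([set t : measurableTypeR R | slab c (x - (t : R) *: v)] `&` setT)).
  by rewrite -integral_indic.
by rewrite setIT; exact: lebesgue_line_slab.
Qed.

(** The hypothesis is only asked on the lines on which [G] is integrable, which
are almost all of them: the line integrals of the positive and negative parts
then agree for almost every starting point in the slab. *)
Lemma integral0_lines v c (G : 'rV[R]_n -> R) : `|v ord0 c| = 1 ->
  mu.-integrable setT (EFin \o G) ->
  (forall x, lebesgue_measure.-integrable setT (fun t : R => (G (x + t *: v))%:E) ->
    \int[lebesgue_measure]_t (G (x + t *: v))%:E = 0)%E ->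
  (\int[mu]_x (G x)%:E = 0)%E.
Proof.
move=> vc iG G0; have mG := measurable_int _ iG.
have mGp := measurable_funepos mG; have mGn := measurable_funeneg mG.
rewrite integralE.
have ep := @integral_slab v c _ vc mGp (fun x => funepos_ge0 _ x).
have en := @integral_slab v c _ vc mGn (fun x => funeneg_ge0 _ x).
have iGp := integrable_funepos measurableT iG.
have iGn := integrable_funeneg measurableT iG.
rewrite [X in (X - _)%E](_ : _ = (\int[mu]_x (EFin \o G)^\- x)%E).
  by rewrite subee// integrable_fin_num.
rewrite ep en.
pose F (H : 'rV[R]_n -> \bar R) (x : 'rV[R]_n) :=
  (\int[lebesgue_measure]_t H (x + t *: v)%R)%E.
have mF H : measurable_fun setT H -> (forall x, 0 <= H x)%E -> measurable_fun setT (F H).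
  move=> mH H0; apply: (@measurable_fun_fubini_tonelli_F _ _ _ _ _ lebesgue_measure
    (fun z : 'rV[R]_n * measurableTypeR R => H (z.1 + (z.2 : R) *: v)%R)).
    exact: measurableT_comp mH (measurable_line v).
  by move=> z; exact: H0.
have iF H : measurable_fun setT H -> (forall x, 0 <= H x)%E ->
    (\int[mu]_x H x < +oo)%E -> mu.-integrable (slab c) (F H).
  move=> mH H0 Hoo; apply/integrableP; split.
    exact: measurable_funTS (mF _ mH H0).
  under eq_integral do rewrite gee0_abs ?integral_ge0//.
  by rewrite -(integral_slab vc mH H0).
apply: ge0_ae_eq_integral => //.
- exact: measurable_slab.
- by apply: measurable_funTS; apply: mF.
- by apply: measurable_funTS; apply: mF.
- by move=> x _; exact: integral_ge0.
- by move=> x _; exact: integral_ge0.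
have msl := measurable_slab c.
have aep := integrable_ae msl (iF _ mGp (fun x => funepos_ge0 _ x) (integrable_lty measurableT iGp)).
have aen := integrable_ae msl (iF _ mGn (fun x => funeneg_ge0 _ x) (integrable_lty measurableT iGn)).
apply: filterS2 aep aen => x fp fn sx; move: (fp sx) (fn sx) => {}fp {}fn.
have mGx : measurable_fun setT (fun t : R => (G (x + t *: v))%:E).
  exact: measurableT_comp mG (measurable_line1 x v).
have iGx : lebesgue_measure.-integrable setT (fun t : R => (G (x + t *: v))%:E).
  apply/integrableP; split => //.
  under eq_integral do rewrite -/((abse \o (EFin \o G)) _) fune_abse.
  rewrite ge0_integralD//; last 2 first.
  - exact: measurableT_comp mGp (measurable_line1 x v).
  - exact: measurableT_comp mGn (measurable_line1 x v).
  by rewrite lte_add_pinfty// ltey_eq ?fp ?fn.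
have : (F (EFin \o G)^\+ x - F (EFin \o G)^\- x = 0)%E.
  rewrite -(G0 x iGx) [RHS]integralE.
  congr (_ - _)%E; apply: eq_integral => t _; rewrite ?funeposE ?funenegE//.
rewrite -(fineK fp) -(fineK fn) -EFinB => -[] /eqP; rewrite subr_eq0 => /eqP fpn.
by rewrite -[LHS](fineK fp) -[RHS](fineK fn) fpn.
Qed.
End lines.

Section null_and_open.
Context {R : realType} {n : nat}.
Implicit Types (x v : 'rV[R]_n) (c : 'I_n).
Local Notation mu := (lebesgue_rV R n).

(** Each line in direction [v] meets the level set in a single point. *)
Lemma null_level_set v c (l : 'rV[R]_n -> R) (s : R) : `|v ord0 c| = 1 ->
  measurable_fun setT l -> s != 0 -> (forall x t, l (x + t *: v) = l x + t * s) ->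
  measurable [set x | l x = 0] /\ mu [set x | l x = 0] = 0%E.
Proof.
move=> vc ml s0 lE.
have mA : measurable [set x | l x = 0].
  rewrite -[[set _ | _]]setTI (_ : [set _ | _] = l @^-1` [set 0]) //.
  exact: ml.
split=> //; rewrite -[X in mu X]setIT -integral_indic//.
have mI : measurable_fun setT (fun x : 'rV[R]_n => (\1_[set x | l x = 0] x)%:E : \bar R).
  by apply/measurable_EFinP; exact: measurable_indic.
rewrite (integral_slab vc mI); last by move=> t; rewrite lee_fin.
apply: integral0_eq => x _.
transitivity (\int[lebesgue_measure]_t ((\1_[set - l x / s] : R -> R) t)%:E)%E.
  apply: eq_integral => t _; rewrite !indicE; congr ((_ : bool)%:R%:E).
  apply/idP/idP; rewrite !inE /= lE => /eqP.
    by rewrite addrC addr_eq0 => /eqP <-; rewrite mulfK.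
  by move=> /eqP ->; rewrite divfK// subrr.
by rewrite integral_indic// setIT; exact: lebesgue_measure_set1.
Qed.

Lemma measurable_ball_rV x (e : R) : measurable (ball x e : set 'rV[R]_n).
Proof.
have [e0|e0] := ltP 0 e; last first.
  rewrite (_ : ball x e = set0); first exact: measurable0.
  by apply/seteqP; split=> // y; rewrite /ball/=/mx_ball => -[]; rewrite ltNge e0.
rewrite (_ : ball x e =
    \bigcap_(i in setT) ((fun y : 'rV[R]_n => y ord0 i) @^-1` (ball (x ord0 i) e))).
  apply: fin_bigcap_measurable => // i _; rewrite -[_ @^-1` _]setTI.
  by apply: measurable_coord => //; exact: measurable_ball.
apply/seteqP; split=> y.
  by move=> [_ h] i _; exact: h.
by move=> h; split=> // j i; rewrite (ord1 j); exact: h.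
Qed.

(** An open set is the union of the balls with rational centre and radius
[1 / k.+1] that it contains. This links the topology of the matrix type with
the sigma-algebra generated by the coordinates. *)
Lemma open_measurable_rV (O : set 'rV[R]_n) : open O -> measurable O.
Proof.
move=> oO.
pose c (z : 'rV[rat]_n) : 'rV[R]_n := map_mx ratr z.
pose B (z : 'rV[rat]_n * nat) : set 'rV[R]_n :=
  if `[< ball (c z.1) (z.2.+1%:R^-1) `<=` O >] then ball (c z.1) (z.2.+1%:R^-1)
  else set0.
rewrite (_ : O = \bigcup_z B z).
  apply: countable_bigcupT_measurable; first exact: countableP.
  by move=> z; rewrite /B; case: ifP => // _; exact: measurable_ball_rV.
apply/seteqP; split=> [x Ox|x [z _]]; last first.
  by rewrite /B; case: ifPn => // /asboolP; apply.
have := oO; rewrite openE => /(_ _ Ox); rewrite /interior -nbhs_ballE => -[e /= e0 xe].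
have [k ke] : exists k, 2 * k.+1%:R^-1 < e :> R.
  have [k] := ltr_add_invr (y := 0) (divr_gt0 e0 (ltr0n _ 2)).
  by rewrite add0r => ?; exists k; rewrite mulrC -ltr_pdivlMr.
have k0 : 0 < k.+1%:R^-1 :> R by rewrite invr_gt0.
have /choice[q qP] (i : 'I_n) : exists q : rat, ball (x ord0 i) k.+1%:R^-1 (ratr q : R).
  have xl : x ord0 i < x ord0 i + k.+1%:R^-1 by rewrite ltrDl.
  have [q] := rat_in_itvoo xl; rewrite in_itv/= => /andP[q1 q2].
  by exists q; rewrite /ball/= ltr_distlC q2 andbT ltrBlDr (lt_trans q1)// ltrDl.
exists (\row_i q i, k) => //; rewrite /B.
have bx : ball (c (\row_i q i)) k.+1%:R^-1 x.
  split=> // j i; rewrite (ord1 j) !mxE; apply: ball_sym; exact: qP.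
rewrite asboolT//= => y yb; apply: xe; apply: le_ball (ltW ke) _ _.
rewrite mulrC mulr_natr mulr2n; apply: ball_triangle yb; exact: ball_sym.
Qed.
End null_and_open.

(** * Modifications on null sets *)

Section null_modification.
Context d (T : measurableType d) (R : realType).
Variable mu : {measure set T -> \bar R}.
Variables (N : set T) (mN : measurable N) (N0 : mu N = 0%E).

Import HBNNSimple.

(* [f] and [g] may be non-measurable, so the integral is compared through its
   definition as a supremum: truncating a simple minorant of [f] to 0 on [N]
   keeps its integral and makes it a minorant of [g]. *)
Let ge0_le_integral_off_null (f g : T -> \bar R) : (forall x, 0 <= f x)%E ->
  (forall x, 0 <= g x)%E -> (forall x, ~ N x -> f x = g x) ->
  (\int[mu]_x f x <= \int[mu]_x g x)%E.
Proof.
move=> f0 g0 fg; rewrite ge0_integralTE// [leRHS]ge0_integralTE//.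
apply: ge_ereal_sup => _ [h /= hf <-].
pose h' := proj_nnsfun h (measurableC mN).
have h'E x : h' x = (h \_ (~` N)) x by rewrite (mrestrict h (measurableC mN)).
apply: (@le_trans _ _ (sintegral mu h')).
  rewrite -!integralT_nnsfun le_eqVlt; apply/orP; left; apply/eqP.
  apply: ae_eq_integral => //.
  - exact/measurable_EFinP.
  - exact/measurable_EFinP.
  exists N; split=> // x /= /not_implyP[_]; apply: contra_notP => Nx.
  by congr EFin; apply/esym; apply: etrans (h'E x) _; rewrite patchE mem_set.
apply: ereal_sup_ubound; exists h' => // x.
apply: (@le_trans _ _ ((h \_ (~` N)) x)%:E).
  by rewrite lee_fin le_eqVlt; apply/orP; left; apply/eqP; exact: h'E.
by rewrite patchE; case: ifPn => // /set_mem Nx; rewrite -fg.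
Qed.

Lemma eq_integral_off_null (D : set T) (f g : T -> \bar R) :
  (forall x, D x -> ~ N x -> f x = g x) ->
  (\int[mu]_(x in D) f x = \int[mu]_(x in D) g x)%E.
Proof.
move=> fg; rewrite integral_mkcond [RHS]integral_mkcond.
have {}fg x : ~ N x -> (f \_ D) x = (g \_ D) x.
  by move=> Nx; rewrite !patchE; case: ifPn => // /set_mem Dx; exact: fg.
rewrite integralE [RHS]integralE; congr (_ - _)%E; apply/eqP;
  rewrite eq_le; apply/andP; split; apply: ge0_le_integral_off_null;
  by move=> x *; rewrite ?funeposE ?funenegE ?le_max ?lexx ?orbT// fg.
Qed.
End null_modification.

Section lebesgue_borel.
Context {R : realType} {n : nat}.
Local Notation mu := (lebesgue_rV R n).

(** Each set {f > r} with r rational is Borel up to a null set; outside the union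
[N] of these countably many null sets all of them are Borel, so that cutting
[f] to 0 on [N] gives a Borel function. *)
Lemma lebesgue_measurable_borel (D : set 'rV[R]_n) (f : 'rV[R]_n -> R) :
  measurable D -> lebesgue_measurable_fun D f ->
  exists f' N, [/\ measurable_fun setT f', measurable N, mu N = 0%E &
    forall x, D x -> ~ N x -> f x = f' x].
Proof.
move=> mD mf.
pose r k : R := ratr (odflt 0 (unpickle k)).
have rP (a b : R) : a < b -> exists k, a < r k < b.
  move=> /rat_in_itvoo[q]; rewrite in_itv/= => qab.
  by exists (pickle q); rewrite /r pickleK.
have /choice[AM AMP] (k : nat) : exists AM : set 'rV[R]_n * set 'rV[R]_n,
   [/\ measurable AM.1, measurable AM.2, mu AM.2 = 0%E &
    (D `&` f @^-1` `]r k, +oo[) `\` AM.2 = AM.1 `\` AM.2].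
  have [A mA [M0 [M [mM M00 M0M]] AM]] :=
    mf `]r k, +oo[%classic (measurable_itv _).
  exists (A, M); split => //=.
  rewrite -AM; apply/seteqP; split=> x /= [].
    by move=> [Ax|/M0M//] nM; split.
  by move=> Ax nM; split => //; left.
pose N := \bigcup_k (AM k).2.
have mN : measurable N by apply: bigcupT_measurable => k; have [] := AMP k.
have N0 : mu N = 0%E.
  apply/negligibleP => //; apply: negligible_bigcup => k.
  by have [_ mM M0 _] := AMP k; apply/negligibleP.
pose D' := D `\` N; have mD' : measurable D' by exact: measurableD.
exists (f \_ D'), N; split => //; last first.
  by move=> x Dx Nx; rewrite patchE mem_set.
apply: (measurability _ (RGenOInfty.measurableE R)) => _ [_ [a ->] <-].
rewrite setTI.
rewrite (_ : _ @^-1` _ = \bigcup_k (if a < r k then (if r k < 0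
   then (AM k).1 `\` N `|` ~` D' else (AM k).1 `\` N) else set0)); last first.
  have AMN k : (AM k).1 `\` N = (D `&` f @^-1` `]r k, +oo[) `\` N.
    have [_ _ _ e] := AMP k; have MN : (AM k).2 `<=` N by move=> x ?; exists k.
    rewrite -[N](setUidr MN) -!setDDl.
    by rewrite -e.
  apply/seteqP; split=> x /=.
    rewrite in_itv/= andbT patchE; case: ifPn => [/set_mem [Dx Nx]|/negP xD'] a_lt.
      have [k /andP[ak kf]] := rP _ _ a_lt.
      exists k => //; rewrite ak AMN.
      by case: ifP => _; [left|]; split=> //; split=> //=; rewrite in_itv/= kf.
    have [k /andP[ak k0]] := rP _ _ a_lt.
    by exists k => //; rewrite ak k0; right => /mem_set.
  move=> [k _]; case: ifPn => // ak; rewrite AMN in_itv/= andbT.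
  have D'f : ((D `&` f @^-1` `]r k, +oo[) `\` N) x -> a < (f \_ D') x.
    move=> [[Dx /=]]; rewrite in_itv/= andbT => kf Nx.
    by rewrite patchE mem_set//; exact: lt_trans kf.
  case: ifPn => [k0 [//|D'x]|_ //].
  by rewrite patchE memNset//; exact: lt_trans k0.
apply: bigcupT_measurable => q; have [mA _ _ _] := AMP q.
case: ifPn => // _; case: ifPn => // _; last exact: measurableD.
by apply: measurableU; [exact: measurableD|exact: measurableC].
Qed.
End lebesgue_borel.

(** * Barycentric coordinates on the simplex *)

Section barycentric.
Context {R : realType} {d : nat}.
Implicit Types (x y : 'rV[R]_d) (i j l : 'I_d.+1) (t : R).
Local Notation mu := (lebesgue_rV R d).
Local Notation S := (@simplex R d).

(** The coordinate of index 0 belongs to the origin, and the coordinate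
[lift ord0 k] to the k-th unit vector, as in the numbering of the vertices. *)
Definition bary x i : R :=
  oapp (fun k => x ord0 k) (1 - sumx x) (unlift ord0 i).

Lemma bary0 x : bary x ord0 = 1 - sumx x.
Proof. by rewrite /bary unlift_none. Qed.

Lemma baryS x (k : 'I_d) : bary x (lift ord0 k) = x ord0 k.
Proof. by rewrite /bary liftK. Qed.

Variant bary_index_spec : 'I_d.+1 -> Type :=
| BaryIndex0 : bary_index_spec ord0
| BaryIndexS (k : 'I_d) : bary_index_spec (lift ord0 k).

Lemma bary_indexP i : bary_index_spec i.
Proof. by case: (unliftP ord0 i) => [k|] ->; constructor. Qed.

Lemma sum_bary x : \sum_i bary x i = 1.
Proof.
rewrite big_ord_recl bary0 /sumx.
by under [X in _ + X]eq_bigr do rewrite baryS; rewrite subrK.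
Qed.

Definition edge i j : 'rV[R]_d := vertex j - vertex i.

Lemma sumxD x y t : sumx (x + t *: y) = sumx x + t * sumx y.
Proof.
by rewrite /sumx mulr_sumr -big_split/=; apply: eq_bigr => k _; rewrite !mxE.
Qed.

Lemma sumx_vertex i : sumx (vertex i) = 1 - (i == ord0)%:R :> R.
Proof.
rewrite /sumx; under eq_bigr do rewrite mxE.
have [|k] := bary_indexP i; first by rewrite subrr big1.
rewrite (bigD1 k)//= eqxx big1 ?addr0 ?subr0// => k' k'k.
by rewrite (inj_eq (@lift_inj _ ord0)) eq_sym (negbTE k'k).
Qed.

Lemma bary_edge x i j t l :
  bary (x + t *: edge i j) l = bary x l + t * ((l == j)%:R - (l == i)%:R).
Proof.
have [|k] := bary_indexP l.
  rewrite !bary0 sumxD /edge -[X in sumx (_ - X)]scale1r -scaleNr sumxD.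
  rewrite !sumx_vertex ![ord0 == _]eq_sym; ring.
by rewrite !baryS !mxE ![lift _ _ == _]eq_sym.
Qed.

(** Any two vertices are separated by a coordinate, which makes the slab
integration available along every edge. *)
Lemma edge_coord i j : i != j -> exists c, `|edge i j ord0 c| = 1.
Proof.
have [|c] := bary_indexP i.
  have [|c _] := bary_indexP j; first by rewrite eqxx.
  by exists c; rewrite !mxE eqxx subr0 normr1.
by move=> ij; exists c; rewrite !mxE eqxx eq_sym (negbTE ij) sub0r normrN normr1.
Qed.

Lemma simplexP x : S x <-> forall i, 0 <= bary x i.
Proof.
split=> [[x0 x1] i|h].
  by have [|k] := bary_indexP i; rewrite ?bary0 ?baryS ?subr_ge0.
split=> [k|]; first by rewrite -baryS.
by rewrite -subr_ge0 -bary0.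
Qed.

Definition osimplex : set 'rV[R]_d := [set x | forall i, 0 < bary x i].

Lemma osimplex_sub : osimplex `<=` S.
Proof. by move=> x xO; apply/simplexP => i; exact/ltW/xO. Qed.

Lemma bary_le1 x i : S x -> bary x i <= 1.
Proof.
move=> /simplexP x0; rewrite -(sum_bary x) (bigD1 i)//= lerDl.
exact: sumr_ge0.
Qed.

Lemma continuous_bary i : continuous (bary^~ i : 'rV[R]_d -> R).
Proof.
have cc (k : 'I_d) : continuous (fun x : 'rV[R]_d => x ord0 k).
  exact: coord_continuous.
have [|k] := bary_indexP i.
  rewrite (_ : bary^~ ord0 = (fun x => 1 - \sum_(k < d) x ord0 k)).
    move=> x; have cs : (\sum_(k < d) (y : 'rV[R]_d) ord0 k) @[y --> x] --> \sum_(k < d) x ord0 k.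
      exact: (cvg_big add_continuous (nbhs_filter x) (fun k _ => cc k x)).
    by have := cvgB (cvg_cst (1:R)) cs; apply.
  by apply/funext => x; exact: bary0.
by rewrite (_ : bary^~ _ = (fun x => x ord0 k)) //; apply/funext => x; exact: baryS.
Qed.

Lemma measurable_bary i : measurable_fun setT (bary^~ i : 'rV[R]_d -> R).
Proof.
have [|k] := bary_indexP i; last first.
  by under eq_fun do rewrite baryS; exact: measurable_coord.
under eq_fun do rewrite bary0 /sumx.
apply: measurable_funB => //; apply: measurable_sum => k.
exact: measurable_coord.
Qed.

Lemma open_osimplex : open osimplex.
Proof.
rewrite openE => x xO.
apply: (@filter_forall _ _ (fun i y => 0 < bary y i) (nbhs x) _) => i.
have ci := @continuous_bary i x; exact: (@cvgr_gt _ _ _ (nbhs_filter x) _ _ ci _ (xO i)).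
Qed.

Lemma osimplex_interior : osimplex `<=` S°.
Proof. by rewrite -open_subsetE; [exact: osimplex_sub|exact: open_osimplex]. Qed.

Lemma closed_simplex : closed S.
Proof.
rewrite (_ : S = \bigcap_(i in setT) ((bary^~ i) @^-1` [set t | 0 <= t])).
  apply: closed_bigI => i _; apply: preimage_closed; last exact: closed_ge.
  by move=> x _; exact: continuous_bary.
apply/seteqP; split=> x; first by move/simplexP=> h i _; exact: h.
by move=> h; apply/simplexP => i; exact: h.
Qed.

Lemma compact_simplex : compact S.
Proof.
apply: bounded_closed_compact closed_simplex.
exists 1; split => // M M1 x Sx; apply: le_trans (ltW M1).
rewrite [leLHS]mx_normrE; apply: bigmax_le => // -[u c] _ /=.
rewrite (ord1 u) -baryS ger0_norm; last by have /simplexP := Sx.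
exact: bary_le1.
Qed.

Lemma measurable_osimplex : measurable osimplex.
Proof. by apply: open_measurable_rV; exact: open_osimplex. Qed.

Lemma measurable_simplex : measurable S.
Proof.
rewrite -[S]setCK; apply: measurableC; apply: open_measurable_rV.
by rewrite openC; exact: closed_simplex.
Qed.

(** The boundary lies in the hyperplanes [bary x i = 0], and each of these is
crossed transversally by an edge through the vertex [i]; such an edge exists
since there are at least two vertices. *)
Lemma simplex_boundary_null : (0 < d)%N -> exists N, [/\ measurable N,
  mu N = 0%E & forall x, S x -> ~ N x -> osimplex x].
Proof.
move=> d0; have other i : exists l, l != i.
  by have [|k] := bary_indexP i; [exists (lift ord0 (Ordinal d0))|exists ord0].
exists (\bigcup_k [set x | bary x (inord k) = 0]).
have faceP i : measurable [set x | bary x i = 0] /\ mu [set x | bary x i = 0] = 0%E.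
  have [l li] := other i.
  have [|c vc] := @edge_coord i l; first by rewrite eq_sym.
  apply: (null_level_set vc (measurable_bary i) (s := -1)); first lra.
  by move=> x t; rewrite bary_edge eqxx eq_sym (negbTE li) sub0r.
split.
- by apply: bigcupT_measurable => k; have [] := faceP (inord k).
- apply/negligibleP; first by apply: bigcupT_measurable => k; have [] := faceP (inord k).
  by apply: negligible_bigcup => k; have [mF F0] := faceP (inord k); apply/negligibleP.
- move=> x /simplexP x0 Nx i; rewrite lt_neqAle x0 andbT eq_sym.
  by apply/eqP => xi; apply: Nx; exists i; rewrite //= inord_val.
Qed.

Lemma measurable_within (h : 'rV[R]_d -> R) :
  {within S, continuous h} -> measurable_fun S h.
Proof.
move=> ch; apply: (measurability _ (RGenOpens.measurableE R)).
move=> _ [_ [a [b ->] <-]].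
have : open (h @^-1` `]a, b[ : set (subspace S)) by exact: ((@continuousP (subspace S) R h).1 ch _ (interval_open _ _)).
move=> /open_subspaceP[U oU US]; rewrite setIC -US.
by apply: measurableI; [exact: open_measurable_rV|exact: measurable_simplex].
Qed.

Lemma continuous_at_osimplex (h : 'rV[R]_d -> R) x :
  {within S, continuous h} -> osimplex x -> {for x, continuous h}.
Proof.
move=> ch xO.
have : {within osimplex, continuous h} by apply: continuous_subspaceW ch; exact: osimplex_sub.
by rewrite continuous_open_subspace; [apply; exact: mem_set|exact: open_osimplex].
Qed.

Lemma bounded_on_simplex (h : 'rV[R]_d -> R) :
  {within S, continuous h} -> exists2 M, 0 <= M & forall x, S x -> `|h x| <= M.
Proof.
move=> ch; have /compact_bounded[M [_ hM]] := continuous_compact ch compact_simplex.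
exists (`|M| + 1); first by rewrite addr_ge0.
by move=> x Sx; apply: hM; [rewrite (le_lt_trans (ler_norm _))// ltrDl|exists x].
Qed.

Lemma uniform_on_simplex (h : 'rV[R]_d -> R) (e : R) : 0 < e ->
  {within S, continuous h} -> exists2 r, 0 < r & forall x y, S x -> S y ->
    ball x r y -> `|h x - h y| <= e.
Proof.
move=> e0 ch; have := compact_simplex; rewrite compact_near_coveringP => nc.
have /nc : forall x, S x -> \forall x' \near x & r \near 0^'+,
    S x' -> forall y, S y -> ball x' r y -> `|h x' - h y| <= e.
  move=> x Sx.
  have e20 : 0 < e / 2 by rewrite divr_gt0.
  have [r /= r0 rP] : exists2 r, 0 < r & forall y, ball x r y -> S y -> `|h x - h y| <= e / 2.
    have /subspace_continuousP/(_ _ Sx)/cvgr_dist_le/(_ _ e20) := ch.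
    rewrite near_withinE -nbhs_ballE => -[r /= r0 rP].
    by exists r => // y /rP.
  have r20 : 0 < r / 2 by rewrite divr_gt0.
  near=> x' r' => Sx' y Sy xy.
  have xx' : ball x (r / 2) x' by near: x'; exact: nbhsx_ballx.
  have r'r : r' < r / 2 by near: r'; exact: nbhs_right_lt.
  have xy' : ball x r y.
    by rewrite (splitr r); apply: ball_triangle xx' _; apply: le_ball xy; exact: ltW.
  rewrite (splitr e) -(subrKA (h x)) (le_trans (ler_normD _ _))// lerD//.
    by rewrite distrC; apply: rP => //; apply: le_ball xx'; lra.
  exact: rP.
move=> hn; have [r [r0 rP]] : exists r : R, 0 < r /\ S `<=` [set x | S x ->
   forall y, S y -> ball x r y -> `|h x - h y| <= e].
  near (0:R)^'+ => r; exists r; split; first by near: r; exact: nbhs_right_gt.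
  by near: r; exact: hn.
by exists r => // x y Sx Sy; exact: rP.
Unshelve. all: by end_near.
Qed.

Lemma measurable_box n (c e : R) :
  measurable [set x : 'rV[R]_n | forall k, c < x ord0 k < e].
Proof.
rewrite (_ : [set _ | _] =
    \bigcap_(k in setT) ((fun x : 'rV[R]_n => x ord0 k) @^-1` `]c, e[)).
  apply: fin_bigcap_measurable => // i _; rewrite -[_ @^-1` _]setTI.
  by apply: measurable_coord => //; exact: measurable_itv.
apply/seteqP; split=> x h i; first by move=> _; rewrite /= in_itv/=; exact: h.
by have := h i Logic.I; rewrite /= in_itv.
Qed.

Lemma lebesgue_box_gt0 n (c e : R) : c < e ->
  (0 < lebesgue_rV R n [set x : 'rV[R]_n | forall k, (c < x ord0 k < e)%R])%E.
Proof.
move=> ce; elim: n => [|n IH].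
  rewrite (_ : [set _ | _] = setT) /=; first by rewrite diracT lte01.
  by apply/seteqP; split=> x // _ [].
set box := [set x : 'rV[R]_n | forall k, c < x ord0 k < e].
rewrite -/box in IH.
have mbox := measurable_box (n := n) c e.
rewrite /= /lebesgue_cons /pushforward.
rewrite (_ : _ @^-1` _ = `]c, e[%classic `*` box).
  rewrite product_measure1E//= lebesgue_measure_itv/= lte_fin ce mule_gt0// lte_fin.
  by rewrite subr_gt0.
apply/seteqP; split=> -[t x] /=.
  move=> h; split.
    by have := h ord0; rewrite mxE; case: splitP => // k _; rewrite mxE (ord1 k) eqxx mulr1n in_itv.
  move=> i; have := h (lift ord0 i); rewrite mxE; case: splitP => [[[]]//|k /= ik].
  by have -> : i = k by apply/val_inj; case: ik.
rewrite in_itv/= => -[ht hx] i; rewrite mxE; case: splitP => k _; last exact: hx.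
by rewrite mxE (ord1 k) eqxx mulr1n.
Qed.

(** The open simplex contains the cube with side [1 / d.+1]. *)
Lemma osimplex_gt0 : (0 < mu osimplex)%E.
Proof.
have d0 : 0 < d.+1%:R^-1 :> R by rewrite invr_gt0.
apply: lt_le_trans (lebesgue_box_gt0 d d0) _.
apply: le_measure; rewrite ?inE; last first.
- move=> x hx i; have [|k] := bary_indexP i; last by rewrite baryS; have /andP[] := hx k.
  rewrite bary0 subr_gt0 /sumx (@le_lt_trans _ _ (\sum_(i < d) d.+1%:R^-1))//.
    by apply: ler_sum => k _; have /andP[_ /ltW] := hx k.
  by rewrite sumr_const card_ord -[d.+1%:R^-1 *+ d]mulr_natl ltr_pdivrMr// mul1r ltr_nat.
- exact: measurable_osimplex.
- exact: measurable_box.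
Qed.
End barycentric.

(** * Multinomial means and Bernstein polynomials *)

Section multinomial_mean.
Context {R : realFieldType} {I : finType}.
Implicit Types (X : I -> R) (k : {ffun I -> nat}) (h : {ffun I -> nat} -> R).

Definition incr k i : {ffun I -> nat} := [ffun l => (k l + (l == i))%N].
Definition decr k i : {ffun I -> nat} := [ffun l => (k l - (l == i))%N].
Definition deg k := (\sum_i k i)%N.

Lemma decr_incr k i : decr (incr k i) i = k.
Proof. by apply/ffunP => l; rewrite !ffunE addnK. Qed.

Lemma incr_decr k i : (0 < k i)%N -> incr (decr k i) i = k.
Proof.
move=> ki; apply/ffunP => l; rewrite !ffunE subnK//.
by case: eqVneq => // ->.
Qed.

Lemma decr_incrC k i j : (0 < k i)%N -> decr (incr k j) i = incr (decr k i) j.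
Proof.
move=> ki; apply/ffunP => l; rewrite !ffunE; have [->|] := eqVneq l i; last first.
  by rewrite !subn0.
by rewrite addnC -addnBA// addnC.
Qed.

Lemma deg_incr k i : deg (incr k i) = (deg k).+1.
Proof.
rewrite /deg (bigD1 i)//= [in RHS](bigD1 i)//= ffunE eqxx addn1 addSn.
by congr (_ + _).+1; apply: eq_bigr => j ji; rewrite ffunE (negbTE ji) addn0.
Qed.

(** The expectation of [h] under the multinomial law with [n] trials and
probabilities [X], obtained by conditioning on the first trial. This recursion
makes linearity, positivity and the moment formulas immediate inductions. *)
Fixpoint mmean X n h : R :=
  if n is n'.+1 then \sum_i X i * mmean X n' (fun k => h (incr k i))
  else h [ffun=> 0%N].

Lemma mmeanS X n h :
  mmean X n.+1 h = \sum_i X i * mmean X n (fun k => h (incr k i)).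
Proof. by []. Qed.

Lemma eq_mmean X n h h' : (forall k, deg k = n -> h k = h' k) ->
  mmean X n h = mmean X n h'.
Proof.
elim: n h h' => [|n IH] h h' hh' /=.
  by apply: hh'; rewrite /deg big1// => i; rewrite ffunE.
apply: eq_bigr => i _; congr (_ * _); apply: IH => k kn.
by apply: hh'; rewrite deg_incr kn.
Qed.

Lemma mmeanD X n h h' : mmean X n (fun k => h k + h' k) = mmean X n h + mmean X n h'.
Proof.
elim: n h h' => [//|n IH] h h' /=; rewrite -big_split/=.
by apply: eq_bigr => i _; rewrite IH mulrDr.
Qed.

Lemma mmeanZ X n c h : mmean X n (fun k => c * h k) = c * mmean X n h.
Proof.
elim: n h => [//|n IH] h /=; rewrite mulr_sumr.
by apply: eq_bigr => i _; rewrite IH mulrCA.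
Qed.

Lemma mmeanB X n h h' : mmean X n (fun k => h k - h' k) = mmean X n h - mmean X n h'.
Proof.
rewrite -mulN1r -mmeanZ -mmeanD; apply: eq_mmean => k _; ring.
Qed.

Lemma mmean_sum X n (J : finType) (P : pred J) (h : J -> {ffun I -> nat} -> R) :
  mmean X n (fun k => \sum_(j | P j) h j k) = \sum_(j | P j) mmean X n (h j).
Proof.
elim: n h => [//|n IH] h /=; under eq_bigr do rewrite IH mulr_sumr.
by rewrite exchange_big.
Qed.

Lemma ler_mmean X n h h' : (forall i, 0 <= X i) ->
  (forall k, deg k = n -> h k <= h' k) -> mmean X n h <= mmean X n h'.
Proof.
move=> X0; elim: n h h' => [|n IH] h h' hh' /=.
  by apply: hh'; rewrite /deg big1// => i; rewrite ffunE.
apply: ler_sum => i _; apply: ler_wpM2l => //; apply: IH => k kn.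
by apply: hh'; rewrite deg_incr kn.
Qed.

Lemma mmean_cst X n c : \sum_i X i = 1 -> mmean X n (fun=> c) = c.
Proof.
by move=> X1; elim: n => [//|n IH] /=; under eq_bigr do rewrite IH; rewrite -mulr_suml X1 mul1r.
Qed.

Lemma ler_norm_mmean X n h : (forall i, 0 <= X i) ->
  `|mmean X n h| <= mmean X n (fun k => `|h k|).
Proof.
move=> X0; rewrite ler_norml -mulN1r -mmeanZ; apply/andP; split; apply: ler_mmean => // k _.
  by rewrite mulN1r lerNl -normrN ler_norm.
exact: ler_norm.
Qed.

(** Size biasing: for a multinomial vector k with n + 1 trials, the weight k_i
counts the trials with outcome i, and removing one of them leaves a multinomial
vector with n trials. *)
Lemma mmean_decr X n h : \sum_i X i = 1 ->
  mmean X n.+1 (fun k => \sum_i (k i)%:R * h (decr k i)) = n.+1%:R * mmean X n h.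
Proof.
move=> X1; elim: n h => [|n IH] h.
  rewrite /= mulr1n -[X in _ = X * _]X1 mulr_suml; apply: eq_bigr => i _; congr (_ * _).
  rewrite (bigD1 i)//= !ffunE eqxx add0n decr_incr big1 ?addr0 ?mul1r// => j ji.
  by rewrite !ffunE (negbTE ji) mul0r.
rewrite mmeanS.
transitivity (\sum_i X i * (mmean X n.+1 h + n.+1%:R * mmean X n (fun k => h (incr k i)))).
  apply: eq_bigr => i _; congr (_ * _); rewrite -IH -mmeanD.
  apply: eq_mmean => k _.
  rewrite (bigD1 i)//= [in RHS](bigD1 i)//= !ffunE eqxx decr_incr natrD.
  rewrite [in RHS]addrA; congr (_ + _).
    have [k0|k0] := posnP (k i); first by rewrite k0 mul0r addr0 add0r mul1r.
    by rewrite incr_decr// mulrDl mul1r addrC.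
  apply: eq_bigr => j ji; rewrite ffunE (negbTE ji) addn0.
  have [->|k0] := posnP (k j); first by rewrite !mul0r.
  by rewrite decr_incrC.
under eq_bigr do rewrite mulrDr mulrCA; rewrite big_split/= -mulr_suml X1 -mulr_sumr.
by rewrite -[X in _ = X * _]natr1; ring.
Qed.

Lemma mmean_coord X n i : \sum_j X j = 1 -> mmean X n (fun k => (k i)%:R) = n%:R * X i.
Proof.
move=> X1; elim: n => [|n IH]; first by rewrite /= ffunE mul0r.
rewrite mmeanS.
transitivity (\sum_j (X j * (n%:R * X i) + X j * (i == j)%:R)).
  apply: eq_bigr => j _; rewrite -mulrDr -IH; congr (_ * _).
  rewrite -[X in _ = _ + X](@mmean_cst X n)// -mmeanD; apply: eq_mmean => k _.
  by rewrite ffunE natrD.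
rewrite big_split/= -mulr_suml X1 (bigD1 i)//= eqxx mulr1 big1 ?addr0 => [|j ji].
  by rewrite -natr1; ring.
by rewrite eq_sym (negbTE ji) ?mulr0 ?mul0r.
Qed.

Lemma mmean_coord2 X n i : \sum_j X j = 1 ->
  mmean X n (fun k => (k i)%:R ^+ 2) = n%:R * (n%:R - 1) * X i ^+ 2 + n%:R * X i.
Proof.
move=> X1; elim: n => [|n IH]; first by rewrite /= ffunE; ring.
rewrite mmeanS.
transitivity (\sum_j (X j * (mmean X n (fun k => (k i)%:R ^+ 2)) + X j * (i == j)%:R * (2 * n%:R * X i + 1))).
  apply: eq_bigr => j _; rewrite -mulrA -mulrDr; congr (_ * _).
  rewrite -mulrA -(mmean_coord n i X1) -[X in _ * (_ + X)](@mmean_cst X n)//.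
  rewrite -mmeanZ -mmeanD -mmeanZ -mmeanD; apply: eq_mmean => k _.
  by rewrite ffunE natrD; case: (i == j) => /=; ring.
rewrite big_split/= -!mulr_suml X1 IH (bigD1 i)//= eqxx mulr1 big1 ?addr0 => [|j ji].
  by rewrite -natr1; ring.
by rewrite eq_sym (negbTE ji) ?mulr0 ?mul0r.
Qed.

Definition multinom k : R := (deg k)`!%:R / \prod_i (k i)`!%:R.
Definition monom X k : R := \prod_i X i ^+ k i.

Lemma monom_incr X k i : monom X (incr k i) = X i * monom X k.
Proof.
rewrite /monom (bigD1 i)//= [in RHS](bigD1 i)//= ffunE eqxx addn1 exprS mulrA.
congr (_ * _); apply: eq_bigr => j ji; by rewrite ffunE (negbTE ji) addn0.
Qed.

Lemma multinom_incr k i :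
  multinom (incr k i) * (k i).+1%:R = multinom k * (deg k).+1%:R.
Proof.
have f0 (n : nat) : n`!%:R != 0 :> R by rewrite pnatr_eq0 -lt0n fact_gt0.
rewrite /multinom deg_incr (bigD1 i)//= [in RHS](bigD1 i)//= ffunE eqxx addn1.
rewrite !factS !natrM.
rewrite (eq_bigr (fun j => (k j)`!%:R)); last first.
  by move=> j ji; rewrite ffunE (negbTE ji) addn0.
field.
apply/andP; split; first by apply/prodf_neq0 => j _; exact: f0.
by rewrite f0 nat1r pnatr_eq0.
Qed.

Lemma deg_eq0 k : (deg k == 0%N) = (k == [ffun=> 0%N]).
Proof.
rewrite /deg sum_nat_eq0; apply/forallP/eqP => [k0|-> i]; last by rewrite ffunE.
by apply/ffunP => i; rewrite ffunE; exact/eqP/k0.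
Qed.

(** The point masses of the multinomial law, which identify the recursive
definition with the explicit sum over multi-indices. *)
Lemma mmean_delta X n k :
  mmean X n (fun m => (m == k)%:R) = (deg k == n)%:R * (multinom k * monom X k).
Proof.
elim: n k => [|n IH] k.
  rewrite /= eq_sym deg_eq0; case: eqP => [->|_]; last by rewrite mul0r.
  rewrite /multinom /monom !big1 => [|i _|i _]; rewrite ?ffunE ?fact0 ?expr0//.
  by rewrite (_ : deg _ = 0%N) ?divr1 ?mulr1//; apply/eqP; rewrite deg_eq0.
rewrite mmeanS.
have n1 : n.+1%:R != 0 :> R by rewrite pnatr_eq0.
transitivity (\sum_i (k i)%:R * ((deg k == n.+1)%:R * (multinom k * monom X k) / n.+1%:R)).
  apply: eq_bigr => i _; have [k0|k0] := posnP (k i).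
    rewrite k0 mul0r (_ : mmean _ _ _ = mmean X n (fun k => 0 * 0)).
      by rewrite mmeanZ mul0r mulr0.
    apply: eq_mmean => m _; rewrite mulr0; case: eqP => // mk.
    by move: k0; rewrite -mk ffunE eqxx addn1.
  have kE := incr_decr k0; set k' := decr k i in kE.
  rewrite (_ : mmean _ _ _ = mmean X n (fun m => (m == k')%:R)); last first.
    apply: eq_mmean => m _; congr (_ %:R); congr nat_of_bool.
    apply/eqP/eqP => [mk|->//]; by rewrite /k' -mk decr_incr.
  have := multinom_incr k' i; rewrite IH -kE deg_incr eqSS monom_incr => E.
  have [dk|_] := eqVneq (deg k') n; last by rewrite !mul0r !mulr0.
  have -> : multinom k' = multinom (incr k' i) * (k' i).+1%:R / n.+1%:R.
    by rewrite E dk mulfK.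
  rewrite [incr k' i i]ffunE eqxx addn1 /=.
  ring.
rewrite -mulr_suml -natr_sum -/(deg k).
have [->|_] := eqVneq (deg k) n.+1; last by rewrite !mul0r mulr0.
by field.
Qed.
End multinomial_mean.

Section bernstein_mean.
Context {R : realType} {d : nat}.
Implicit Types (x y : 'rV[R]_d) (l : 'I_d.+1).

(** The multi-index completed by the exponent [n - |k|] of [1 - |x|], placed at
the index 0 of the corresponding barycentric coordinate. *)
Definition full_index n (k : {ffun 'I_d -> 'I_n.+1}) : {ffun 'I_d.+1 -> nat} :=
  [ffun i => oapp (fun j => k j : nat) (n - \sum_j k j)%N (unlift ord0 i)].

Lemma full_index0 n (k : {ffun 'I_d -> 'I_n.+1}) :
  full_index k ord0 = (n - \sum_j k j)%N.
Proof. by rewrite ffunE unlift_none. Qed.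

Lemma full_indexS n (k : {ffun 'I_d -> 'I_n.+1}) j :
  full_index k (lift ord0 j) = k j.
Proof. by rewrite ffunE liftK. Qed.

Lemma deg_full_index n (k : {ffun 'I_d -> 'I_n.+1}) : (\sum_j k j <= n)%N ->
  deg (full_index k) = n.
Proof.
move=> kn; rewrite /deg big_ord_recl full_index0.
by under [X in (_ + X)%N]eq_bigr do rewrite full_indexS; rewrite subnK.
Qed.

Lemma full_index_inj n : injective (@full_index n).
Proof.
move=> k k' kk'; apply/ffunP => j; apply/val_inj.
by rewrite -[LHS](full_indexS k) kk' full_indexS.
Qed.

Lemma full_index_surj n (m : {ffun 'I_d.+1 -> nat}) : deg m = n ->
  exists2 k : {ffun 'I_d -> 'I_n.+1}, (\sum_j k j <= n)%N & full_index k = m.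
Proof.
rewrite /deg big_ord_recl => mn.
have mj j : (m (lift ord0 j) < n.+1)%N.
  by rewrite ltnS -mn (bigD1 j)//= addnCA leq_addr.
have kE : (\sum_j m (lift ord0 j) = \sum_j [ffun j => Ordinal (mj j)] j)%N.
  by apply: eq_bigr => j _; rewrite ffunE.
exists [ffun j => Ordinal (mj j)]; first by rewrite -kE -mn leq_addl.
apply/ffunP => i; have [|j] := bary_indexP i; last by rewrite full_indexS ffunE.
by rewrite full_index0 -kE -mn addnK.
Qed.

Lemma bernsteinE n (k : {ffun 'I_d -> 'I_n.+1}) x : (\sum_j k j <= n)%N ->
  bernstein k x = multinom (full_index k) * monom (bary x) (full_index k).
Proof.
move=> kn; rewrite /bernstein /multinom deg_full_index// /monom !big_ord_recl.
rewrite bary0 full_index0.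
rewrite [X in _ = _ / (_ * X) * _](eq_bigr (fun j => (k j)`!%:R)) => [|j _]; last by rewrite full_indexS.
rewrite [X in _ = _ * (_ * X)](eq_bigr (fun j => x ord0 j ^+ k j)) => [|j _]; last first.
  by rewrite full_indexS baryS.
by rewrite natrM natr_prod [X in _ / X]mulrC -mulrA [X in _ * X]mulrC.
Qed.

Lemma sum_bernstein n x h :
  \sum_(k : {ffun 'I_d -> 'I_n.+1} | (\sum_(i < d) k i <= n)%N)
    bernstein k x * h (full_index k) = mmean (bary x) n h.
Proof.
rewrite (@eq_mmean _ _ _ _ h (fun m =>
  \sum_(k : {ffun 'I_d -> 'I_n.+1} | (\sum_(i < d) k i <= n)%N)
    h (full_index k) * (m == full_index k)%:R)); last first.
  move=> m mn; have [k kn <-] := full_index_surj mn.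
  rewrite (bigD1 k)//= eqxx mulr1 big1 ?addr0// => k' /andP[_ k'k].
  by rewrite (inj_eq (@full_index_inj n)) eq_sym (negbTE k'k) mulr0.
rewrite mmean_sum; apply: eq_bigr => k kn.
by rewrite mmeanZ mmean_delta deg_full_index// eqxx mul1r bernsteinE// mulrC.
Qed.
End bernstein_mean.

(** * A fundamental theorem of calculus on open intervals *)

(** The integrands below blow up at the end points of the interval, whereas the
primitive only has limits there. The compact intervals [E k] exhaust the open
interval, and the formula passes to the limit by monotone convergence. *)
Section open_FTC.
Context {R : realType}.
Local Notation mu := (@lebesgue_measure R).
Variables (f F : R -> R) (a b l m : R).
Hypotheses (ab : a < b)
  (dF : forall t, t \in `]a, b[ -> is_derive t 1 F (f t))
  (cf : forall t, t \in `]a, b[ -> {for t, continuous f})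
  (Fa : F t @[t --> a^'+] --> l) (Fb : F t @[t --> b^'-] --> m).

(* The factor 1/3 keeps [E k] nonempty for every k. *)
Let dlt (k : nat) : R := (b - a) / 3 / k.+1%:R.

Let dlt_gt0 k : 0 < dlt k.
Proof. by rewrite !divr_gt0// subr_gt0. Qed.

Let dlt_le k k' : (k <= k')%N -> dlt k' <= dlt k.
Proof.
move=> kk'; rewrite ler_pM2l ?divr_gt0 ?subr_gt0//.
by rewrite lef_pV2 ?posrE// ler_nat.
Qed.

Let dlt_cvg : dlt k @[k --> \oo] --> 0.
Proof.
rewrite -[X in _ --> X](mulr0 ((b - a) / 3)); apply: cvgM; first exact: cvg_cst.
exact: cvg_harmonic.
Qed.

Let E k : set R := `[a + dlt k, b - dlt k]%classic.

Let E_lt k : a + dlt k < b - dlt k.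
Proof.
have := dlt_le (leq0n k); rewrite {2}/dlt divr1; have := ab; lra.
Qed.

Let EP k x : E k x <-> a + dlt k <= x <= b - dlt k.
Proof. by rewrite /E /= in_itv. Qed.

Let EU : \bigcup_k E k = `]a, b[%classic.
Proof.
apply/seteqP; split=> [x [k _ /EP/andP[h1 h2]]|x]; rewrite /= !in_itv/=.
  by have h0 := dlt_gt0 k; apply/andP; split; lra.
move=> /andP[ax xb].
have := cvgr_lt _ dlt_cvg (Num.min (x - a) (b - x)).
rewrite lt_min !subr_gt0 ax xb => /(_ _ isT)[k _ /(_ k (leqnn k))/=].
rewrite lt_min => /andP[h1 h2]; exists k => //=.
by apply/EP/andP; split; lra.
Qed.

Let EnD : nondecreasing_seq E.
Proof.
move=> k k' kk'; apply/subsetPset => x /EP/andP[h1 h2]; apply/EP.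
by have := dlt_le kk' => h0; apply/andP; split; lra.
Qed.

Let sub_ab k x : x \in `[a + dlt k, b - dlt k] -> x \in `]a, b[.
Proof.
by rewrite !in_itv/= => /andP[? ?]; have := dlt_gt0 k => ?; apply/andP; split; lra.
Qed.

Let integral_E k : (\int[mu]_(x in E k) (f x)%:E =
  (F (b - dlt k))%:E - (F (a + dlt k))%:E)%E.
Proof.
have cF x : x \in `]a, b[ -> {for x, continuous F}.
  move=> xab; apply: differentiable_continuous; apply/derivable1_diffP.
  by have [] := dF xab.
apply: continuous_FTC2 => //.
- apply: continuous_in_subspaceT => x /set_mem/= xk; apply: cf; exact: sub_ab xk.
- split.
  + move=> x xk; have [|] := @dF x; last by [].
    by apply: (@sub_ab k); apply: subset_itv_oo_cc xk.
  + apply: cvg_at_right_filter; apply: cF; apply: (@sub_ab k).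
    by rewrite in_itv/= lexx ltW.
  + apply: cvg_at_left_filter; apply: cF; apply: (@sub_ab k).
    by rewrite in_itv/= lexx ltW.
- move=> x xk; rewrite derive1E; have [] := @dF x; last by [].
  by apply: (@sub_ab k); apply: subset_itv_oo_cc xk.
Qed.

Let cvg_E : (\int[mu]_(x in E k) (f x)%:E)%E @[k --> \oo] --> (m - l)%:E.
Proof.
under eq_fun do rewrite integral_E -EFinB.
apply: cvg_EFin; first by near=> k.
apply: cvgB.
  move/cvg_at_leftP: Fb; apply; split=> [k|]; first by rewrite gtrBl.
  by rewrite -[X in _ --> X]subr0; apply: cvgB; [exact: cvg_cst|exact: dlt_cvg].
move/cvg_at_rightP: Fa; apply; split=> [k|]; first by rewrite ltrDl.
by rewrite -[X in _ --> X]addr0; apply: cvgD; [exact: cvg_cst|exact: dlt_cvg].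
Unshelve. all: by end_near.
Qed.

Let mfab : measurable_fun `]a, b[ f.
Proof.
apply: open_continuous_measurable_fun; first exact: interval_open.
by move=> x /set_mem; exact: cf.
Qed.

Let mE k : measurable (E k).
Proof. exact: measurable_itv. Qed.

(** For nonnegative [f] integrability is part of the conclusion; the version for
a signed [f] below assumes it. *)
Lemma ge0_integral_itvoo_FTC : (forall t, t \in `]a, b[ -> 0 <= f t) ->
  (\int[mu]_(t in `]a, b[) (f t)%:E = (m - l)%:E)%E.
Proof.
move=> f0; apply: cvg_unique cvg_E => //.
rewrite -EU; apply: ge0_nondecreasing_set_cvg_integral => //.
- by move=> k; apply/measurable_EFinP; apply: measurable_funS mfab => // x; exact: sub_ab.
- by move=> k x /sub_ab/f0; rewrite lee_fin.
Qed.

Lemma integral_itvoo_FTC : mu.-integrable `]a, b[ (EFin \o f) ->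
  (\int[mu]_(t in `]a, b[) (f t)%:E = (m - l)%:E)%E.
Proof.
move=> fi; apply: cvg_unique cvg_E => //.
have mf : measurable_fun `]a, b[ (EFin \o f) by exact/measurable_EFinP.
rewrite integralE.
rewrite (_ : (fun k => _) = (fun k => \int[mu]_(x in E k) (EFin \o f)^\+ x -
  \int[mu]_(x in E k) (EFin \o f)^\- x)%E); last first.
  by apply/funext => k; rewrite integralE.
apply: cvgeB.
- apply: fin_num_adde_defl; rewrite fin_numN; apply: integrable_fin_num => //.
  exact: integrable_funeneg.
- rewrite -EU; apply: ge0_nondecreasing_set_cvg_integral => //.
  by move=> k; apply: measurable_funepos; apply: measurable_funS mf => // x; exact: sub_ab.
- rewrite -EU; apply: ge0_nondecreasing_set_cvg_integral => //.
  by move=> k; apply: measurable_funeneg; apply: measurable_funS mf => // x; exact: sub_ab.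
Qed.
End open_FTC.

(** * Directional derivatives *)

Section directional.
Context {R : realType} {V : normedModType R}.
Implicit Types (x u v : V) (g : V -> R).

Lemma is_derive_line x v g t l :
  is_derive (x + t *: v) v g l <->
  is_derive (t : R) (1 : R) (fun s => g (x + s *: v)) l.
Proof.
have E : (fun h : R => h^-1 *: ((g \o shift (x + t *: v)) (h *: v) - g (x + t *: v))) =
    (fun h : R => h^-1 *: (((fun s => g (x + s *: v)) \o shift t) (h *: (1:R)) -
       g (x + t *: v))).
  apply/funext => h /=; congr (_ *: (g _ - _)).
  by rewrite [h *: 1]mulr1 scalerDl addrCA.
by split=> -[dg gl]; apply: DeriveDef; move: dg gl; rewrite /derivable /derive E.
Qed.

Lemma is_derive_line0 x v g l :
  is_derive x v g l <-> is_derive (0 : R) (1 : R) (fun s => g (x + s *: v)) l.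
Proof. by rewrite -is_derive_line scale0r addr0. Qed.

Lemma is_derive_scale_dir x v g l c :
  is_derive x v g l -> is_derive x (c *: v) g (c * l).
Proof.
rewrite !is_derive_line0 => dl.
rewrite (_ : (fun s => g _) = (fun s => g (x + s *: v)) \o (fun s => s * c)).
  rewrite mulrC; apply: is_derive1_comp; first by rewrite mul0r.
  have := is_deriveM (is_derive_id (0:R) 1) (is_derive_cst c (0:R) 1).
  by rewrite scaler0 add0r [_ *: _]mulr1.
by apply/funext => s /=; rewrite scalerA.
Qed.

Lemma mean_value_le (phi dphi : R -> R) (h L e : R) :
  (forall s, `|s| <= `|h| -> is_derive s (1 : R) phi (dphi s)) ->
  (forall s, `|s| <= `|h| -> `|dphi s - L| <= e) ->
  `|phi h - phi 0 - L * h| <= e * `|h|.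
Proof.
move=> dp pe.
have cphi s : `|s| <= `|h| -> {for s, continuous phi}.
  move=> sh; apply: differentiable_continuous; apply/derivable1_diffP.
  by have [] := dp s sh.
have [h0|h0] := leP 0 h.
  have sE s : s \in `[0, h] -> `|s| <= `|h|.
    by rewrite in_itv/= => /andP[s0 sh]; rewrite !ger0_norm.
  have [||s s0 ->] := @MVT_segment _ phi dphi 0 h h0.
  - by move=> s /subset_itv_oo_cc /sE; exact: dp.
  - by apply: continuous_in_subspaceT => z /set_mem/sE; exact: cphi.
  rewrite subr0 -mulrBl normrM ler_wpM2r//; apply: pe; exact: sE.
have sE s : s \in `[h, 0] -> `|s| <= `|h|.
  by rewrite in_itv/= => /andP[s0 sh]; rewrite !ler0_norm ?lerN2// ltW.
have [||s s0 E] := @MVT_segment _ phi dphi h 0 (ltW h0).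
- by move=> s /subset_itv_oo_cc /sE; exact: dp.
- by apply: continuous_in_subspaceT => z /set_mem/sE; exact: cphi.
rewrite -[phi h - _]opprB E sub0r mulrN opprK -mulrBl normrM ler_wpM2r//.
by apply: pe; exact: sE.
Qed.

(** Additivity in the direction without differentiability of [g]: it is enough
that the derivative along [u] exists near [x] and is continuous at [x]. The
increment along [u], starting from [x + h *: v], is handled by the mean value
theorem. *)
Lemma is_derive_add_dir x u v g (A : V -> R) B :
  (\forall y \near x, is_derive y u g (A y)) -> {for x, continuous A} ->
  is_derive x v g B -> is_derive x (u + v) g (A x + B).
Proof.
move=> dA cA [dB vB].
have cB : h^-1 *: ((g \o shift x) (h *: v) - g x) @[h --> (0:R)^'] --> B.
  by rewrite -vB; exact: dB.
suff cAB : h^-1 *: ((g \o shift x) (h *: (u + v)) - g x) @[h --> (0:R)^'] --> A x + B.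
  by apply: DeriveDef; [apply/cvg_ex; exists (A x + B)|exact: cvg_lim cAB].
(* The difference quotient along [u + v] splits into one along [u] from the
   moving point [x + h *: v] and one along [v] from [x]. *)
have cA' : h^-1 *: ((g \o shift x) (h *: (u + v)) - (g \o shift x) (h *: v)) @[h --> (0:R)^'] --> A x.
  apply/cvgrPdist_le => e e0.
  have [r /= r0 rP] : exists2 r, 0 < r & forall y, ball x r y ->
      is_derive y u g (A y) /\ `|A x - A y| <= e.
    have /cvgrPdist_le/(_ _ e0) cAe := cA.
    have H : nbhs x (fun y => is_derive y u g (A y) /\ `|A x - A y| <= e).
      exact: filterI dA cAe.
    move: H => /nbhs_ballP[r r0 rP]; by exists r.
  have w0 : 0 < `|u| + `|v| + 1 by rewrite ltr_pwDr// addr_ge0.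
  near=> h.
  have h0 : h != 0 by near: h; exact: nbhs_dnbhs_neq.
  have hr : `|h| * (`|u| + `|v| + 1) < r.
    rewrite -ltr_pdivlMr//; near: h; apply: dnbhs0_lt; exact: divr_gt0.
  have inB s : `|s| <= `|h| -> ball x r (x + h *: v + s *: u).
    move=> sh; rewrite -ball_normE /= -addrA opprD addrA subrr sub0r normrN.
    rewrite (le_lt_trans (ler_normD _ _))//; apply: le_lt_trans hr.
    rewrite !normrZ (@le_trans _ _ (`|h| * `|v| + `|h| * `|u|))//.
      by rewrite lerD2l ler_wpM2r.
    by rewrite -mulrDr ler_wpM2l// addrC lerDl.
  have := @mean_value_le (fun s => g (x + h *: v + s *: u))
    (fun s => A (x + h *: v + s *: u)) h (A x) e.
  have d1 (s : R) : `|s| <= `|h| -> is_derive s (1 : R) (fun s : R => g (x + h *: v + s *: u)) (A (x + h *: v + s *: u)).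
    by move=> /inB /rP[dg _]; apply/is_derive_line.
  have d2 (s : R) : `|s| <= `|h| -> `|A (x + h *: v + s *: u) - A x| <= e.
    by move=> /inB /rP[_]; rewrite distrC.
  move=> /(_ d1 d2) {d1 d2}.
  rewrite scale0r addr0 /= (scalerDr h u v) [x + h *: v]addrC.
  rewrite (addrC (h *: v + x)) addrA => H.
  rewrite -(ler_pM2r (x := `|h|)) ?normr_gt0// -normrM.
  apply: le_trans H; rewrite le_eqVlt; apply/orP; left; rewrite -normrN.
  apply/eqP; congr `|_|; rewrite mulrBl opprB [_ *: _]mulrC.
  by rewrite divfK.
rewrite (_ : (fun h : R => _) = (fun h : R => h^-1 *: ((g \o shift x) (h *: (u + v)) -
    (g \o shift x) (h *: v))) + (fun h : R => h^-1 *: ((g \o shift x) (h *: v) - g x))).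
  exact: cvgD cA' cB.
by apply/funext => h; apply: etrans _ (scalerDr _ _ _); rewrite subrKA.
Unshelve. all: by end_near.
Qed.
End directional.

(** * Integrability of the Jacobi weight *)

Section beta_bound.
Context {R : realType}.
Local Notation mu := (@lebesgue_measure R).

(** On [s / 2, s] the power function is comparable to its value at [s], whatever
the sign of the exponent. *)
Lemma powR_half (s r q : R) : 0 < s -> s / 2 <= r <= s ->
  r `^ q <= 2 `^ `|q| * s `^ q.
Proof.
move=> s0 /andP[sr rs]; have r0 : 0 < r by apply: lt_le_trans sr; rewrite divr_gt0.
have h1 : 1 <= 2 `^ `|q| :> R by rewrite -[leLHS](powRr0 2) ler_powR// ler1n.
have [q0|q0] := leP 0 q.
  apply: (@le_trans _ _ (s `^ q)); first by rewrite ge0_ler_powR// nnegrE ltW.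
  by rewrite ler_peMl// powR_ge0.
rewrite ltr0_norm// -(opprK q) powRN (powRN s) opprK; set c := - q.
have c0 : 0 < c by rewrite oppr_gt0.
rewrite ler_pdivlMr ?powR_gt0// mulrC ler_pdivrMr ?powR_gt0//.
rewrite -(powRM c (ler0n _ 2) (ltW r0)) ge0_ler_powR ?nnegrE ?(ltW c0) ?(ltW s0)//.
  by rewrite mulr_ge0// ltW.
by move: sr; rewrite ler_pdivrMr// mulrC.
Qed.

Lemma cvg_sub_at_right (a : R) : (t - a) @[t --> a^'+] --> 0^'+.
Proof.
move=> A [e /= e0 eA]; exists e => //= t; rewrite /ball/= => at_ ta.
by apply: eA; rewrite /= ?subr_gt0// sub0r normrN distrC.
Qed.

Lemma cvg_sub_at_left (b : R) : (b - t) @[t --> b^'-] --> 0^'+.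
Proof.
move=> A [e /= e0 eA]; exists e => //= t; rewrite /ball/= => bt tb.
by apply: eA; rewrite /= ?subr_gt0// sub0r normrN.
Qed.

Lemma powR_cvg_right (a c : R) : 0 < c -> (t - a) `^ c @[t --> a^'+] --> 0.
Proof. by move=> c0; apply: (cvg_comp _ _ (@cvg_sub_at_right a) (powR_cvg0 c0)). Qed.

Lemma powR_cvg_left (b c : R) : 0 < c -> (b - t) `^ c @[t --> b^'-] --> 0.
Proof. by move=> c0; apply: (cvg_comp _ _ (@cvg_sub_at_left b) (powR_cvg0 c0)). Qed.

Lemma is_derive_powR_shift (a c t : R) : a < t ->
  is_derive t 1 (fun t => (t - a) `^ c) (c * (t - a) `^ (c - 1)).
Proof.
move=> at_; have d1 : is_derive t 1 (fun t : R => t - a) 1.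
  by apply: is_derive_eq; rewrite subr0.
have d2 : is_derive (t - a) 1 (fun x => x `^ c) (c * (t - a) `^ (c - 1)).
  by apply: is_derive1_powR; rewrite subr_gt0.
by have := @is_derive1_comp _ _ (fun t => t - a) t _ _ d2 d1; rewrite mulr1.
Qed.

Lemma is_derive_powR_refl (b c t : R) : t < b ->
  is_derive t 1 (fun t => (b - t) `^ c) (- (c * (b - t) `^ (c - 1))).
Proof.
move=> tb; have d1 : is_derive t 1 (fun t : R => b - t) (- 1).
  by have := is_deriveB (is_derive_cst b t (1 : R)) (is_derive_id t (1 : R)); rewrite sub0r.
have d2 : is_derive (b - t) 1 (fun x => x `^ c) (c * (b - t) `^ (c - 1)).
  by apply: is_derive1_powR; rewrite subr_gt0.
by have := @is_derive1_comp _ _ (fun t => b - t) t _ _ d2 d1; rewrite mulrN1.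
Qed.

Lemma continuous_powR_gt0 (c t : R) : 0 < t -> {for t, continuous (fun t => t `^ c)}.
Proof.
move=> t0; apply: differentiable_continuous; apply/derivable1_diffP.
by apply: derivable_powR; rewrite in_itv/= t0.
Qed.

(** Scaling of the beta integral, with an unspecified constant. One of the two
factors is bounded by a multiple of a power of [s] on each half of the interval,
and the remaining power has an elementary primitive. *)
Lemma integral_beta_le (p q : R) : -1 < p -> -1 < q -> exists2 C, 0 <= C &
  forall s, 0 < s -> (\int[mu]_(t in `]0%R, s[) (t `^ p * (s - t) `^ q)%:E <=
    (C * s `^ (p + q + 1))%:E)%E.
Proof.
move=> p1 q1; have p1' : 0 < p + 1 by lra. have q1' : 0 < q + 1 by lra.
pose K := Num.max (2 `^ `|p|) (2 `^ `|q|) : R.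
have K0 : 0 <= K by rewrite le_max powR_ge0.
exists (K * ((p + 1)^-1 + (q + 1)^-1)).
  by rewrite mulr_ge0// addr_ge0// invr_ge0 ltW.
move=> s s0.
pose f t := K * (s `^ q * t `^ p + s `^ p * (s - t) `^ q).
pose F t := K * (s `^ q * t `^ (p + 1) / (p + 1) - s `^ p * (s - t) `^ (q + 1) / (q + 1)).
have f0 t : 0 <= f t by rewrite mulr_ge0// addr_ge0// mulr_ge0// powR_ge0.
have sp : s `^ (p + q + 1) = s `^ q * s `^ (p + 1).
  by rewrite -powRD ?(gt_eqF s0) ?implybT//; congr powR; ring.
have sq : s `^ (p + q + 1) = s `^ p * s `^ (q + 1).
  by rewrite -powRD ?(gt_eqF s0) ?implybT//; congr powR; ring.
apply: (@le_trans _ _ (\int[mu]_(t in `]0%R, s[) (f t)%:E)%E).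
  apply: ge0_le_integral => //=.
  - by move=> t _; rewrite lee_fin mulr_ge0// powR_ge0.
  - apply/measurable_EFinP; apply: measurable_funM.
      by apply: measurable_funTS; exact: measurable_powR.
    apply: measurable_funTS; apply: (measurableT_comp (measurable_powR q)).
    exact: measurable_funB.
  - apply/measurable_EFinP; apply: measurable_funM => //; apply: measurable_funD.
      by apply: measurable_funM => //; apply: measurable_funTS; exact: measurable_powR.
    apply: measurable_funM => //.
    apply: measurable_funTS; apply: (measurableT_comp (measurable_powR q)).
    exact: measurable_funB.
  move=> t; rewrite in_itv/= => /andP[t0 ts]; rewrite lee_fin /f mulrDr.
  have [h|h] := leP t (s / 2).
    apply: (@le_trans _ _ (K * (s `^ q * t `^ p))).
      rewrite mulrA [leLHS]mulrC ler_wpM2r ?powR_ge0//.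
      apply: le_trans (powR_half q s0 _) _; first by apply/andP; split; lra.
      by rewrite ler_wpM2r ?powR_ge0// le_max lexx orbT.
    by rewrite lerDl mulr_ge0// mulr_ge0// powR_ge0.
  apply: (@le_trans _ _ (K * (s `^ p * (s - t) `^ q))).
    rewrite mulrA ler_wpM2r ?powR_ge0//.
    apply: le_trans (powR_half p s0 _) _; first by apply/andP; split; lra.
    by rewrite ler_wpM2r ?powR_ge0// le_max lexx.
  by rewrite lerDr mulr_ge0// mulr_ge0// powR_ge0.
have -> : (\int[mu]_(t in `]0%R, s[) (f t)%:E =
    (K * (s `^ (p + q + 1) / (p + 1) - 0) - K * (0 - s `^ (p + q + 1) / (q + 1)))%:E)%E; last first.
  by rewrite lee_fin; lra.
apply: (@ge0_integral_itvoo_FTC _ f F 0 s) => //.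
- move=> t; rewrite in_itv/= => /andP[t0 ts].
  have d1 := is_derive_powR_shift (p + 1) t0.
  have d2 := is_derive_powR_refl (q + 1) ts.
  have d3 := is_deriveZ K (is_deriveB (is_deriveZ (s `^ q / (p + 1)) d1) (is_deriveZ (s `^ p / (q + 1)) d2)).
  rewrite (_ : F = (fun x => K * (s `^ q / (p + 1) * (x - 0) `^ (p + 1) - s `^ p / (q + 1) * (s - x) `^ (q + 1)))); last first.
    by apply/funext => x; rewrite /F subr0; congr (_ * _); ring.
  apply: (is_derive_eq d3).
  rewrite /f !addrK subr0 /GRing.scale/=; field.
  by rewrite !gt_eqF.
- move=> t; rewrite in_itv/= => /andP[t0 ts].
  have c1 := continuous_powR_gt0 (c := p) t0.
  have c2 : {for t, continuous (fun t => (s - t) `^ q)}.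
    apply: differentiable_continuous; apply/derivable1_diffP.
    by have [] := is_derive_powR_refl q ts.
  apply: cvgM; first exact: cvg_cst.
  apply: cvgD; apply: cvgM => //; exact: cvg_cst.
- apply: cvgM; first exact: cvg_cst.
  apply: cvgB.
    rewrite [X in _ --> X](_ : 0 = s `^ q * 0 / (p + 1)); last by rewrite mulr0 mul0r.
    apply: cvgM; last exact: cvg_cst.
    apply: cvgM; first exact: cvg_cst.
    exact: powR_cvg0.
  rewrite sq; apply: cvgM; last exact: cvg_cst.
  apply: cvgM; first exact: cvg_cst.
  rewrite [X in _ --> X](_ : s `^ (q + 1) = (s - 0) `^ (q + 1)); last by rewrite subr0.
  have c0 : {for 0, continuous (fun t => (s - t) `^ (q + 1))}.
    apply: differentiable_continuous; apply/derivable1_diffP.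
    by have [] := is_derive_powR_refl (q + 1) s0.
  exact: cvg_at_right_filter c0.
- apply: cvgM; first exact: cvg_cst.
  apply: cvgB.
    rewrite sp; apply: cvgM; last exact: cvg_cst.
    apply: cvgM; first exact: cvg_cst.
    apply: cvg_at_left_filter; exact: continuous_powR_gt0.
  rewrite [X in _ --> X](_ : 0 = s `^ p * 0 / (q + 1)); last by rewrite mulr0 mul0r.
  apply: cvgM; last exact: cvg_cst.
  apply: cvgM; first exact: cvg_cst.
  exact: powR_cvg_left.
Qed.
End beta_bound.

Section dirichlet.
Context {R : realType}.

Definition dirichlet_dom n (s : R) : set 'rV[R]_n :=
  [set x : 'rV[R]_n | (forall k, 0 < x ord0 k) /\ sumx x < s].

Arguments dirichlet_dom : clear implicits.

(** The density of the Dirichlet integral over the simplex of size [s]; letting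
the size vary makes the section at a fixed first coordinate [t] a density of
the same form, of size [s - t]. *)
Definition dirichlet_weight n (b : 'I_n -> R) (g s : R) (x : 'rV[R]_n) : R :=
  \1_(dirichlet_dom n s) x * (\prod_k x ord0 k `^ b k * (s - sumx x) `^ g).

Lemma measurable_sumx n : measurable_fun setT (@sumx R n).
Proof. by apply: measurable_sum => k; exact: measurable_coord. Qed.

Lemma measurable_dirichlet_dom n s : measurable (dirichlet_dom n s).
Proof.
rewrite (_ : dirichlet_dom n s =
  (\bigcap_(k in setT) ((fun x : 'rV[R]_n => x ord0 k) @^-1` `]0, +oo[)) `&`
  (@sumx R n @^-1` `]-oo, s[)).
  apply: measurableI.
    apply: fin_bigcap_measurable => // k _; rewrite -[_ @^-1` _]setTI.
    by apply: measurable_coord => //; exact: measurable_itv.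
  rewrite -[_ @^-1` _]setTI.
  by apply: measurable_sumx => //; exact: measurable_itv.
apply/seteqP; split=> x [h1 h2].
  split; last by rewrite /= in_itv.
  by move=> k _; rewrite /= in_itv/= andbT; exact: h1.
split; last by move: h2; rewrite /= in_itv.
by move=> k; have := h1 k Logic.I; rewrite /= in_itv/= andbT.
Qed.

Lemma measurable_dirichlet_weight n b g s :
  measurable_fun setT (@dirichlet_weight n b g s).
Proof.
apply: measurable_funM.
  by apply: measurable_indic; exact: measurable_dirichlet_dom.
apply: measurable_funM.
  apply: measurable_prod => k _; apply: (measurableT_comp (measurable_powR (b k))).
  exact: measurable_coord.
apply: (measurableT_comp (measurable_powR g)).
by apply: measurable_funB => //; exact: measurable_sumx.
Qed.

Lemma dirichlet_weight_ge0 n b g s x : 0 <= @dirichlet_weight n b g s x.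
Proof.
rewrite mulr_ge0 ?indic_ge0// mulr_ge0 ?powR_ge0// prodr_ge0// => k _.
exact: powR_ge0.
Qed.

Lemma cons_rV0 n t (v : 'rV[R]_n) : cons_rV (t, v) ord0 ord0 = t.
Proof. by rewrite mxE; case: splitP => // k _; rewrite mxE (ord1 k) eqxx mulr1n. Qed.

Lemma cons_rVS n t (v : 'rV[R]_n) k : cons_rV (t, v) ord0 (lift ord0 k) = v ord0 k.
Proof.
rewrite mxE; case: splitP => [[[]]//|k' /= kk'].
by congr (v _ _); apply/val_inj; case: kk'.
Qed.

Lemma sumx_cons n t (v : 'rV[R]_n) : sumx (cons_rV (t, v)) = t + sumx v.
Proof.
rewrite /sumx big_ord_recl cons_rV0; congr (_ + _).
by apply: eq_bigr => k _; rewrite cons_rVS.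
Qed.

Lemma dirichlet_weight_cons n b g s t (v : 'rV[R]_n) :
  dirichlet_weight b g s (cons_rV (t, v)) =
  \1_(`]0, +oo[%classic : set R) t * t `^ b ord0 *
    dirichlet_weight (fun k => b (lift ord0 k)) g (s - t) v.
Proof.
rewrite /dirichlet_weight big_ord_recl cons_rV0 sumx_cons opprD addrA.
rewrite (_ : \1_(dirichlet_dom _ s) (cons_rV (t, v)) =
  \1_(`]0, +oo[%classic : set R) t * \1_(dirichlet_dom n (s - t)) v); last first.
  rewrite !indicE -natrM mulnb; congr ((_ : bool)%:R).
  apply/idP/andP; rewrite !inE /= in_itv/= andbT.
    move=> [h1]; rewrite sumx_cons => h2; split; first by have := h1 ord0; rewrite cons_rV0.
    split; last by lra.
    by move=> k; have := h1 (lift ord0 k); rewrite cons_rVS.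
  move=> [h1 [h2 h3]]; split; last by rewrite sumx_cons; lra.
  move=> k; case: (unliftP ord0 k) => [k'|] ->; last by rewrite cons_rV0.
  by rewrite cons_rVS.
rewrite (_ : \prod_(k < n) _ = \prod_(k < n) v ord0 k `^ b (lift ord0 k)).
  ring.
by apply: eq_bigr => k _; rewrite cons_rVS.
Qed.

Lemma dirichlet_weight_le0 n b g s x : s <= 0 -> @dirichlet_weight n b g s x = 0.
Proof.
move=> s0; rewrite /dirichlet_weight indicE memNset ?mul0r// => -[x0].
apply/negP; rewrite -leNgt (le_trans s0)// sumr_ge0// => k _; exact/ltW.
Qed.

Lemma measurable_powRM (p q s : R) :
  measurable_fun setT (fun t : R => t `^ p * (s - t) `^ q).
Proof.
apply: measurable_funM; first exact: measurable_powR.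
apply: (measurableT_comp (measurable_powR q)); exact: measurable_funB.
Qed.

(** Induction on the dimension: the integral over a section scales like a power
of [s - t] by the induction hypothesis, which leaves a beta integral in [t]. *)
Lemma integral_dirichlet_le n (b : 'I_n -> R) g : (forall k, -1 < b k) -> -1 < g ->
  exists2 C, 0 <= C & forall s, 0 < s ->
  (\int[lebesgue_rV R n]_x (dirichlet_weight b g s x)%:E <=
   (C * s `^ (\sum_k (b k + 1) + g))%:E)%E.
Proof.
elim: n b g => [|n IH] b g b1 g1.
  exists 1 => // s s0; rewrite /= integral_dirac//; last first.
    by apply/measurable_EFinP; exact: measurable_dirichlet_weight.
  rewrite [X in (X * _)%E](_ : _ = 1%E); last exact: diracT.
  rewrite mul1e lee_fin /dirichlet_weight !big_ord0 mul1r /sumx big_ord0 subr0 mul1r add0r.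
  by rewrite ler_piMl ?powR_ge0// indicE lern1 leq_b1.
have [C C0 CP] := IH (fun k => b (lift ord0 k)) g (fun k => b1 _) g1.
set e := \sum_(k < n) (b (lift ord0 k) + 1) + g in CP.
have e1 : -1 < e.
  by rewrite /e -[ltLHS]add0r ler_ltD// sumr_ge0// => k _; have := b1 (lift ord0 k); lra.
have [D D0 DP] := integral_beta_le (b1 ord0) e1.
exists (C * D); first exact: mulr_ge0.
move=> s s0; have mw := @measurable_dirichlet_weight n.+1 b g s.
have mwE : measurable_fun setT (fun x => (dirichlet_weight b g s x)%:E) by exact/measurable_EFinP.
have w0 x : (0 <= (dirichlet_weight b g s x)%:E)%E by rewrite lee_fin dirichlet_weight_ge0.
rewrite (integral_lebesgue_rVS mwE w0).
apply: (@le_trans _ _ (\int[lebesgue_measure]_(t in `]0%R, s[) (C * (t `^ b ord0 * (s - t) `^ e))%:E)%E).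
  rewrite [leRHS]integral_mkcond; apply: ge0_le_integral => //.
  - by move=> t _; exact: integral_ge0.
  - apply: (@measurable_fun_fubini_tonelli_F _ _ _ _ _ (lebesgue_rV R n)
      ((fun x => (dirichlet_weight b g s x)%:E) \o @cons_rV R n)).
      exact: measurableT_comp mwE (@measurable_cons_rV R n).
    by move=> z; exact: w0.
  - apply/(measurable_restrictT _ _).1 => //.
    apply/measurable_EFinP; apply: measurable_funM => //.
    by apply: measurable_funTS; exact: measurable_powRM.
  move=> t _.
  under eq_integral => v _ do rewrite dirichlet_weight_cons EFinM.
  have k0 : 0 <= \1_(`]0, +oo[%classic : set R) t * t `^ b ord0.
    by rewrite mulr_ge0 ?indic_ge0 ?powR_ge0.
  have -> : (\int[lebesgue_rV R n]_v ((\1_(`]0, +oo[%classic : set R) t * t `^ b ord0)%:E *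
      (dirichlet_weight (fun k => b (lift ord0 k)) g (s - t) v)%:E) =
    (\1_(`]0, +oo[%classic : set R) t * t `^ b ord0)%:E *
      \int[lebesgue_rV R n]_v (dirichlet_weight (fun k => b (lift ord0 k)) g (s - t) v)%:E)%E.
    apply: ge0_integralZl => //.
    - by apply/measurable_EFinP; exact: measurable_dirichlet_weight.
    - by move=> v _; rewrite lee_fin dirichlet_weight_ge0.
  rewrite patchE; case: ifPn => [/set_mem|].
    rewrite /= in_itv/= => /andP[t0 ts].
    rewrite indicE mem_set ?mul1r//= ?in_itv/= ?t0//.
    rewrite mulrCA [leRHS]EFinM lee_wpmul2l ?lee_fin ?powR_ge0//.
    by apply: CP; rewrite subr_gt0.
  move=> /negP tN; have [t0|t0] := leP t 0.
    by rewrite indicE memNset ?mul0r ?mul0e//= in_itv/= andbT; apply/negP; rewrite -leNgt.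
  rewrite integral0_eq ?mule0// => v _; rewrite dirichlet_weight_le0//.
  by rewrite subr_le0 leNgt; apply/negP => ts; apply: tN; rewrite inE/= in_itv/= t0.
under eq_integral do rewrite EFinM.
have -> : (\int[lebesgue_measure]_(t in `]0%R, s[) (C%:E * (t `^ b ord0 * (s - t) `^ e)%:E) =
    C%:E * \int[lebesgue_measure]_(t in `]0%R, s[) (t `^ b ord0 * (s - t) `^ e)%:E)%E.
  apply: ge0_integralZl => //.
  - by apply/measurable_EFinP; apply: measurable_funTS; exact: measurable_powRM.
  - by move=> t _; rewrite lee_fin mulr_ge0 ?powR_ge0.
rewrite -mulrA EFinM lee_wpmul2l ?lee_fin//.
apply: le_trans (DP s s0) _; rewrite lee_fin le_eqVlt; apply/orP; left; apply/eqP.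
by congr (_ * _ `^ _); rewrite big_ord_recl /e; ring.
Qed.
End dirichlet.

Section weight.
Context {R : realType} {d : nat} (hd : (0 < d)%N).
Variables (a : 'I_d.+1 -> R) (a1 : forall i, -1 < a i).
Implicit Types (x y : 'rV[R]_d) (h : 'rV[R]_d -> R).
Local Notation mu := (lebesgue_rV R d).
Local Notation S := (@simplex R d).
Local Notation O := (@osimplex R d).

Definition bweight x : R := \prod_i bary x i `^ a i.
Local Notation w := bweight.

Lemma bweight_ge0 x : 0 <= w x.
Proof. by rewrite prodr_ge0// => i _; exact: powR_ge0. Qed.

Lemma bweight_gt0 x : O x -> 0 < w x.
Proof. by move=> xO; rewrite prodr_gt0// => i _; exact/powR_gt0/xO. Qed.

Lemma measurable_bweight : measurable_fun setT w.
Proof.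
apply: measurable_prod => k _; apply: (measurableT_comp (measurable_powR (a k))).
exact: measurable_bary.
Qed.

Lemma eq_integral_osimplex (f g : 'rV[R]_d -> \bar R) :
  (forall x, O x -> f x = g x) -> (\int[mu]_(x in S) f x = \int[mu]_(x in S) g x)%E.
Proof.
have [N [mN N0 SN]] := simplex_boundary_null (R := R) hd.
by move=> fg; apply: (eq_integral_off_null mN N0) => x Sx Nx; apply/fg/SN.
Qed.

Lemma osimplex_dirichlet x : O x <-> @dirichlet_dom R d 1 x.
Proof.
split=> [xO|[h1 h2] i].
  split=> [k|]; first by rewrite -baryS.
  by rewrite -subr_gt0 -bary0.
by have [|k] := bary_indexP i; rewrite ?bary0 ?baryS ?subr_gt0.
Qed.

Lemma integrable_bweight : mu.-integrable S (EFin \o w).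
Proof.
apply/integrableP; split.
  by apply/measurable_EFinP; apply: measurable_funTS; exact: measurable_bweight.
pose dw := dirichlet_weight (fun k => a (lift ord0 k)) (a ord0) 1.
rewrite (@eq_integral_osimplex _ (fun x => (dw x)%:E)); last first.
  move=> x xO /=; rewrite ger0_norm ?bweight_ge0//; congr (_%:E).
  rewrite /dw /dirichlet_weight indicE mem_set ?mul1r; last exact/osimplex_dirichlet.
  rewrite /bweight big_ord_recl bary0 mulrC; congr (_ * _).
  by apply: eq_bigr => k _; rewrite baryS.
have [C C0 CP] := integral_dirichlet_le (fun k : 'I_d => a1 (lift ord0 k)) (a1 ord0).
apply: (@le_lt_trans _ _ (\int[mu]_x (dw x)%:E)%E).
  apply: ge0_subset_integral => //.
  - exact: measurable_simplex.
  - by apply/measurable_EFinP; exact: measurable_dirichlet_weight.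
  - by move=> x _; rewrite lee_fin dirichlet_weight_ge0.
exact: le_lt_trans (CP 1 ltr01) (ltry _).
Qed.

Definition w_integrable h := mu.-integrable S (fun x => (h x * w x)%:E).
Definition w_int h : R := \int[mu]_(x in S) (h x * w x).

Lemma w_integrable_bounded h M : measurable_fun S h ->
  (forall x, S x -> `|h x| <= M) -> w_integrable h.
Proof.
move=> mh hM; apply: (@le_integrable _ _ _ mu S measurable_simplex _ (fun x => (M * w x)%:E)).
- apply/measurable_EFinP; apply: measurable_funM => //.
  by apply: measurable_funTS; exact: measurable_bweight.
- move=> x Sx; rewrite /= lee_fin normrM [leRHS]normrM ler_wpM2r//.
  exact: le_trans (hM x Sx) (ler_norm M).
have := integrableZl measurable_simplex M integrable_bweight.
by apply: eq_integrable; [exact: measurable_simplex|move=> x _].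
Qed.

Lemma w_integrable_within h : {within S, continuous h} -> w_integrable h.
Proof.
move=> ch; have [M _ hM] := bounded_on_simplex ch.
exact: w_integrable_bounded (measurable_within ch) hM.
Qed.

Lemma w_integrableD h h' : w_integrable h -> w_integrable h' ->
  w_integrable (fun x => h x + h' x).
Proof.
move=> ih ih'; have := integrableD measurable_simplex ih ih'.
by apply: eq_integrable; [exact: measurable_simplex|move=> x _; rewrite /= mulrDl EFinD].
Qed.

Lemma w_integrableZ c h : w_integrable h -> w_integrable (fun x => c * h x).
Proof.
move=> ih; have := integrableZl measurable_simplex c ih.
by apply: eq_integrable; [exact: measurable_simplex|move=> x _; rewrite /= -mulrA EFinM].
Qed.

Lemma w_integrableB h h' : w_integrable h -> w_integrable h' ->
  w_integrable (fun x => h x - h' x).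
Proof.
move=> ih ih'; have := w_integrableD ih (w_integrableZ (-1) ih').
apply: eq_integrable; [exact: measurable_simplex|move=> x _].
by rewrite mulN1r.
Qed.

Lemma w_integrableM h h' M : measurable_fun S h' -> (forall x, S x -> `|h' x| <= M) ->
  w_integrable h -> w_integrable (fun x => h x * h' x).
Proof.
move=> mh' hM ih.
have mh : measurable_fun S (fun x => h x * w x) by apply/measurable_EFinP; exact: measurable_int ih.
apply: (@le_integrable _ _ _ mu S measurable_simplex _ (fun x => (M * (h x * w x))%:E)).
- apply/measurable_EFinP; under eq_fun do rewrite mulrAC.
  exact: measurable_funM.
- move=> x Sx; rewrite /= lee_fin mulrAC normrM [leRHS]normrM mulrC ler_wpM2r//.
  exact: le_trans (hM x Sx) (ler_norm M).
have := integrableZl measurable_simplex M ih.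
by apply: eq_integrable; [exact: measurable_simplex|move=> x _].
Qed.

Lemma w_integrable_norm h : w_integrable h -> w_integrable (fun x => `|h x|).
Proof.
move=> /integrable_norm; apply: eq_integrable; first exact: measurable_simplex.
by move=> x _; rewrite /= normrM [`|w x|]ger0_norm ?bweight_ge0.
Qed.

Lemma w_intD h h' : w_integrable h -> w_integrable h' ->
  w_int (fun x => h x + h' x) = w_int h + w_int h'.
Proof.
move=> ih ih'; rewrite /w_int -RintegralD//; last exact: measurable_simplex.
by apply: eq_Rintegral => x _; rewrite mulrDl.
Qed.

Lemma w_intZ c h : w_integrable h -> w_int (fun x => c * h x) = c * w_int h.
Proof.
move=> ih; rewrite /w_int -RintegralZl//; last exact: measurable_simplex.
by apply: eq_Rintegral => x _; rewrite mulrA.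
Qed.

Lemma w_intB h h' : w_integrable h -> w_integrable h' ->
  w_int (fun x => h x - h' x) = w_int h - w_int h'.
Proof.
move=> ih ih'; rewrite -mulN1r -w_intZ// -w_intD//; last exact: w_integrableZ.
by congr w_int; apply/funext => x; rewrite mulN1r.
Qed.

Lemma w_integrable_sum (I : Type) (r : seq I) (h : I -> 'rV[R]_d -> R) :
  (forall i, w_integrable (h i)) -> w_integrable (fun x => \sum_(i <- r) h i x).
Proof.
move=> ih; elim: r => [|i r IHr].
  under eq_fun do rewrite big_nil.
  by apply: (@w_integrable_bounded _ 0) => // x _; rewrite normr0.
by under eq_fun do rewrite big_cons; exact: w_integrableD.
Qed.

Lemma w_int_sum (I : Type) (r : seq I) (h : I -> 'rV[R]_d -> R) :
  (forall i, w_integrable (h i)) ->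
  w_int (fun x => \sum_(i <- r) h i x) = \sum_(i <- r) w_int (h i).
Proof.
move=> ih; elim: r => [|i r IHr].
  rewrite big_nil -[RHS](mul0r (w_int (fun=> 0))) -w_intZ.
    by congr w_int; apply/funext => x; rewrite big_nil mul0r.
  by apply: (@w_integrable_bounded _ 0) => // x _; rewrite normr0.
rewrite big_cons -IHr -w_intD//; last exact: w_integrable_sum.
by congr w_int; apply/funext => x; rewrite big_cons.
Qed.

Lemma ler_w_int h h' : w_integrable h -> w_integrable h' ->
  (forall x, S x -> h x <= h' x) -> w_int h <= w_int h'.
Proof.
move=> ih ih' hh'; apply: le_Rintegral => //; first exact: measurable_simplex.
by move=> x Sx; rewrite ler_wpM2r ?bweight_ge0// hh'.
Qed.

(** A positive function with vanishing integral would vanish almost everywhere on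
the open simplex, which has positive measure. *)
Lemma w_int_gt0 h : w_integrable h -> (forall x, O x -> 0 < h x) -> 0 < w_int h.
Proof.
move=> ih h0.
have hw x : O x -> 0 < h x * w x.
  by move=> xO; rewrite mulr_gt0 ?h0// bweight_gt0.
have E : (\int[mu]_(x in S) (h x * w x)%:E = \int[mu]_(x in O) `|(h x * w x)%:E|)%E.
  rewrite [RHS]integral_mkcond (_ : _ \_ O =
      ((fun x => `|(h x * w x)%:E|) \_ O)%E); last by [].
  rewrite [LHS](@eq_integral_osimplex _ ((fun x => `|(h x * w x)%:E|) \_ O)%E); last first.
    by move=> x xO; rewrite patchE mem_set//= ger0_norm// ltW ?hw.
  rewrite [LHS]integral_mkcond; apply: eq_integral => x _; rewrite !patchE.
  by case: ifPn => // xS; case: ifPn => // /set_mem /osimplex_sub /mem_set; rewrite (negbTE xS).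
have mhw : measurable_fun O (fun x => (h x * w x)%:E).
  by apply: measurable_funS (measurable_int _ ih); [exact: measurable_simplex|exact: osimplex_sub].
have fin : (\int[mu]_(x in S) (h x * w x)%:E)%E \is a fin_num.
  by apply: integrable_fin_num ih; exact: measurable_simplex.
rewrite /w_int /Rintegral -lte_fin fineK// lt_neqAle; apply/andP; split; last first.
  by rewrite E integral_ge0.
apply/eqP => /esym/eqP; rewrite E => /eqP.
move/(ae_eq_integral_abs mu measurable_osimplex mhw).1 => [N [mN N0 ON]].
have : (mu O <= mu N)%E.
  apply: le_measure; rewrite ?inE//; first exact: measurable_osimplex.
  move=> x xO; apply: ON => /= /(_ xO) [hw0].
  by have := hw x xO; rewrite hw0 ltxx.
by rewrite N0 leNgt osimplex_gt0.
Qed.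
End weight.

(** * Integration by parts along the edges *)

(** On a chord of the simplex parallel to the edge from i to j, at parameter t,
the coordinates are lambda_i = be - t and lambda_j = t - al, the other ones being
constant; their contribution to the weight is the factor [c]. *)
Section chord.
Context {R : realType}.
Variables (al be ai aj c M : R) (U U' : R -> R).
Hypotheses (alb : al < be) (ai1 : -1 < ai) (aj1 : -1 < aj).
Hypotheses (dU : forall t, t \in `]al, be[ -> is_derive t 1 U (U' t))
  (cU' : forall t, t \in `]al, be[ -> {for t, continuous U'})
  (UM : forall t, t \in `]al, be[ -> `|U t| <= M).

Let P t := (be - t) `^ (ai + 1).
Let Q t := (t - al) `^ (aj + 1).
Let f t := c * ((- ((ai + 1) * (be - t) `^ ai) * Q t + P t * ((aj + 1) * (t - al) `^ aj)) * U t
   + P t * Q t * U' t).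

Let ai0 : 0 < ai + 1. Proof. by have := ai1; lra. Qed.
Let aj0 : 0 < aj + 1. Proof. by have := aj1; lra. Qed.

Let dP t : t \in `]al, be[ -> is_derive t 1 P (- ((ai + 1) * (be - t) `^ ai)).
Proof.
rewrite in_itv/= => /andP[_ tb].
by have := is_derive_powR_refl (ai + 1) tb; rewrite addrK.
Qed.

Let dQ t : t \in `]al, be[ -> is_derive t 1 Q ((aj + 1) * (t - al) `^ aj).
Proof.
rewrite in_itv/= => /andP[ta _].
by have := is_derive_powR_shift (aj + 1) ta; rewrite addrK.
Qed.

Let F t := c * (P t * Q t * U t).

Let derive_continuous (g : R -> R) (t l : R) : is_derive t 1 g l -> {for t, continuous g}.
Proof.
move=> [dg _]; apply: differentiable_continuous; exact/derivable1_diffP.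
Qed.

Let dF t : t \in `]al, be[ -> is_derive t 1 F (f t).
Proof.
move=> tI; have := dP tI; have := dQ tI; have := dU tI => dUt dQt dPt.
have dd := is_deriveZ c (is_deriveM (is_deriveM dPt dQt) dUt).
apply: (is_derive_eq dd).
change (c * ((P t * Q t) * U' t + U t * (P t * ((aj + 1) * (t - al) `^ aj) +
  Q t * (- ((ai + 1) * (be - t) `^ ai)))) = f t).
rewrite /f; ring.
Qed.

Let cf t : t \in `]al, be[ -> {for t, continuous f}.
Proof.
move=> tI; have cP := derive_continuous (dP tI); have cQ := derive_continuous (dQ tI).
have cU := derive_continuous (dU tI).
move: (tI); rewrite in_itv/= => /andP[ta tb].
have c1 := derive_continuous (is_derive_powR_refl ai tb).
have c2 := derive_continuous (is_derive_powR_shift aj ta).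
apply: cvgM; first exact: cvg_cst.
apply: cvgD; last by apply: cvgM; [exact: cvgM|exact: cU'].
apply: cvgM; last exact: cU.
apply: cvgD; apply: cvgM => //; last by apply: cvgM => //; exact: cvg_cst.
by apply: cvgN; apply: cvgM => //; exact: cvg_cst.
Qed.

Let F_le t : t \in `]al, be[ -> `|F t| <= `|c| * M * (P t * Q t).
Proof.
move=> tI; have P0 : 0 <= P t := powR_ge0 _ _; have Q0 : 0 <= Q t := powR_ge0 _ _.
rewrite /F !normrM (ger0_norm P0) (ger0_norm Q0) -[leRHS]mulrA ler_wpM2l//.
by rewrite mulrC ler_wpM2r ?UM// mulr_ge0.
Qed.

Let Fal : F t @[t --> al^'+] --> 0.
Proof.
have h0 : `|c| * M * (P t * Q t) @[t --> al^'+] --> 0.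
  rewrite [X in _ --> X](_ : 0 = `|c| * M * (P al * 0)); last by rewrite !mulr0.
  apply: cvgM; first exact: cvg_cst.
  apply: cvgM; last exact: powR_cvg_right.
  have cP : {for al, continuous P} := derive_continuous (is_derive_powR_refl (ai + 1) alb).
  exact: cvg_at_right_filter cP.
have h1 : - (`|c| * M * (P t * Q t)) @[t --> al^'+] --> 0 by rewrite -oppr0; exact: cvgN.
apply: squeeze_cvgr h1 h0; near=> t; rewrite -ler_norml; apply: F_le.
by rewrite in_itv/=; apply/andP; split; near: t; [exact: nbhs_right_gt|exact: nbhs_right_lt].
Unshelve. all: by end_near.
Qed.

Let Fbe : F t @[t --> be^'-] --> 0.
Proof.
have h0 : `|c| * M * (P t * Q t) @[t --> be^'-] --> 0.
  rewrite [X in _ --> X](_ : 0 = `|c| * M * (0 * Q be)); last by rewrite mul0r mulr0.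
  apply: cvgM; first exact: cvg_cst.
  apply: cvgM; first exact: powR_cvg_left.
  have cQ : {for be, continuous Q} := derive_continuous (is_derive_powR_shift (aj + 1) alb).
  exact: cvg_at_left_filter cQ.
have h1 : - (`|c| * M * (P t * Q t)) @[t --> be^'-] --> 0 by rewrite -oppr0; exact: cvgN.
apply: squeeze_cvgr h1 h0; near=> t; rewrite -ler_norml; apply: F_le.
by rewrite in_itv/=; apply/andP; split; near: t; [exact: nbhs_left_gt|exact: nbhs_left_lt].
Unshelve. all: by end_near.
Qed.

(** The integrand is the derivative of
c (be - t)^(ai + 1) (t - al)^(aj + 1) U(t), which tends to 0 at both ends because
the exponents are positive and [U] is bounded. *)
Lemma integral_chord0 (g : R -> R) :
  (forall t, t \in `]al, be[ -> g t = c * ((be - t) `^ ai * (t - al) `^ aj) *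
    (((aj + 1) * (be - t) - (ai + 1) * (t - al)) * U t + (be - t) * (t - al) * U' t)) ->
  lebesgue_measure.-integrable `]al, be[ (EFin \o g) ->
  (\int[lebesgue_measure]_(t in `]al, be[) (g t)%:E = 0)%E.
Proof.
move=> gE ig.
have gf t : t \in `]al, be[ -> g t = f t.
  move=> tI; rewrite gE//; move: tI; rewrite in_itv/= => /andP[ta tb].
  rewrite /f /P /Q !powRD ?(gt_eqF, subr_gt0) ?implybT//.
  rewrite !powRr1 ?subr_ge0 ?ltW//; ring.
have -> : (\int[lebesgue_measure]_(t in `]al, be[) (g t)%:E =
    \int[lebesgue_measure]_(t in `]al, be[) (f t)%:E)%E.
  by apply: eq_integral => t; rewrite inE => /gf ->.
have -> : (\int[lebesgue_measure]_(t in `]al, be[) (f t)%:E = (0 - 0)%:E)%E.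
  apply: (@integral_itvoo_FTC _ f F) => //.
  by apply: eq_integrable ig => // t; rewrite inE => /gf /= ->.
by rewrite subrr.
Qed.
End chord.

Section divergence.
Context {R : realType} {d : nat} (hd : (0 < d)%N).
Variables (a : 'I_d.+1 -> R) (a1 : forall i, -1 < a i).
Implicit Types (x y : 'rV[R]_d) (h : 'rV[R]_d -> R).
Local Notation mu := (lebesgue_rV R d).
Local Notation S := (@simplex R d).
Local Notation O := (@osimplex R d).
Local Notation w := (bweight a).

Lemma bary_edge_src x i j t : i != j -> bary (x + t *: edge i j) i = bary x i - t.
Proof. by move=> ij; rewrite bary_edge eqxx (negbTE ij) sub0r mulrN1. Qed.

Lemma bary_edge_dst x i j t : i != j -> bary (x + t *: edge i j) j = bary x j + t.
Proof. by move=> ij; rewrite bary_edge eqxx eq_sym (negbTE ij) subr0 mulr1. Qed.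

Lemma bary_edge_other x i j t l : l != i -> l != j ->
  bary (x + t *: edge i j) l = bary x l.
Proof. by move=> li lj; rewrite bary_edge (negbTE li) (negbTE lj) subrr mulr0 addr0. Qed.

Lemma continuous_line x v : continuous (fun t : R => x + t *: v).
Proof.
move=> t; apply: cvgD; first exact: cvg_cst.
by apply: cvgZr_tmp.
Qed.

Lemma within_cst (A : set 'rV[R]_d) (c : R) : {within A, continuous (fun=> c)}.
Proof. by move=> x; exact: cvg_cst. Qed.

Lemma within_add (A : set 'rV[R]_d) h h' : {within A, continuous h} -> {within A, continuous h'} ->
  {within A, continuous (fun x => h x + h' x)}.
Proof. by move=> ch ch' x; apply: cvgD; [exact: ch|exact: ch']. Qed.

Lemma within_sub (A : set 'rV[R]_d) h h' : {within A, continuous h} -> {within A, continuous h'} ->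
  {within A, continuous (fun x => h x - h' x)}.
Proof. by move=> ch ch' x; apply: cvgB; [exact: ch|exact: ch']. Qed.

Lemma within_mul (A : set 'rV[R]_d) h h' : {within A, continuous h} -> {within A, continuous h'} ->
  {within A, continuous (fun x => h x * h' x)}.
Proof. by move=> ch ch' x; apply: cvgM; [exact: ch|exact: ch']. Qed.

Lemma within_bary (A : set 'rV[R]_d) i : {within A, continuous (bary^~ i : 'rV[R]_d -> R)}.
Proof. exact/continuous_subspaceT/continuous_bary. Qed.

(** The integrand times the weight is the derivative of
lambda_i lambda_j w u in the direction of the edge, so that its integral over
every chord vanishes. *)
Lemma w_int_div i j u u' : i != j ->
  {within S, continuous u} -> {within S, continuous u'} ->
  (forall x, O x -> is_derive x (edge i j : 'rV[R]_d) u (u' x)) ->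
  w_int a (fun x => ((a j + 1) * bary x i - (a i + 1) * bary x j) * u x +
    bary x i * bary x j * u' x) = 0.
Proof.
move=> ij cu cu' du; set K := (X in w_int a X).
set v : 'rV[R]_d := edge i j.
have [Mu _ uM] := bounded_on_simplex cu.
have iK : w_integrable a K.
  apply: (w_integrable_within hd a1).
  apply: within_add; apply: within_mul => //.
    by apply: within_sub; apply: within_mul; [exact: within_cst|exact: within_bary|exact: within_cst|exact: within_bary].
  by apply: within_mul; exact: within_bary.
(* Extended by 0 off the open simplex, so that whole lines can be used. *)
pose G := (fun x => K x * w x) \_ O.
have GE x : (G x)%:E = ((fun x => (K x * w x)%:E) \_ O) x.
  by rewrite /G !patchE; case: ifP.
have iG : mu.-integrable setT (EFin \o G).
  have iKO : mu.-integrable O (fun x => (K x * w x)%:E).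
    by apply: integrableS iK; [exact: measurable_simplex|exact: measurable_osimplex|exact: osimplex_sub].
  have := (integrable_mkcond _ measurable_osimplex).1 iKO.
  by apply: eq_integrable => // x _; rewrite /= GE.
suff G0 : (\int[mu]_x (G x)%:E = 0)%E.
  rewrite /w_int /Rintegral (_ : (\int[_]_(x in S) _)%E = 0%E)//.
  rewrite -[RHS]G0 (eq_integral_osimplex hd (g := EFin \o G)); last first.
    by move=> x xO; rewrite /= GE patchE mem_set.
  rewrite integral_mkcond; apply: eq_integral => x _; rewrite patchE.
  case: ifPn => // /negP xS; rewrite /= /G patchE memNset// => /osimplex_sub.
  by move/mem_set.
have [c vc] := edge_coord (R := R) ij.
apply: (integral0_lines vc iG) => x iGx.
have OP t : O (x + t *: v) <-> [/\ t < bary x i, - bary x j < t &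
    forall l, l != i -> l != j -> 0 < bary x l].
  split=> [xO|[ti tj hl] l].
    split.
    - by have := xO i; rewrite bary_edge_src// subr_gt0.
    - by have := xO j; rewrite bary_edge_dst// -ltrBlDl sub0r.
    - by move=> l li lj; have := xO l; rewrite bary_edge_other.
  have [->|li] := eqVneq l i; first by rewrite bary_edge_src// subr_gt0.
  have [->|lj] := eqVneq l j; first by rewrite bary_edge_dst// -ltrBlDl sub0r.
  by rewrite bary_edge_other// hl.
(* The line meets the open simplex in an open interval of parameters, or not at
   all. *)
have [[alb hl]|bad] := pselect (- bary x j < bary x i /\
    (forall l, l != i -> l != j -> 0 < bary x l)); last first.
  apply: integral0_eq => t _; rewrite /G patchE memNset// => /OP[ti tj hl].
  by apply: bad; split=> //; exact: lt_trans ti.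
have OI t : O (x + t *: v) <-> t \in `](- bary x j), (bary x i)[.
  rewrite in_itv/=; split=> [/OP[-> ->]//|/andP[h1 h2]]; exact/OP.
have E1 : (fun t => (G (x + t *: v))%:E) =
    (fun t => (G (x + t *: v))%:E) \_ `](- bary x j), (bary x i)[.
  apply/funext => t; rewrite patchE; case: ifPn => // /negP tI.
  by rewrite /G patchE memNset// => /OI /mem_set.
rewrite E1 -integral_mkcond.
apply: (@integral_chord0 _ _ _ (a i) (a j)
  (\prod_(l | (l != i) && (l != j)) bary x l `^ a l) Mu
  (fun t => u (x + t *: v)) (fun t => u' (x + t *: v))) => //.
- move=> t /OI xO; exact: ((is_derive_line x v u t _).1 (du _ xO)).
- move=> t /OI xO; apply: (@continuous_comp _ _ _ (fun t : R => x + t *: v) u').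
    exact: continuous_line.
  exact: continuous_at_osimplex.
- by move=> t /OI /osimplex_sub; exact: uM.
- move=> t /OI xO; rewrite /G patchE mem_set// /K /bweight.
  rewrite (bigD1 i)//= (bigD1 j) 1?eq_sym//= bary_edge_src// bary_edge_dst// opprK.
  rewrite (eq_bigr (fun l => bary x l `^ a l)); last first.
    by move=> l /andP[li lj]; rewrite bary_edge_other.
  rewrite [t + _]addrC; ring.
exact: integrableS iGx.
Qed.
End divergence.

Section monomial.
Context {R : realType} {d : nat}.
Implicit Types (x : 'rV[R]_d) (k : {ffun 'I_d.+1 -> nat}) (i j : 'I_d.+1).

Definition bmon k x : R := monom (bary x) k.

Lemma within_bmon (A : set 'rV[R]_d) k : {within A, continuous (bmon k)}.
Proof.
have ci i n : {within A, continuous (fun x : 'rV[R]_d => bary x i ^+ n)}.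
  elim: n => [|n IHn]; first by under eq_fun do rewrite expr0; exact: within_cst.
  by under eq_fun do rewrite exprS; apply: within_mul IHn; exact: within_bary.
rewrite /bmon /monom; elim: (index_enum _) => [|i r IHr].
  by under eq_fun do rewrite big_nil; exact: within_cst.
by under eq_fun do rewrite big_cons; exact: within_mul IHr.
Qed.

Lemma bmon_incr k i x : bmon (incr k i) x = bary x i * bmon k x.
Proof. exact: monom_incr. Qed.

Lemma bmon_decr k i x : (k i)%:R * (bary x i * bmon (decr k i) x) = (k i)%:R * bmon k x.
Proof.
have [->|ki] := posnP (k i); first by rewrite !mul0r.
by rewrite -bmon_incr incr_decr.
Qed.

Lemma bmon_ge0 k x : simplex x -> 0 <= bmon k x.
Proof. by move=> /simplexP x0; rewrite prodr_ge0// => i _; rewrite exprn_ge0. Qed.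

Lemma bmon_le1 k x : simplex x -> bmon k x <= 1.
Proof.
move=> Sx; have /simplexP x0 := Sx; apply: prodr_ile1 => i _.
by rewrite exprn_ge0//= exprn_ile1// bary_le1.
Qed.

Lemma bmon_gt0 k x : osimplex x -> 0 < bmon k x.
Proof. by move=> xO; rewrite prodr_gt0// => i _; rewrite exprn_gt0. Qed.

Lemma sum_bmon_incr k x : \sum_i bmon (incr k i) x = bmon k x.
Proof.
by under eq_bigr do rewrite bmon_incr; rewrite -mulr_suml sum_bary mul1r.
Qed.

Lemma is_derive_bmon x i j k : i != j ->
  is_derive x (edge i j : 'rV[R]_d) (bmon k)
    ((k j)%:R * bmon (decr k j) x - (k i)%:R * bmon (decr k i) x).
Proof.
move=> ij; apply/is_derive_line0.
pose C := \prod_(l | (l != i) && (l != j)) bary x l ^+ k l.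
have E : (fun s : R => bmon k (x + s *: edge i j)) =
    (fun s => C * ((bary x i - s) ^+ k i * (bary x j + s) ^+ k j)).
  apply/funext => s; rewrite /bmon /monom (bigD1 i)//= (bigD1 j) 1?eq_sym//=.
  rewrite bary_edge_src// bary_edge_dst//.
  rewrite (eq_bigr (fun l => bary x l ^+ k l)); last first.
    by move=> l /andP[li lj]; rewrite bary_edge_other.
  by rewrite -/C; ring.
rewrite E.
have D l : bmon (decr k l) x = bary x l ^+ (k l).-1 * \prod_(l' | l' != l) bary x l' ^+ k l'.
  rewrite /bmon /monom (bigD1 l)//= ffunE eqxx subn1; congr (_ * _).
  by apply: eq_bigr => l' l'l; rewrite ffunE (negbTE l'l) subn0.
have d1 : is_derive (0 : R) 1 (fun s => bary x i - s) (- 1).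
  by have := is_deriveB (is_derive_cst (bary x i) (0 : R) (1 : R)) (is_derive_id (0 : R) (1 : R)); rewrite sub0r.
have d2 : is_derive (0 : R) 1 (fun s => bary x j + s) 1.
  by have := is_deriveD (is_derive_cst (bary x j) (0 : R) (1 : R)) (is_derive_id (0 : R) (1 : R)); rewrite add0r.
have := is_deriveX (k i) d1; rewrite exprfctE => p1.
have := is_deriveX (k j) d2; rewrite exprfctE => p2.
have p := is_deriveZ C (is_deriveM p1 p2).
apply: (is_derive_eq p).
rewrite !subr0 !addr0 /GRing.scale/= !D.
rewrite [\prod_(l' | l' != j) _](bigD1 i)//= [\prod_(l' | l' != i) _](bigD1 j) 1?eq_sym//=.
rewrite [X in _ = _ * (_ * (_ * X)) - _](eq_bigl (fun l => (l != i) && (l != j))); last first.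
  by move=> l; rewrite andbC.
by rewrite -/C; ring.
Qed.
End monomial.

Section self_adjoint.
Context {R : realType} {d : nat} (hd : (0 < d)%N).
Variables (a : 'I_d.+1 -> R) (a1 : forall i, -1 < a i).
Implicit Types (x : 'rV[R]_d) (k : {ffun 'I_d.+1 -> nat}) (i j : 'I_d.+1).
Local Notation S := (@simplex R d).
Local Notation O := (@osimplex R d).
Local Notation w_int := (w_int a).
Local Notation w_integrable := (w_integrable a).

(** The moments of the weight, that is, the Dirichlet integrals. *)
Definition bmom k : R := w_int (bmon k).
Definition wdim : R := \sum_i (a i + 1).

Lemma wdim_gt0 : 0 < wdim.
Proof.
rewrite /wdim (bigD1 ord0)//= ltr_pwDl//; first by have := a1 ord0; lra.
by rewrite sumr_ge0// => i _; have := a1 i; lra.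
Qed.

Lemma w_integrable_bmon k : w_integrable (bmon k).
Proof. by apply: (w_integrable_within hd a1); exact: within_bmon. Qed.

Lemma bmom_gt0 k : 0 < bmom k.
Proof.
apply: (w_int_gt0 hd); first exact: w_integrable_bmon.
by move=> x; exact: bmon_gt0.
Qed.

(** Integration by parts against [u = bmon k]. *)
Lemma bmom_swap k i j :
  ((k j)%:R + a j + 1) * bmom (incr k i) = ((k i)%:R + a i + 1) * bmom (incr k j).
Proof.
have [->//|ij] := eqVneq i j.
have ik := w_integrable_bmon.
have := @w_int_div R d hd a a1 i j (bmon k)
  (fun x => (k j)%:R * bmon (decr k j) x - (k i)%:R * bmon (decr k i) x) ij.
move=> /(_ (@within_bmon _ _ _ _)) h; apply/eqP; rewrite -subr_eq0; apply/eqP.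
rewrite -[RHS]h.
- rewrite /bmom -!w_intZ// -w_intB; try exact: w_integrableZ.
  congr w_int; apply/funext => x; rewrite !bmon_incr.
  have := bmon_decr k j x; have := bmon_decr k i x => ei ej.
  transitivity (((k j)%:R * (bary x j * bmon (decr k j) x)) * bary x i
    - ((k i)%:R * (bary x i * bmon (decr k i) x)) * bary x j
    + ((a j + 1) * bary x i - (a i + 1) * bary x j) * bmon k x); last by ring.
  by rewrite ei ej; ring.
- by apply: within_sub; apply: within_mul; (try exact: within_cst); exact: within_bmon.
- by move=> x _; exact: is_derive_bmon.
Qed.

(** Summing the exchange relation over one of the indices, since the barycentric
coordinates add up to 1. This is the recursion that a quotient of Gamma
functions satisfies, obtained without evaluating the integral. *)
Lemma bmom_incr k j :
  ((deg k)%:R + wdim) * bmom (incr k j) = ((k j)%:R + a j + 1) * bmom k.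
Proof.
have -> : bmom k = \sum_i bmom (incr k i).
  rewrite /bmom -(w_int_sum hd a1); last by move=> i; exact: w_integrable_bmon.
  by congr w_int; apply/funext => x; rewrite sum_bmon_incr.
rewrite mulr_sumr; under eq_bigr do rewrite bmom_swap.
rewrite -mulr_suml; congr (_ * _).
rewrite /deg natr_sum /wdim -big_split/=; apply: eq_bigr => i _; ring.
Qed.

(** w^-1 d_ij (lambda_i lambda_j w d_ij g) with the product rule carried out, [g1]
and [g2] being the first and second derivatives of [g] along the edge. In this
form it is continuous up to the boundary. *)
Definition edge_op (g1 g2 : 'rV[R]_d -> R) i j x : R :=
  ((a j + 1) * bary x i - (a i + 1) * bary x j) * g1 x + bary x i * bary x j * g2 x.

(** Green's formula along the edge: the difference of the two integrands is the
divergence of lambda_i lambda_j w (lambda^k d_ij g - g d_ij lambda^k). The second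
factor on the right is [edge_op] applied to the monomial, written so that no
exponent k - 2 e_j occurs and that it is symmetric in i and j. *)
Lemma edge_op_sym i j k (g g1 g2 : 'rV[R]_d -> R) : i != j ->
  {within S, continuous g} -> {within S, continuous g1} -> {within S, continuous g2} ->
  (forall x, O x -> is_derive x (edge i j : 'rV[R]_d) g (g1 x)) ->
  (forall x, O x -> is_derive x (edge i j : 'rV[R]_d) g1 (g2 x)) ->
  w_int (fun x => edge_op g1 g2 i j x * bmon k x) =
  w_int (fun x => g x * (((k j)%:R * ((k j)%:R + a j) * (bary x i * bmon (decr k j) x)
     - (k j)%:R * ((k i)%:R + a i + 1) * bmon k x) +
    ((k i)%:R * ((k i)%:R + a i) * (bary x j * bmon (decr k i) x)
     - (k i)%:R * ((k j)%:R + a j + 1) * bmon k x))).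
Proof.
move=> ij cg cg1 cg2 dg dg1.
pose q1 x := (k j)%:R * bmon (decr k j) x - (k i)%:R * bmon (decr k i) x.
pose q2 x := (k j)%:R * ((decr k j j)%:R * bmon (decr (decr k j) j) x - (decr k j i)%:R * bmon (decr (decr k j) i) x)
  - (k i)%:R * ((decr k i j)%:R * bmon (decr (decr k i) j) x - (decr k i i)%:R * bmon (decr (decr k i) i) x).
have wc := fun A c => @within_cst R d A c.
have wb := fun A i => @within_bary R d A i.
have wm := fun A k => @within_bmon R d A k.
have cq1 : {within S, continuous q1} by apply: within_sub; apply: within_mul.
have cq2 : {within S, continuous q2}.
  by apply: within_sub; apply: within_mul => //; apply: within_sub; apply: within_mul.
have dq x : is_derive x (edge i j : 'rV[R]_d) (bmon k) (q1 x) by exact: is_derive_bmon.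
have dq1 x : is_derive x (edge i j : 'rV[R]_d) q1 (q2 x).
  have ha := is_deriveZ (k j)%:R (is_derive_bmon x (decr k j) ij).
  have hb := is_deriveZ (k i)%:R (is_derive_bmon x (decr k i) ij).
  exact: is_deriveB ha hb.
have key := @w_int_div R d hd a a1 i j (fun x => bmon k x * g1 x - g x * q1 x)
  (fun x => bmon k x * g2 x - g x * q2 x) ij.
have wi h : {within S, continuous h} -> w_integrable h by exact: w_integrable_within.
apply/eqP; rewrite -subr_eq0 -w_intB; first last.
- apply: wi; apply: within_mul => //.
  by apply: within_add; apply: within_sub; do ?[apply: within_mul => //].
- apply: wi; apply: within_mul => //.
  apply: within_add; apply: within_mul => //; last exact: within_mul.
  by apply: within_sub; apply: within_mul.
apply/eqP; rewrite -[RHS]key.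
- congr w_int; apply/funext => x; rewrite /edge_op.
  have ji : j != i by rewrite eq_sym.
  have K1 l : (k l)%:R * (decr k l l)%:R = (k l)%:R * ((k l)%:R - 1) :> R.
    have [->|kl] := posnP (k l); first by rewrite !mul0r.
    by rewrite ffunE eqxx natrB.
  have K2 : decr k j i = k i by rewrite ffunE (negbTE ij) subn0.
  have K3 : decr k i j = k j by rewrite ffunE (negbTE ji) subn0.
  have e1 := bmon_decr k j x; have e2 := bmon_decr k i x.
  have e3 := bmon_decr (decr k j) j x; have e4 := bmon_decr (decr k j) i x.
  have e5 := bmon_decr (decr k i) j x; have e6 := bmon_decr (decr k i) i x.
  have Eq2 : bary x i * bary x j * q2 x =
      (k j)%:R * ((k j)%:R - 1) * (bary x i * bmon (decr k j) x)
      - (k i)%:R * ((k j)%:R * bmon k x) - (k j)%:R * ((k i)%:R * bmon k x)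
      + (k i)%:R * ((k i)%:R - 1) * (bary x j * bmon (decr k i) x).
    rewrite /q2; transitivity
      ((k j)%:R * (bary x i * ((decr k j j)%:R * (bary x j * bmon (decr (decr k j) j) x))
        - bary x j * ((decr k j i)%:R * (bary x i * bmon (decr (decr k j) i) x)))
      - (k i)%:R * (bary x i * ((decr k i j)%:R * (bary x j * bmon (decr (decr k i) j) x))
        - bary x j * ((decr k i i)%:R * (bary x i * bmon (decr (decr k i) i) x)))).
      by ring.
    rewrite e3 e4 e5 e6 K2 K3 -e1 -[X in _ - _ * X + _]e2 -!K1; ring.
  have Eq1 : ((a j + 1) * bary x i - (a i + 1) * bary x j) * q1 x =
      (a j + 1) * (k j)%:R * (bary x i * bmon (decr k j) x)
      - (a j + 1) * ((k i)%:R * bmon k x) - (a i + 1) * ((k j)%:R * bmon k x)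
      + (a i + 1) * (k i)%:R * (bary x j * bmon (decr k i) x).
    by rewrite -e1 -e2 /q1; ring.
  transitivity ((((a j + 1) * bary x i - (a i + 1) * bary x j) * g1 x +
      bary x i * bary x j * g2 x) * bmon k x
    - g x * (((a j + 1) * bary x i - (a i + 1) * bary x j) * q1 x +
       bary x i * bary x j * q2 x)); last by ring.
  by rewrite Eq1 Eq2; ring.
- by apply: within_sub; apply: within_mul.
- by apply: within_sub; apply: within_mul.
- move=> x xO.
  have ha := is_deriveM (dq x) (dg1 x xO).
  have hb := is_deriveM (dg x xO) (dq1 x).
  apply: (is_derive_eq (is_deriveB ha hb)).
  rewrite /GRing.scale/=; ring.
Qed.
End self_adjoint.

(** * The step identity *)

Lemma sum_ltn_pairs (R : comNzRingType) n (T : 'I_n -> 'I_n -> R) :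
  \sum_(i < n) \sum_(j < n | (i < j)%N) (T i j + T j i) = \sum_i \sum_j T i j - \sum_i T i i.
Proof.
under eq_bigr do rewrite big_split/=.
rewrite big_split/= [X in _ + X](exchange_big_dep xpredT)//=.
rewrite -sumrB -big_split/=; apply: eq_bigr => i _.
rewrite [in RHS](bigD1 i)//= addrAC subrr add0r.
rewrite [RHS](bigID (fun j : 'I_n => (i < j)%N))/=; congr (_ + _).
  by apply: eq_bigl => j; rewrite -(inj_eq val_inj)/= neq_ltn; case: ltngtP.
by apply: eq_bigl => j; rewrite -(inj_eq val_inj)/=; case: ltngtP.
Qed.

Section durrmeyer_step.
Context {R : realType} {d : nat} (hd : (0 < d)%N).
Variables (a : 'I_d.+1 -> R) (a1 : forall i, -1 < a i).
Implicit Types (x : 'rV[R]_d) (k : {ffun 'I_d.+1 -> nat}) (i j : 'I_d.+1).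
Local Notation S := (@simplex R d).
Local Notation O := (@osimplex R d).
Local Notation w_int := (w_int a).
Local Notation w_integrable := (w_integrable a).
Local Notation A := (wdim a).

(** The mean of [h] for the probability density proportional to lambda^k w. *)
Definition bmean (h : 'rV[R]_d -> R) k : R := w_int (fun x => h x * bmon k x) / bmom a k.
(** The operator M_n: the multinomial law with parameters lambda(x) replaces the
Bernstein polynomials. *)
Definition durrmeyer n h x : R := mmean (bary x) n (bmean h).

Lemma w_integrable_bmonM h k : w_integrable h -> w_integrable (fun x => h x * bmon k x).
Proof.
move=> ih; apply: (w_integrableM (M := 1)) ih.
  by apply: measurable_within; exact: within_bmon.
by move=> x Sx; rewrite ger0_norm ?bmon_ge0// bmon_le1.
Qed.

Section operator.
Variables (g : 'rV[R]_d -> R) (g1 g2 : 'I_d.+1 -> 'I_d.+1 -> 'rV[R]_d -> R).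
Hypotheses (cg : {within S, continuous g})
  (cg1 : forall i j, {within S, continuous (g1 i j)})
  (cg2 : forall i j, {within S, continuous (g2 i j)})
  (dg : forall i j x, O x -> is_derive x (edge i j : 'rV[R]_d) g (g1 i j x))
  (dg1 : forall i j x, O x -> is_derive x (edge i j : 'rV[R]_d) (g1 i j) (g2 i j x)).

Definition simplex_op x : R :=
  \sum_(i < d.+1) \sum_(j < d.+1 | (i < j)%N) edge_op a (g1 i j) (g2 i j) i j x.

Lemma within_edge_op i j : {within S, continuous (edge_op a (g1 i j) (g2 i j) i j)}.
Proof.
have wb i' := @within_bary R d S i'; have wc c := @within_cst R d S c.
apply: within_add; apply: within_mul => //; last exact: within_mul.
by apply: within_sub; apply: within_mul.
Qed.

Lemma within_sum (I : Type) (r : seq I) (P : pred I) (h : I -> 'rV[R]_d -> R) :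
  (forall z, {within S, continuous (h z)}) ->
  {within S, continuous (fun x => \sum_(z <- r | P z) h z x)}.
Proof.
move=> ch; elim: r => [|z r IHr].
  by under eq_fun do rewrite big_nil; exact: within_cst.
under eq_fun do rewrite big_cons; case: (P z) => //.
by apply: within_add.
Qed.

Lemma within_simplex_op : {within S, continuous simplex_op}.
Proof.
by apply: within_sum => i; apply: within_sum => j; exact: within_edge_op.
Qed.

(** Symmetry moves the operator onto lambda^k, where the sum over the edges
collapses to a combination of lambda^k and the lambda^(k - e_j); the moment
recursion turns the resulting integrals into means. *)
Lemma bmean_simplex_op n k : deg k = n.+1 ->
  bmean simplex_op k =
  (n%:R + A) * (\sum_j (k j)%:R * bmean g (decr k j) - n.+1%:R * bmean g k).
Proof.
move=> kn; have A0 := wdim_gt0 a1; have m0 k' := bmom_gt0 hd a1 k'.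
have nA0 : 0 < n%:R + A by rewrite ltr_wpDl.
have wi h : {within S, continuous h} -> w_integrable h by exact: w_integrable_within.
pose J k' := w_int (fun x => g x * bmon k' x).
have iJ k' : w_integrable (fun x => g x * bmon k' x) by apply: w_integrable_bmonM; exact: wi.
(* The terms of [edge_op] on lambda^k that carry the factor [k j]; the sum over the
   pairs i < j of [T i j + T j i] becomes a sum over ordered pairs. *)
pose T i j x := (k j)%:R * ((k j)%:R + a j) * (bary x i * bmon (decr k j) x)
     - (k j)%:R * ((k i)%:R + a i + 1) * bmon k x.
have sumT x : \sum_(i < d.+1) \sum_(j < d.+1 | (i < j)%N) (T i j x + T j i x) =
    \sum_j (k j)%:R * ((k j)%:R + a j) * bmon (decr k j) x - n.+1%:R * (n%:R + A) * bmon k x.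
  rewrite (sum_ltn_pairs (fun i j => T i j x)) exchange_big/= -sumrB.
  transitivity (\sum_j ((k j)%:R * ((k j)%:R + a j) * bmon (decr k j) x -
      (k j)%:R * (n%:R + A) * bmon k x)).
    apply: eq_bigr => j _; rewrite /T sumrB.
    rewrite -mulr_sumr -mulr_suml sum_bary mul1r.
    rewrite -mulr_suml -mulr_sumr (_ : \sum_i ((k i)%:R + a i + 1) = n.+1%:R + A); last first.
      rewrite -kn /deg natr_sum /wdim -big_split/=; apply: eq_bigr => i _; ring.
    have := bmon_decr k j x => e.
    transitivity ((k j)%:R * ((k j)%:R + a j) * bmon (decr k j) x - (k j)%:R * (n.+1%:R + A) * bmon k x
       - ((k j)%:R + a j) * ((k j)%:R * (bary x j * bmon (decr k j) x)) + (k j)%:R * ((k j)%:R + a j + 1) * bmon k x).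
      ring.
    by rewrite e -natr1; ring.
  rewrite sumrB -mulr_suml -mulr_suml -natr_sum -/(deg k) kn; ring.
have num : w_int (fun x => simplex_op x * bmon k x) =
    \sum_j (k j)%:R * ((k j)%:R + a j) * J (decr k j) - n.+1%:R * (n%:R + A) * J k.
  transitivity (w_int (fun x => \sum_(i < d.+1) \sum_(j <- [seq j : 'I_d.+1 <- index_enum _ | (i < j)%N])
      (edge_op a (g1 i j) (g2 i j) i j x * bmon k x))).
    congr w_int; apply/funext => x; rewrite /simplex_op mulr_suml; apply: eq_bigr => i _.
    by rewrite mulr_suml big_filter.
  have ie i j : w_integrable (fun x => edge_op a (g1 i j) (g2 i j) i j x * bmon k x).
    by apply: w_integrable_bmonM; apply: wi; exact: within_edge_op.
  rewrite (w_int_sum hd a1); last by move=> i; exact: w_integrable_sum.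
  transitivity (\sum_(i < d.+1) \sum_(j <- [seq j : 'I_d.+1 <- index_enum _ | (i < j)%N])
      w_int (fun x => g x * (T i j x + T j i x))).
    apply: eq_bigr => i _; rewrite (w_int_sum hd a1)// !big_filter.
    apply: eq_bigr => j ij; apply: edge_op_sym => //; try exact: dg; try exact: dg1.
    by rewrite -(inj_eq val_inj)/= neq_ltn ij.
  have wT i j : {within S, continuous (T i j)}.
    have wc := fun c => @within_cst R d S c; have wb := fun i => @within_bary R d S i.
    have wm := fun k => @within_bmon R d S k.
    by apply: within_sub; apply: within_mul => //; exact: within_mul.
  have iT i j : w_integrable (fun x => g x * (T i j x + T j i x)).
    by apply: wi; apply: within_mul => //; exact: within_add.
  under eq_bigr do rewrite -(w_int_sum hd a1)//.
  rewrite -(w_int_sum hd a1); last by move=> i; exact: w_integrable_sum.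
  transitivity (w_int (fun x => \sum_j (k j)%:R * ((k j)%:R + a j) * (g x * bmon (decr k j) x)
       - n.+1%:R * (n%:R + A) * (g x * bmon k x))).
    congr w_int; apply/funext => x.
    under eq_bigr do rewrite -mulr_sumr big_filter.
    rewrite -mulr_sumr sumT mulrBr mulr_sumr; congr (_ - _); last by ring.
    by apply: eq_bigr => j _; ring.
  rewrite w_intB ?w_intZ//; first last.
  - exact: w_integrableZ.
  - by apply: (w_integrable_sum hd a1) => j; exact: w_integrableZ.
  rewrite (w_int_sum hd a1) => [|j]; last exact: w_integrableZ.
  by congr (_ - _); apply: eq_bigr => j _; rewrite w_intZ.
rewrite /bmean num mulrBl mulrBr; congr (_ - _); last by rewrite -/(J k); ring.
rewrite mulr_suml mulr_sumr; apply: eq_bigr => j _; rewrite -/(J (decr k j)).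
have [->|kj] := posnP (k j); first by rewrite !mul0r mulr0.
have := bmom_incr hd a1 (decr k j) j; rewrite incr_decr//.
have -> : deg (decr k j) = n by apply: succn_inj; rewrite -kn -[in RHS](incr_decr kj) deg_incr.
have -> : (decr k j j)%:R + a j + 1 = (k j)%:R + a j.
  by rewrite ffunE eqxx /= natrB//; ring.
move=> e; have mk := m0 k; have mj := m0 (decr k j).
have -> : (k j)%:R + a j = (n%:R + A) * bmom a k / bmom a (decr k j).
  by rewrite e mulfK// gt_eqF.
by field; rewrite !gt_eqF.
Qed.

(** The means of degree n come in through the size biasing of the multinomial
law. *)
Lemma durrmeyer_step n x :
  durrmeyer n.+1 simplex_op x =
  (n%:R + A) * n.+1%:R * (durrmeyer n g x - durrmeyer n.+1 g x).
Proof.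
rewrite /durrmeyer; set X := bary x.
rewrite (@eq_mmean _ _ _ _ _ (fun k => (n%:R + A) *
  (\sum_j (k j)%:R * bmean g (decr k j) - n.+1%:R * bmean g k))); last first.
  by move=> k; exact: bmean_simplex_op.
rewrite mmeanZ mmeanB mmeanZ mmean_decr ?sum_bary//; ring.
Qed.
End operator.
End durrmeyer_step.

(** * Uniform convergence on continuous functions *)

Section approximation.
Context {R : realType} {d : nat} (hd : (0 < d)%N).
Variables (a : 'I_d.+1 -> R) (a1 : forall i, -1 < a i).
Implicit Types (x y : 'rV[R]_d) (k : {ffun 'I_d.+1 -> nat}) (i j : 'I_d.+1)
  (h : 'rV[R]_d -> R).
Local Notation S := (@simplex R d).
Local Notation w_int := (w_int a).
Local Notation w_integrable := (w_integrable a).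
Local Notation A := (wdim a).
Local Notation Bmean := (bmean a).
Local Notation Mop := (durrmeyer a).

Lemma bmeanD h h' k : w_integrable h -> w_integrable h' ->
  Bmean (fun x => h x + h' x) k = Bmean h k + Bmean h' k.
Proof.
move=> ih ih'; rewrite /bmean -mulrDl -w_intD; last 2 first.
- exact: w_integrable_bmonM.
- exact: w_integrable_bmonM.
by congr (w_int _ / _); apply/funext => x; rewrite mulrDl.
Qed.

Lemma bmeanZ c h k : w_integrable h -> Bmean (fun x => c * h x) k = c * Bmean h k.
Proof.
move=> ih; rewrite /bmean mulrA -w_intZ; last exact: w_integrable_bmonM.
by congr (w_int _ / _); apply/funext => x; rewrite mulrA.
Qed.

Lemma bmeanB h h' k : w_integrable h -> w_integrable h' ->
  Bmean (fun x => h x - h' x) k = Bmean h k - Bmean h' k.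
Proof.
move=> ih ih'; rewrite -mulN1r -bmeanZ// -bmeanD//; last exact: w_integrableZ.
by congr (Bmean _ _); apply/funext => x; rewrite mulN1r.
Qed.

Lemma bmean_cst c k : Bmean (fun=> c) k = c.
Proof.
rewrite /bmean w_intZ; last exact: w_integrable_bmon.
by rewrite mulfK// gt_eqF// bmom_gt0.
Qed.

Lemma ler_bmean h h' k : w_integrable h -> w_integrable h' ->
  (forall x, S x -> h x <= h' x) -> Bmean h k <= Bmean h' k.
Proof.
move=> ih ih' hh'; rewrite ler_pM2r ?invr_gt0 ?bmom_gt0//.
apply: ler_w_int; [exact: w_integrable_bmonM|exact: w_integrable_bmonM|].
by move=> x Sx; rewrite ler_wpM2r ?bmon_ge0 ?hh'.
Qed.

Lemma ler_norm_bmean h k : w_integrable h -> `|Bmean h k| <= Bmean (fun x => `|h x|) k.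
Proof.
move=> ih; have ih' := w_integrable_norm ih.
rewrite ler_norml -mulN1r -bmeanZ//; apply/andP; split; apply: ler_bmean => //.
- exact: w_integrableZ.
- by move=> x _; rewrite mulN1r lerNl -normrN ler_norm.
- by move=> x _; exact: ler_norm.
Qed.

(** The mean of a Dirichlet law, from the moment recursion. *)
Lemma bmean_bary i k : Bmean (bary^~ i) k = ((k i)%:R + (a i + 1)) / ((deg k)%:R + A).
Proof.
have A0 : 0 < (deg k)%:R + A by rewrite ltr_wpDl// wdim_gt0.
have m0 := bmom_gt0 hd a1 k.
rewrite /bmean (_ : w_int _ = bmom a (incr k i)); last first.
  by congr w_int; apply/funext => x; rewrite bmon_incr.
apply/eqP; rewrite eqr_div ?(gt_eqF m0) ?(gt_eqF A0)//; apply/eqP.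
by rewrite mulrC bmom_incr// addrA.
Qed.

Lemma bmean_bary2 i k : Bmean (fun x => bary x i ^+ 2) k =
  ((k i)%:R + (a i + 1)) * ((k i)%:R + (a i + 1) + 1) /
    (((deg k)%:R + A) * ((deg k)%:R + A + 1)).
Proof.
have A0 : 0 < (deg k)%:R + A by rewrite ltr_wpDl// wdim_gt0.
have A1 : 0 < (deg k)%:R + A + 1 by rewrite ltr_wpDl// ltW.
have m0 := bmom_gt0 hd a1 k.
rewrite /bmean (_ : w_int _ = bmom a (incr (incr k i) i)); last first.
  by congr w_int; apply/funext => x; rewrite !bmon_incr mulrA expr2.
have e1 := bmom_incr hd a1 k i; have := bmom_incr hd a1 (incr k i) i.
rewrite deg_incr ffunE eqxx addn1 -!natr1 => e2.
have AA := mulr_gt0 A0 A1.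
apply/eqP; rewrite eqr_div ?(gt_eqF m0) ?(gt_eqF AA)//; apply/eqP.
transitivity (((deg k)%:R + 1 + A) * bmom a (incr (incr k i) i) * ((deg k)%:R + A)); first by ring.
rewrite e2.
transitivity (((k i)%:R + (a i + 1) + 1) * (((deg k)%:R + A) * bmom a (incr k i))); first by ring.
by rewrite e1; ring.
Qed.

(** An explicit computation from the first two moments of the Dirichlet and
multinomial laws, the leading terms in N cancelling. *)
Lemma durrmeyer_variance i : exists2 C, 0 <= C & forall N x, S x ->
  Mop N (fun y => (bary y i - bary x i) ^+ 2) x <= C / (N%:R + A).
Proof.
have A0 := wdim_gt0 a1; set b := a i + 1; have b0 : 0 < b by rewrite /b; have := a1 i; lra.
exists (A ^+ 2 + A + b * (b + 1) + 2).
  by have := mulr_ge0 (ltW A0) (ltW A0); have := mulr_ge0 (ltW b0) (ltW b0); nra.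
move=> N x Sx; set X := bary x i.
have X0 : 0 <= X by move: Sx => /simplexP; exact.
have X1 : X <= 1 by exact: bary_le1.
have NA0 : 0 < N%:R + A by rewrite ltr_wpDl.
have NA1 : 0 < N%:R + A + 1 by rewrite ltr_wpDl// ltW.
have wi h : {within S, continuous h} -> w_integrable h by exact: w_integrable_within.
have wb : w_integrable (bary^~ i) by apply: wi; exact: within_bary.
have wb2 : w_integrable (fun y => bary y i ^+ 2).
  by apply: wi; under eq_fun do rewrite expr2; apply: within_mul; exact: within_bary.
have wc c : w_integrable (fun=> c) by apply: wi; exact: within_cst.
rewrite /durrmeyer (@eq_mmean _ _ _ _ _ (fun k =>
  ((N%:R + A) * (N%:R + A + 1))^-1 * ((k i)%:R ^+ 2) +
  ((2 * b + 1) / ((N%:R + A) * (N%:R + A + 1)) - 2 * X / (N%:R + A)) * (k i)%:R +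
  (b * (b + 1) / ((N%:R + A) * (N%:R + A + 1)) - 2 * X * b / (N%:R + A) + X ^+ 2))); last first.
  move=> k kN.
  rewrite (_ : (fun y => _) = (fun y => (bary y i ^+ 2 - (2 * X) * bary y i) + X ^+ 2)); last first.
    by apply/funext => y; ring.
  rewrite bmeanD//; last by apply: w_integrableB => //; exact: w_integrableZ.
  rewrite bmeanB//; last exact: w_integrableZ.
  rewrite bmeanZ// bmean_cst bmean_bary bmean_bary2 kN -/b.
  by field; rewrite !gt_eqF.
rewrite mmeanD mmeanD mmeanZ mmean_coord2 ?sum_bary// mmeanZ mmean_coord ?sum_bary//.
rewrite mmean_cst ?sum_bary//.
rewrite -/X.
have -> : ((N%:R + A) * (N%:R + A + 1))^-1 * (N%:R * (N%:R - 1) * X ^+ 2 + N%:R * X) +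
   ((2 * b + 1) / ((N%:R + A) * (N%:R + A + 1)) - 2 * X / (N%:R + A)) * (N%:R * X) +
   (b * (b + 1) / ((N%:R + A) * (N%:R + A + 1)) - 2 * X * b / (N%:R + A) + X ^+ 2) =
  (X ^+ 2 * (A ^+ 2 + A - 2 * N%:R) + X * (2 * N%:R - 2 * b * (A + 1)) + b * (b + 1)) /
    ((N%:R + A) * (N%:R + A + 1)).
  by field; rewrite !gt_eqF.
have N0 : 0 <= N%:R :> R by [].
have XX1 : X ^+ 2 <= 1 by rewrite exprn_ile1.
have AA : 0 <= A ^+ 2 + A by rewrite addr_ge0 ?sqr_ge0// ltW.
have b0' := ltW b0; have A0' := ltW A0.
have bb : 0 <= b * (b + 1) by rewrite mulr_ge0// addr_ge0.
rewrite ler_pdivrMr ?mulr_gt0// [leRHS]mulrA divfK ?gt_eqF//.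
have h1 : X ^+ 2 * (A ^+ 2 + A - 2 * N%:R) <= A ^+ 2 + A.
  rewrite mulrBr lerBlDr (@le_trans _ _ (A ^+ 2 + A))//.
    by rewrite ler_piMl.
  by rewrite lerDl !mulr_ge0// sqr_ge0.
have h2 : X * (2 * N%:R - 2 * b * (A + 1)) <= 2 * N%:R.
  rewrite mulrBr lerBlDr (@le_trans _ _ (2 * N%:R))//.
    by rewrite ler_piMl// mulr_ge0.
  by rewrite lerDl !mulr_ge0// addr_ge0.
have h3 : 0 <= (A ^+ 2 + A + b * (b + 1)) * (N%:R + A).
  by rewrite mulr_ge0// addr_ge0.
have h4 : (A ^+ 2 + A + b * (b + 1) + 2) * (N%:R + A + 1) =
  (A ^+ 2 + A + b * (b + 1)) * (N%:R + A) + (A ^+ 2 + A) + b * (b + 1) + 2 * N%:R + 2 * A + 2 by ring.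
by rewrite h4; lra.
Qed.

(** Korovkin's argument: by uniform continuity [g y] differs from [g x] by at most
[e / 2] plus a multiple of the squared distance of y from x, and M_N of the
latter is small. *)
Lemma durrmeyer_cvg g (e : R) n : {within S, continuous g} -> 0 < e ->
  exists2 N, (n <= N)%N & forall x, S x -> `|Mop N g x - g x| <= e.
Proof.
move=> cg e0; have A0 := wdim_gt0 a1.
have wi h : {within S, continuous h} -> w_integrable h by exact: w_integrable_within.
have e20 : 0 < e / 2 by rewrite divr_gt0.
have [r r0 rP] := uniform_on_simplex e20 cg.
have [M M0 gM] := bounded_on_simplex cg.
have /choice[C CP] : forall i, exists C, 0 <= C /\ forall N x, S x ->
    Mop N (fun y => (bary y i - bary x i) ^+ 2) x <= C / (N%:R + A).
  by move=> i; have [C C0 CP] := durrmeyer_variance i; exists C.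
(* Where [|y - x| >= r] in the max norm, [2 M] is at most [c] times the squared
   distance. *)
pose c := 2 * M / r ^+ 2; have c0 : 0 <= c by rewrite divr_ge0 ?sqr_ge0// mulr_ge0.
have r20 : 0 < r ^+ 2 by rewrite exprn_gt0.
have key x y : S x -> S y -> `|g y - g x| <= e / 2 + c * \sum_i (bary y i - bary x i) ^+ 2.
  move=> Sx Sy; have s0 i : 0 <= (bary y i - bary x i) ^+ 2 by exact: sqr_ge0.
  have [xy|xy] := pselect (ball x r y).
    rewrite distrC (le_trans (rP x y Sx Sy xy))// lerDl mulr_ge0// sumr_ge0//.
  have [k rk] : exists k : 'I_d, r <= `|x ord0 k - y ord0 k|.
    apply/not_existsP => h; apply: xy; split=> // i k; rewrite (ord1 i).
    by have /negP := h k; rewrite -ltNge.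
  apply: (@le_trans _ _ (2 * M)).
    by rewrite (le_trans (ler_normB _ _))// mulr2n mulrDl mul1r lerD ?gM.
  apply: (@le_trans _ _ (c * r ^+ 2)); first by rewrite divfK// gt_eqF.
  apply: (@le_trans _ _ (c * \sum_i (bary y i - bary x i) ^+ 2)); last by rewrite lerDr ltW.
  rewrite ler_wpM2l// (bigD1 (lift ord0 k))//= ler_wpDr ?sumr_ge0//.
  rewrite !baryS -(real_normK (num_real (y ord0 k - _))) distrC.
  by apply: lerXn2r; rewrite ?nnegrE ?normr_ge0 ?(ltW r0).
pose D := c * \sum_i C i.
have D0 : 0 <= D by rewrite mulr_ge0// sumr_ge0// => i _; have [] := CP i.
have [N nN NP] : exists2 N, (n <= N)%N & D / (N%:R + A) <= e / 2.
  pose m := Num.truncn (D / (e / 2)).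
  exists (maxn n m.+1); first exact: leq_maxl.
  have m0 : 0 < (maxn n m.+1)%:R + A by rewrite ltr_wpDl.
  rewrite ler_pdivrMr// mulrC -ler_pdivrMr// (@le_trans _ _ m.+1%:R)//.
    by rewrite ltW// truncnS_gt.
  by rewrite (@le_trans _ _ (maxn n m.+1)%:R) ?ler_nat ?leq_maxr// lerDl ltW.
exists N => // x Sx; have X0 : forall i, 0 <= bary x i by apply/simplexP.
have wsq i : w_integrable (fun y => (bary y i - bary x i) ^+ 2).
  apply: wi; under eq_fun do rewrite expr2.
  by apply: within_mul; apply: within_sub; (try exact: within_cst); exact: within_bary.
have wc t : w_integrable (fun=> t) by apply: wi; exact: within_cst.
rewrite /durrmeyer -[X in _ - X](@mmean_cst _ _ (bary x) N) ?sum_bary// -mmeanB.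
apply: le_trans (ler_norm_mmean _ _ X0) _.
apply: (@le_trans _ _ (mmean (bary x) N (fun k => e / 2 +
    c * \sum_i Bmean (fun y => (bary y i - bary x i) ^+ 2) k))).
  apply: ler_mmean => // k _.
  rewrite -[X in _ - X](@bmean_cst _ k) -bmeanB//; last exact: wi.
  have wgx : w_integrable (fun y => g y - g x) by apply: w_integrableB => //; exact: wi.
  apply: le_trans (ler_norm_bmean _ wgx) _.
  have wS : w_integrable (fun y => \sum_i (bary y i - bary x i) ^+ 2) by exact: w_integrable_sum.
  apply: (@le_trans _ _ (Bmean (fun y => e / 2 + c * \sum_i (bary y i - bary x i) ^+ 2) k)).
    apply: ler_bmean => [||y Sy]; last exact: key.
    - exact: w_integrable_norm.
    - by apply: w_integrableD => //; exact: w_integrableZ.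
  rewrite bmeanD ?bmean_cst//; last exact: w_integrableZ.
  rewrite bmeanZ// lerD2l le_eqVlt; apply/orP; left; apply/eqP; congr (_ * _).
  rewrite /bmean -mulr_suml -(w_int_sum hd a1); last by move=> i; exact: w_integrable_bmonM.
  by congr (w_int _ / _); apply/funext => y; rewrite mulr_suml.
rewrite mmeanD mmean_cst ?sum_bary// mmeanZ mmean_sum.
rewrite [leRHS](splitr e) lerD2l (le_trans _ NP)// /D -mulrA ler_wpM2l//.
by rewrite mulr_suml; apply: ler_sum => i _; have [_] := CP i; apply.
Qed.
End approximation.

(** * Contractivity in the weighted norms *)

Section power_tangent.
Context {R : realType}.

(** The convex function t^r lies above its tangent at [s]; this is Young's
inequality for t and s^(r - 1). At s = 0 with r = 1 the slope is 1, since 0^0 = 1. *)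
Lemma powR_tangent (r s t : R) : 1 <= r -> 0 <= s -> 0 <= t ->
  s `^ r + r * s `^ (r - 1) * (t - s) <= t `^ r.
Proof.
move=> r1 s0 t0; have r0 : 0 < r by apply: lt_le_trans r1.
have sE : s `^ (r - 1) * s = s `^ r by rewrite mulrC mulr_powRB1.
have [->|rn1] := eqVneq r 1.
  by rewrite subrr powRr0 !powRr1//; lra.
have r1' : 1 < r by rewrite lt_neqAle eq_sym rn1.
pose q := r / (r - 1); have q0 : 0 < q by rewrite divr_gt0// subr_gt0.
have := @conjugate_powR R t (s `^ (r - 1)) r q t0 (powR_ge0 _ _) r0 q0.
have rr : r != 0 by rewrite gt_eqF.
have rr1 : r - 1 != 0 by rewrite subr_eq0.
have -> : r^-1 + q^-1 = 1 by rewrite /q; field; apply/andP; split.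
move=> /(_ erefl).
rewrite -powRrM (_ : (r - 1) * q = r); last by rewrite /q; field.
rewrite (_ : t `^ r / r + s `^ r / q = (t `^ r + (r - 1) * s `^ r) / r); last first.
  by rewrite /q; field; apply/andP; split.
rewrite ler_pdivlMr// => H.
rewrite mulrBr -(mulrA r _ s) sE; move: H; rewrite -mulrA; lra.
Qed.
End power_tangent.

Section contraction.
Context {R : realType} {d : nat} (hd : (0 < d)%N).
Variables (a : 'I_d.+1 -> R) (a1 : forall i, -1 < a i).
Implicit Types (x y : 'rV[R]_d) (k : {ffun 'I_d.+1 -> nat}) (i j : 'I_d.+1)
  (h : 'rV[R]_d -> R).
Local Notation S := (@simplex R d).
Local Notation w_int := (w_int a).
Local Notation w_integrable := (w_integrable a).
Local Notation Bmean := (bmean a).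
Local Notation Mop := (durrmeyer a).

Lemma durrmeyerE n h x : Mop n h x =
  \sum_(k <- [seq k : {ffun 'I_d -> 'I_n.+1} <- index_enum _ | (\sum_(i < d) k i <= n)%N])
     multinom (full_index k) * Bmean h (full_index k) * bmon (full_index k) x.
Proof.
rewrite big_filter /durrmeyer -sum_bernstein; apply: eq_bigr => k kn.
by rewrite bernsteinE// mulrAC.
Qed.

Lemma within_durrmeyer n h : {within S, continuous (Mop n h)}.
Proof.
rewrite (funext (durrmeyerE n h)); apply: within_sum => k.
by apply: within_mul; [exact: within_cst|exact: within_bmon].
Qed.

(** M_n preserves the weighted integral: integrating a Bernstein polynomial cancels
its normalisation, and the Bernstein polynomials add up to 1. *)
Lemma w_int_durrmeyer n h : w_integrable h -> w_int (Mop n h) = w_int h.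
Proof.
move=> ih; have ib k := w_integrable_bmon hd a1 k.
rewrite (funext (durrmeyerE n h)) (w_int_sum hd a1) => [|k]; last exact: w_integrableZ.
transitivity (\sum_(k <- [seq k : {ffun 'I_d -> 'I_n.+1} <- index_enum _ | (\sum_(i < d) k i <= n)%N])
     w_int (fun x => multinom (full_index k) * (h x * bmon (full_index k) x))).
  apply: eq_bigr => k _; rewrite w_intZ// w_intZ; last exact: w_integrable_bmonM.
  by rewrite -mulrA /bmean divfK// gt_eqF// bmom_gt0.
rewrite -(w_int_sum hd a1) => [|k]; last by apply: w_integrableZ; exact: w_integrable_bmonM.
congr w_int; apply/funext => x.
transitivity (h x * mmean (bary x) n (fun=> 1)); last by rewrite mmean_cst ?sum_bary// mulr1.
rewrite -sum_bernstein mulr_sumr big_filter; apply: eq_bigr => k kn.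
by rewrite bernsteinE// mulr1 mulrCA.
Qed.

Lemma ler_durrmeyer n h h' x : S x -> w_integrable h -> w_integrable h' ->
  (forall y, S y -> h y <= h' y) -> Mop n h x <= Mop n h' x.
Proof.
move=> Sx ih ih' hh'; apply: ler_mmean => [|k _]; first by apply/simplexP.
exact: ler_bmean.
Qed.

Lemma durrmeyerD n h h' x : w_integrable h -> w_integrable h' ->
  Mop n (fun y => h y + h' y) x = Mop n h x + Mop n h' x.
Proof.
move=> ih ih'; rewrite /durrmeyer -mmeanD; apply: eq_mmean => k _.
exact: bmeanD.
Qed.

Lemma durrmeyerZ n c h x : w_integrable h ->
  Mop n (fun y => c * h y) x = c * Mop n h x.
Proof.
by move=> ih; rewrite /durrmeyer -mmeanZ; apply: eq_mmean => k _; exact: bmeanZ.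
Qed.

Lemma durrmeyerB n h h' x : w_integrable h -> w_integrable h' ->
  Mop n (fun y => h y - h' y) x = Mop n h x - Mop n h' x.
Proof.
move=> ih ih'; rewrite /durrmeyer -mmeanB; apply: eq_mmean => k _.
exact: bmeanB.
Qed.

Lemma durrmeyer_cst n c x : Mop n (fun=> c) x = c.
Proof.
rewrite /durrmeyer (@eq_mmean _ _ _ _ _ (fun=> c)) => [|k _]; last exact: bmean_cst.
by rewrite mmean_cst// sum_bary.
Qed.

Lemma ler_norm_durrmeyer n h x : S x -> w_integrable h ->
  `|Mop n h x| <= Mop n (fun y => `|h y|) x.
Proof.
move=> Sx ih; have X0 : forall i, 0 <= bary x i by apply/simplexP.
apply: le_trans (ler_norm_mmean _ _ X0) _; apply: ler_mmean => // k _.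
exact: ler_norm_bmean.
Qed.

(** Jensen's inequality: the positive operator M_n reproduces constants, so that
applying it to the tangent at s = M_n|h|(x) gives s^r. *)
Lemma powR_durrmeyer_le n h r x : 1 <= r -> S x -> w_integrable h ->
  w_integrable (fun y => `|h y| `^ r) ->
  `|Mop n h x| `^ r <= Mop n (fun y => `|h y| `^ r) x.
Proof.
move=> r1 Sx ih ihr; have r0 : 0 <= r by apply: le_trans r1.
have ih' := w_integrable_norm ih.
set s := Mop n (fun y => `|h y|) x.
have hs : `|Mop n h x| <= s by exact: ler_norm_durrmeyer.
have s0 : 0 <= s by apply: le_trans hs.
apply: (@le_trans _ _ (s `^ r)); first by rewrite ge0_ler_powR ?nnegrE.
have wc t : w_integrable (fun=> t).
  by apply: (w_integrable_within hd a1); exact: within_cst.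
pose T y := (s `^ r - r * s `^ (r - 1) * s) + r * s `^ (r - 1) * `|h y|.
have iT : w_integrable T by apply: w_integrableD => //; exact: w_integrableZ.
have -> : s `^ r = Mop n T x.
  rewrite durrmeyerD//; last exact: w_integrableZ.
  by rewrite durrmeyer_cst durrmeyerZ// -/s subrK.
apply: ler_durrmeyer => // y Sy; rewrite /T.
apply: le_trans (powR_tangent r1 s0 (normr_ge0 (h y))).
by rewrite le_eqVlt; apply/orP; left; apply/eqP; ring.
Qed.
End contraction.

Section weighted_norm.
Context {R : realType} {d : nat} (hd : (0 < d)%N).
Variables (alpha : 'I_d.+1 -> R) (alpha1 : forall i, -1 < alpha i).
Implicit Types (x y : 'rV[R]_d) (f g h : 'rV[R]_d -> R) (p : \bar R).
Local Notation mu := (lebesgue_rV R d).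
Local Notation S := (@simplex R d).
Local Notation O := (@osimplex R d).

(** The exponents of the weight, renumbered so that the exponent of 1 - |x| comes
first, like its barycentric coordinate. *)
Definition bexp (i : 'I_d.+1) : R :=
  oapp (fun k => alpha (lift ord_max k)) (alpha ord_max) (unlift ord0 i).

Local Notation w := (bweight bexp).

Lemma bexp_gtN1 i : -1 < bexp i.
Proof. by rewrite /bexp; case: unlift => [k|] /=. Qed.

Lemma jacobi_weightE : jacobi_weight alpha = w.
Proof.
apply/funext => x; rewrite /jacobi_weight /bweight big_ord_recl bary0 mulrC.
rewrite /bexp unlift_none; congr (_ * _); apply: eq_bigr => k _.
by rewrite baryS liftK.
Qed.

(** The weighted norm of [f] is the plain L_r norm of this function, from which
it inherits Minkowski's inequality. *)
Definition wpow r f : 'rV[R]_d -> R := (fun y => f y * w y `^ r^-1) \_ S.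
Arguments wpow : clear implicits.

Lemma measurable_wpow r f : measurable_fun S f -> measurable_fun setT (wpow r f).
Proof.
move=> mf; apply/(measurable_restrictT _ _).1; first exact: measurable_simplex.
apply: measurable_funM => //; apply: measurable_funTS.
by apply: (measurableT_comp (measurable_powR _)); exact: measurable_bweight.
Qed.

Lemma wnorm_Lnorm r f : 1 <= r ->
  wnorm alpha r%:E f = ('N[mu]_(r%:E)[EFin \o wpow r f])%E.
Proof.
move=> r1; have r0 : 0 < r by apply: lt_le_trans r1.
rewrite unlock /wnorm; congr (_ `^ _)%E; rewrite [LHS]integral_mkcond.
apply: eq_integral => x _; rewrite /wpow !patchE /= patchE jacobi_weightE.
case: ifPn => _.
  rewrite normrM powRM// (ger0_norm (powR_ge0 _ _)) -powRrM mulVf ?gt_eqF//.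
  by rewrite powRr1// bweight_ge0.
by rewrite normr0 powR0// gt_eqF.
Qed.

Lemma lebesgue_rVT_gt0 : (0 < mu setT)%E.
Proof.
apply: lt_le_trans (@osimplex_gt0 R d) _.
by apply: le_measure; rewrite ?inE//; exact: measurable_osimplex.
Qed.

Lemma wnorm_ge0 p f : (0 <= wnorm alpha p f)%E.
Proof.
case: p => [r||] //=; first exact: poweR_ge0.
by apply: ess_sup_gee lebesgue_rVT_gt0 _; apply/nearW => x; rewrite lee_fin.
Qed.

Lemma wnorm_triangle p f g : (1 <= p)%E -> measurable_fun S f -> measurable_fun S g ->
  (wnorm alpha p (fun x => f x + g x)%R <= wnorm alpha p f + wnorm alpha p g)%E.
Proof.
case: p => [r||] //; rewrite ?lee_fin => r1 mf mg.
  rewrite !wnorm_Lnorm//.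
  rewrite (_ : EFin \o wpow r (fun x => f x + g x) = EFin \o (wpow r f \+ wpow r g)); last first.
    apply/funext => x /=; congr EFin; rewrite /wpow !patchE.
    by case: ifP => _; rewrite ?mulrDl// addr0.
  by apply: eminkowski => //; exact: measurable_wpow.
rewrite /wnorm.
have := ess_sup_normD mu (f \_ S) (g \_ S).
congr (_ <= _)%E; congr ess_sup; apply/funext => x /=; congr (`|_|%:E).
by rewrite !patchE; case: ifP => _ //; rewrite addr0.
Qed.

Lemma wnormN p f : wnorm alpha p (fun x => - f x) = wnorm alpha p f.
Proof.
case: p => [r||] //=.
  by congr (_ `^ _)%E; apply: eq_integral => x _; rewrite normrN.
congr ess_sup; apply/funext => x; rewrite !patchE; case: ifP => // _.
by rewrite normrN.
Qed.

Lemma eq_wnorm p (N : set 'rV[R]_d) f g : measurable N -> mu N = 0%E ->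
  (forall x, S x -> ~ N x -> f x = g x) -> wnorm alpha p f = wnorm alpha p g.
Proof.
move=> mN N0 fg; case: p => [r||] //=.
  congr (_ `^ _)%E; apply: (eq_integral_off_null mN N0) => x Sx Nx.
  by rewrite fg.
apply: eq_ess_sup; exists N; split => // x /=; apply: contra_notP => Nx.
rewrite !patchE; case: ifPn => // /set_mem Sx; by rewrite fg.
Qed.

Lemma eq_wnorm_osimplex p f g : (forall x, O x -> f x = g x) ->
  wnorm alpha p f = wnorm alpha p g.
Proof.
have [N [mN N0 SN]] := simplex_boundary_null (R := R) hd.
by move=> fg; apply: (eq_wnorm _ mN N0) => x Sx Nx; apply: fg; exact: SN.
Qed.

Lemma measurable_powR_w r f : measurable_fun S f ->
  measurable_fun S (fun x => `|f x| `^ r * w x).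
Proof.
move=> mf; apply: measurable_funM.
  by apply: (measurableT_comp (measurable_powR r)); exact: measurableT_comp mf.
by apply: measurable_funTS; exact: measurable_bweight.
Qed.

Lemma wnorm_fin r f : wnorm alpha r%:E f =
  ((\int[mu]_(x in S) (`|f x| `^ r * w x)%:E) `^ r^-1)%E.
Proof. by rewrite /wnorm jacobi_weightE. Qed.

Lemma powR_w_ge0 r f x : (0 <= (`|f x| `^ r * w x)%:E)%E.
Proof. by rewrite lee_fin mulr_ge0 ?powR_ge0 ?bweight_ge0. Qed.

Lemma wnormZ_le p f c : (1 <= p)%E -> 0 <= c -> measurable_fun S f ->
  (wnorm alpha p (fun x => c * f x)%R <= c%:E * wnorm alpha p f)%E.
Proof.
case: p => [r||] //; rewrite ?lee_fin => r1 c0 mf.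
  have r0 : 0 < r by apply: lt_le_trans r1.
  rewrite !wnorm_fin.
  have -> : (\int[mu]_(x in S) (`|c * f x| `^ r * w x)%:E =
      (c `^ r)%:E * \int[mu]_(x in S) (`|f x| `^ r * w x)%:E)%E.
    rewrite -ge0_integralZl//; first last.
    - by rewrite lee_fin powR_ge0.
    - by move=> x _; exact: powR_w_ge0.
    - by apply/measurable_EFinP; exact: measurable_powR_w.
    - exact: measurable_simplex.
    apply: eq_integral => x _; rewrite -EFinM normrM powRM// (ger0_norm c0).
    by rewrite mulrA.
  rewrite poweRM ?lee_fin ?powR_ge0//; last by apply: integral_ge0 => x _; exact: powR_w_ge0.
  by rewrite poweR_EFin -powRrM divff ?gt_eqF// powRr1.
rewrite /wnorm -(ess_supZl _ lebesgue_rVT_gt0 c0).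
rewrite le_eqVlt; apply/orP; left; apply/eqP; congr ess_sup; apply/funext => x /=.
rewrite -EFinM !patchE; case: ifP => _; last by rewrite normr0 mulr0.
by rewrite normrM (ger0_norm c0).
Qed.

Lemma wnorm_bounded p : (1 <= p)%E -> exists2 K, 0 <= K & forall f M,
  measurable_fun S f -> (forall x, S x -> `|f x| <= M) -> (wnorm alpha p f <= (M * K)%:E)%E.
Proof.
have S0 : S (0 : 'rV[R]_d).
  by split=> [i|]; rewrite ?mxE// /sumx big1// => i _; rewrite mxE.
case: p => [r||] //; rewrite ?lee_fin => r1; last first.
  exists 1 => // f M mf fM; rewrite mulr1; apply/ess_supP/nearW => x /=.
  rewrite lee_fin patchE; case: ifPn => [/set_mem/fM//|_].
  by rewrite normr0 (le_trans _ (fM _ S0)).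
have r0 : 0 < r by apply: lt_le_trans r1.
have iw := integrable_bweight hd bexp_gtN1.
exists ((w_int bexp (fun=> 1)) `^ r^-1); first exact: powR_ge0.
move=> f M mf fM; have M0 : 0 <= M by apply: le_trans (fM _ S0).
have -> : M * (w_int bexp (fun=> 1)) `^ r^-1 = (M `^ r * w_int bexp (fun=> 1)) `^ r^-1.
  rewrite powRM ?powR_ge0//.
    by rewrite -powRrM divff ?gt_eqF// powRr1.
  by apply: Rintegral_ge0 => x _; rewrite mul1r bweight_ge0.
rewrite wnorm_fin -poweR_EFin.
have W1 : w_integrable bexp (fun=> 1).
  by apply: (w_integrable_within hd bexp_gtN1); exact: within_cst.
have -> : (M `^ r * w_int bexp (fun=> 1))%:E = (\int[mu]_(x in S) (M `^ r * w x)%:E)%E.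
  rewrite -w_intZ// /w_int /Rintegral fineK.
    by apply: eq_integral => x _; rewrite mulr1.
  by apply: integrable_fin_num; [exact: measurable_simplex|exact: w_integrableZ].
apply: gt0_ler_poweR.
- by rewrite invr_ge0 ltW.
- by rewrite in_itv/= integral_ge0 ?leey// => x _; exact: powR_w_ge0.
- by rewrite in_itv/= integral_ge0 ?leey// => x _; rewrite lee_fin mulr_ge0 ?powR_ge0 ?bweight_ge0.
apply: ge0_le_integral.
- exact: measurable_simplex.
- by move=> x _; exact: powR_w_ge0.
- by apply/measurable_EFinP; exact: measurable_powR_w.
- apply/measurable_EFinP; apply: measurable_funM => //.
  by apply: measurable_funTS; exact: measurable_bweight.
- move=> x Sx; rewrite lee_fin ler_wpM2r ?bweight_ge0// ge0_ler_powR ?nnegrE//.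
    exact: ltW.
  exact: fM.
Qed.

Lemma wnorm_integrable_powR r f : 1 <= r -> measurable_fun S f ->
  (wnorm alpha r%:E f < +oo)%E -> w_integrable bexp (fun x => `|f x| `^ r).
Proof.
move=> r1 mf; have r0 : 0 < r by apply: lt_le_trans r1.
rewrite wnorm_fin => /lty_poweRy; rewrite invr_eq0 gt_eqF// => /(_ isT) foo.
apply/integrableP; split; first by apply/measurable_EFinP; exact: measurable_powR_w.
under eq_integral do rewrite gee0_abs ?powR_w_ge0//.
exact: foo.
Qed.

Lemma ae_bounded f e : ess_sup mu (fun x => `|(f \_ S) x|%:E) = e%:E ->
  exists N, [/\ measurable N, mu N = 0%E & forall x, S x -> ~ N x -> `|f x| <= e].
Proof.
move=> fe; have [N [mN N0 fN]] := ess_sup_ge mu (fun x => `|(f \_ S) x|%:E).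
exists N; split=> // x Sx; apply: contra_notP => /negP fx; apply: fN => /=.
by rewrite fe lee_fin patchE mem_set//; apply/negP.
Qed.

(** The weight has finite total mass, so the weighted L_p space is contained in the
weighted L_1 space. For finite p this uses t <= 1 + t^p; for p = +oo the function
is bounded off a null set. *)
Lemma wnorm_integrable p f : (1 <= p)%E -> measurable_fun S f ->
  (wnorm alpha p f < +oo)%E -> w_integrable bexp f.
Proof.
have wc t : w_integrable bexp (fun=> t).
  by apply: (w_integrable_within hd bexp_gtN1); exact: within_cst.
have mfw f' : measurable_fun S f' -> measurable_fun S (fun x => (f' x * w x)%:E).
  move=> mf'; apply/measurable_EFinP; apply: measurable_funM => //.
  by apply: measurable_funTS; exact: measurable_bweight.
case: p => [r||] //; rewrite ?lee_fin => r1 mf foo.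
  have ifr := wnorm_integrable_powR r1 mf foo.
  apply: (le_integrable measurable_simplex (mfw _ mf) _ (w_integrableD (wc 1) ifr)).
  move=> x Sx; rewrite lee_fin !normrM ler_wpM2r// [leRHS]ger0_norm ?addr_ge0 ?powR_ge0//.
  have [f1|f1] := leP `|f x| 1; first by rewrite ler_wpDr// powR_ge0.
  by rewrite (le_trans (le1r_powR (ltW f1) r1))// lerDr.
have E : ess_sup mu (fun x => `|(f \_ S) x|%:E) \is a fin_num.
  by rewrite ge0_fin_numE//; exact: (wnorm_ge0 +oo f).
have [N [mN N0 fN]] := ae_bounded (esym (fineK E)).
set e := fine _ in fN.
have if' : w_integrable bexp (f \_ (S `\` N)).
  apply: (@w_integrable_bounded _ _ hd _ bexp_gtN1 _ `|e|).
    apply: measurable_funTS; apply/(measurable_restrictT _ _).1.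
      by apply: measurableD => //; exact: measurable_simplex.
    by apply: measurable_funS mf; [exact: measurable_simplex|exact: subDsetl].
  move=> x Sx; rewrite patchE; case: ifPn => [/set_mem[_ Nx]|_]; last by rewrite normr0.
  exact: le_trans (fN x Sx Nx) (ler_norm e).
apply/integrableP; split; first exact: mfw.
move/integrableP : if' => [_]; congr (_ < _)%E.
apply: (eq_integral_off_null mN N0) => x Sx Nx.
by rewrite patchE mem_set.
Qed.

(** For finite p, integrate Jensen's inequality and use that M_n preserves the
integral. For p = +oo, replace [f] on a null set to make it bounded everywhere,
which leaves M_n f unchanged, and use positivity. *)
Lemma wnorm_durrmeyer p f n : (1 <= p)%E -> measurable_fun S f ->
  (wnorm alpha p (durrmeyer bexp n f) <= wnorm alpha p f)%E.
Proof.
move=> p1 mf; have [->|foo] := eqVneq (wnorm alpha p f) +oo%E; first exact: leey.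
have {}foo : (wnorm alpha p f < +oo)%E by rewrite ltey.
have iwf := wnorm_integrable p1 mf foo.
have b1 := bexp_gtN1.
case: p p1 foo => [r||] //; rewrite ?lee_fin => r1 foo; last first.
  have E : ess_sup mu (fun x => `|(f \_ S) x|%:E) \is a fin_num.
    by rewrite ge0_fin_numE//; exact: (wnorm_ge0 +oo f).
  have [N [mN N0 fN]] := ae_bounded (esym (fineK E)).
  rewrite /wnorm -(fineK E); set e := fine _ in fN *.
  have e0 : 0 <= e by rewrite fine_ge0//; exact: (wnorm_ge0 +oo f).
  apply/ess_supP/nearW => x; rewrite lee_fin patchE; case: ifPn => [/set_mem Sx|_]; last by rewrite normr0.
  (* [f'] is bounded by the essential supremum of [f] everywhere. *)
  pose f' := f \_ (S `\` N).
  have f'e y : S y -> `|f' y| <= e.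
    move=> Sy; rewrite /f' patchE; case: ifPn => [/set_mem[_ Ny]|_]; last by rewrite normr0.
    exact: fN.
  have if' : w_integrable bexp f'.
    apply: (@w_integrable_bounded _ _ hd _ b1 _ e) => //.
    apply: measurable_funTS; apply/(measurable_restrictT _ _).1.
      by apply: measurableD => //; exact: measurable_simplex.
    by apply: measurable_funS mf; [exact: measurable_simplex|exact: subDsetl].
  have -> : durrmeyer bexp n f x = durrmeyer bexp n f' x.
    apply: eq_mmean => k _; congr (fine _ / _).
    apply: (eq_integral_off_null mN N0) => y Sy Ny.
    by rewrite /f' patchE mem_set.
  apply: le_trans (ler_norm_durrmeyer hd b1 n Sx if') _.
  rewrite -[leRHS](durrmeyer_cst hd b1 n e x); apply: ler_durrmeyer => //.
    exact: w_integrable_norm.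
  by apply: (w_integrable_within hd b1); exact: within_cst.
have r0 : 0 < r by apply: lt_le_trans r1.
have ifr := wnorm_integrable_powR r1 mf foo.
have cM : {within S, continuous (durrmeyer bexp n f)} by exact: within_durrmeyer.
have mM := measurable_within cM.
have iMr : w_integrable bexp (durrmeyer bexp n (fun x => `|f x| `^ r)).
  by apply: (w_integrable_within hd b1); exact: within_durrmeyer.
rewrite !wnorm_fin; apply: gt0_ler_poweR.
- by rewrite invr_ge0 ltW.
- by rewrite in_itv/= integral_ge0 ?leey// => x _; exact: powR_w_ge0.
- by rewrite in_itv/= integral_ge0 ?leey// => x _; exact: powR_w_ge0.
apply: (@le_trans _ _ (\int[mu]_(x in S) (durrmeyer bexp n (fun x => `|f x| `^ r) x * w x)%:E)%E).
  apply: ge0_le_integral.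
  - exact: measurable_simplex.
  - by move=> x _; exact: powR_w_ge0.
  - by apply/measurable_EFinP; exact: measurable_powR_w.
  - exact: measurable_int iMr.
  - move=> x Sx; rewrite lee_fin ler_wpM2r ?bweight_ge0//.
    exact: powR_durrmeyer_le.
rewrite -(fineK (integrable_fin_num measurable_simplex iMr)).
rewrite -[leRHS](fineK (integrable_fin_num measurable_simplex ifr)) lee_fin.
rewrite le_eqVlt; apply/orP; left; apply/eqP.
exact: (w_int_durrmeyer hd b1 n ifr).
Qed.
End weighted_norm.

(** * The differential operator in barycentric coordinates *)

Section edge_derivative.
Context {R : realType} {d : nat}.
Implicit Types (x y v : 'rV[R]_d) (h : 'rV[R]_d -> R) (i j l : 'I_d.+1).
Local Notation S := (@simplex R d).
Local Notation O := (@osimplex R d).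

Lemma is_derive_dir0 x h : is_derive x (0 : 'rV[R]_d) h 0.
Proof.
apply/is_derive_line0; rewrite (_ : (fun s => _) = cst (h x)); first exact: is_derive_cst.
by apply/funext => s; rewrite scaler0 addr0.
Qed.

(** The derivative in the direction of a vertex, seen as a vector from the origin,
out of the partial derivatives [D]; the origin itself contributes 0. *)
Definition vderiv (D : 'I_d -> 'rV[R]_d -> R) i x : R :=
  oapp (fun k => D k x) 0 (unlift ord0 i).

Lemma within_vderiv D i : (forall k, {within S, continuous (D k)}) ->
  {within S, continuous (vderiv D i)}.
Proof.
by move=> cD; rewrite /vderiv; case: unlift => [k|] /=; [exact: cD|exact: within_cst].
Qed.

Lemma vertex0 : vertex ord0 = 0 :> 'rV[R]_d.
Proof. by apply/rowP => k; rewrite !mxE. Qed.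

Lemma vertexS k : vertex (lift ord0 k) = delta_mx ord0 k :> 'rV[R]_d.
Proof.
by apply/rowP => k'; rewrite !mxE eqxx/= (inj_eq (@lift_inj _ ord0)) eq_sym.
Qed.

Lemma is_derive_vertex h D i x :
  (forall k, is_derive x (delta_mx ord0 k : 'rV[R]_d) h (D k x)) ->
  is_derive x (vertex i : 'rV[R]_d) h (vderiv D i x).
Proof.
move=> hD; have [|k] := bary_indexP i; rewrite /vderiv ?unlift_none ?liftK.
  by rewrite vertex0; exact: is_derive_dir0.
by rewrite vertexS; exact: hD.
Qed.

Lemma is_derive_edge h D i j x : (forall k, {within S, continuous (D k)}) ->
  (forall k y, O y -> is_derive y (delta_mx ord0 k : 'rV[R]_d) h (D k y)) -> O x ->
  is_derive x (edge i j : 'rV[R]_d) h (vderiv D j x - vderiv D i x).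
Proof.
move=> cD dD xO; rewrite /edge; apply: is_derive_add_dir.
- have := @open_osimplex R d; rewrite openE => /(_ _ xO); apply: filterS => y yO.
  by apply: is_derive_vertex => k; exact: dD.
- by apply: continuous_at_osimplex xO; exact: within_vderiv.
have := @is_derive_scale_dir R 'rV[R]_d x (vertex i) h _ (-1) (is_derive_vertex i (fun k => dD k x xO)).
by rewrite scaleN1r mulN1r.
Qed.

Definition vderiv2 (D : 'I_d -> 'I_d -> 'rV[R]_d -> R) l i x : R :=
  oapp (fun k => vderiv (D k) i x) 0 (unlift ord0 l).

Definition edge1 D i j x : R := vderiv D j x - vderiv D i x.

Definition edge2 D i j x : R :=
  (vderiv2 D j j x - vderiv2 D j i x) - (vderiv2 D i j x - vderiv2 D i i x).

Lemma within_vderiv2 D l i : (forall k k', {within S, continuous (D k k')}) ->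
  {within S, continuous (vderiv2 D l i)}.
Proof.
move=> cD; rewrite /vderiv2; case: unlift => [k|] /=; [|exact: within_cst].
by apply: within_vderiv => k'; exact: cD.
Qed.

Lemma is_derive_edge1 (D1 : 'I_d -> 'rV[R]_d -> R) D2 i j x :
  (forall k k', {within S, continuous (D2 k k')}) ->
  (forall k k' y, O y -> is_derive y (delta_mx ord0 k' : 'rV[R]_d) (D1 k) (D2 k k' y)) -> O x ->
  is_derive x (edge i j : 'rV[R]_d) (edge1 D1 i j) (edge2 D2 i j x).
Proof.
move=> cD dD xO.
have H l : is_derive x (edge i j : 'rV[R]_d) (vderiv D1 l) (vderiv2 D2 l j x - vderiv2 D2 l i x).
  rewrite /vderiv /vderiv2; case: (unlift ord0 l) => [k|] /=.
    by apply: is_derive_edge xO => // k' y yO; exact: dD.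
  by rewrite subrr; exact: is_derive_cst.
exact: is_deriveB (H j) (H i).
Qed.

Lemma bpow_pred (b c : R) : 0 < b -> b * b `^ (c - 1) = b `^ c.
Proof.
move=> b0; rewrite powRB ?(gt_eqF b0) ?implybT// powRr1 ?ltW//.
by rewrite mulrCA divff ?mulr1// gt_eqF.
Qed.

(** Along the edge only two factors of the weight vary, so this is a derivative of
a function of one variable. *)
Lemma is_derive_flux (a : 'I_d.+1 -> R) (g1 : 'rV[R]_d -> R) (g2 : R) i j x : i != j -> O x ->
  is_derive x (edge i j : 'rV[R]_d) g1 g2 ->
  is_derive x (edge i j : 'rV[R]_d) (fun y => bary y i * bary y j * bweight a y * g1 y)
    (bweight a x * (((a j + 1) * bary x i - (a i + 1) * bary x j) * g1 x
       + bary x i * bary x j * g2)).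
Proof.
move=> ij xO dg1.
pose c := \prod_(l | (l != i) && (l != j)) bary x l `^ a l.
have W s : bweight a (x + s *: edge i j) =
    c * ((bary x i - s) `^ a i * (s - - bary x j) `^ a j).
  rewrite /bweight (bigD1 i)//= (bigD1 j) 1?eq_sym//=.
  rewrite bary_edge_src// bary_edge_dst// opprK [s + _]addrC.
  rewrite (eq_bigr (fun l => bary x l `^ a l)); last first.
    by move=> l /andP[li lj]; rewrite bary_edge_other.
  by rewrite -/c; ring.
set bi := bary x i; set bj := bary x j.
have bi0 : 0 < bi := xO i; have bj0 : 0 < bj := xO j.
have W0 : bweight a x = c * (bi `^ a i * bj `^ a j).
  by have := W 0; rewrite scale0r addr0 subr0 sub0r opprK.
apply/is_derive_line0.
have d1 : is_derive (0 : R) 1 (fun s => bi - s) (- 1).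
  by have := is_deriveB (is_derive_cst bi (0 : R) (1 : R)) (is_derive_id (0 : R) (1 : R)); rewrite sub0r.
have d2 : is_derive (0 : R) 1 (fun s => bj + s) 1.
  by have := is_deriveD (is_derive_cst bj (0 : R) (1 : R)) (is_derive_id (0 : R) (1 : R)); rewrite add0r.
have d3 := is_derive_powR_refl (a i) bi0.
have d4 : is_derive (0 : R) 1 (fun s => (s - - bj) `^ a j) _ :=
  is_derive_powR_shift (a j) (etrans (oppr_lt0 bj) bj0).
have d5 : is_derive (0 : R) 1 (fun s => g1 (x + s *: edge i j)) g2.
  exact: ((is_derive_line0 x _ g1 g2).1 dg1).
have D := is_deriveM (is_deriveM (is_deriveM d1 d2) (is_deriveZ c (is_deriveM d3 d4))) d5.
have E : (fun s => bary (x + s *: edge i j) i * bary (x + s *: edge i j) j *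
    bweight a (x + s *: edge i j) * g1 (x + s *: edge i j)) =
  (fun s => (bi - s) * (bj + s) * (c * ((bi - s) `^ a i * (s - - bj) `^ a j)) * g1 (x + s *: edge i j)).
  by apply/funext => s; rewrite W bary_edge_src// bary_edge_dst.
rewrite E; apply: (is_derive_eq D).
change ((bi - 0) * (bj + 0) * (c * ((bi - 0) `^ a i * (0 - - bj) `^ a j)) * g2 +
  g1 (x + 0 *: edge i j) *
  ((bi - 0) * (bj + 0) * (c * ((bi - 0) `^ a i * (a j * (0 - - bj) `^ (a j - 1)) +
      (0 - - bj) `^ a j * (- (a i * (bi - 0) `^ (a i - 1))))) +
   c * ((bi - 0) `^ a i * (0 - - bj) `^ a j) * ((bi - 0) * 1 + (bj + 0) * (- 1))) =
  bweight a x * (((a j + 1) * bi - (a i + 1) * bj) * g1 x + bi * bj * g2)).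
rewrite scale0r !addr0 !subr0 sub0r opprK W0.
rewrite -(bpow_pred (a i) bi0) -(bpow_pred (a j) bj0); ring.
Qed.

Lemma enormZ (t : R) v : enorm (t *: v) = `|t| * enorm v.
Proof.
rewrite /enorm -sqrtr_sqr -sqrtrM ?sqr_ge0// mulr_sumr; congr Num.sqrt.
by apply: eq_bigr => k _; rewrite mxE exprMn.
Qed.

Lemma enorm_edge_gt0 i j : i != j -> 0 < enorm (edge i j : 'rV[R]_d).
Proof.
move=> ij; have [c vc] := edge_coord (R := R) ij.
rewrite sqrtr_gt0 (bigD1 c)//= ltr_wpDr//.
  by apply: sumr_ge0 => k _; exact: sqr_ge0.
by rewrite -(real_normK (num_real _)) vc expr1n.
Qed.

Lemma edgeC i j : edge j i = - edge i j :> 'rV[R]_d.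
Proof. by rewrite /edge opprB. Qed.

(** From [x] one can move towards the vertex j until the coordinate of i
vanishes, that is, by lambda_i times the length of the edge. *)
Lemma sup_edge_dist i j x : i != j -> S x ->
  sup [set enorm (x - (x + t *: edge_dir i j)) |
        t in [set t : R | 0 <= t /\ S (x + t *: edge_dir i j)]] =
  enorm (edge i j : 'rV[R]_d) * bary x i.
Proof.
move=> ij /simplexP x0; set e := enorm (edge i j : 'rV[R]_d).
have e0 : 0 < e := enorm_edge_gt0 ij.
have ed : edge_dir i j = e^-1 *: edge i j by [].
rewrite (_ : [set _ | _ in _] = `[0, e * bary x i]%classic).
  by rewrite sup_itvcc// mulr_ge0// ltW.
have dist t : 0 <= t -> enorm (x - (x + t *: edge_dir i j)) = t.
  move=> l0; rewrite opprD addrA subrr sub0r ed scalerA -scaleNr enormZ normrN.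
  by rewrite ger0_norm ?divr_ge0 ?(ltW e0)// -/e divfK// gt_eqF.
have inS t : 0 <= t -> S (x + t *: edge_dir i j) <-> t <= e * bary x i.
  move=> l0; rewrite ed scalerA -ler_pdivrMl// mulrC; split.
    by move=> /simplexP/(_ i); rewrite bary_edge_src// subr_ge0.
  move=> li; apply/simplexP => k.
  have [->|ki] := eqVneq k i; first by rewrite bary_edge_src// subr_ge0.
  have [->|kj] := eqVneq k j; last by rewrite bary_edge_other.
  by rewrite bary_edge_dst// addr_ge0// mulr_ge0// invr_ge0 ltW.
apply/seteqP; split=> [_ [t [l0 Sl] <-]|t].
  by rewrite dist// /= in_itv/= l0; apply/inS.
by rewrite /= in_itv/= => /andP[l0 li]; exists t; [split=> //; exact/inS|exact: dist].
Qed.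

Lemma dtilde_edge i j x : i != j -> S x ->
  dtilde (edge_dir i j) x =
  enorm (edge i j : 'rV[R]_d) ^+ 2 * (bary x i * bary x j).
Proof.
move=> ij Sx; rewrite /dtilde sup_edge_dist//.
have ji : j != i by rewrite eq_sym.
have eE : enorm (edge j i : 'rV[R]_d) = enorm (edge i j : 'rV[R]_d).
  by rewrite edgeC -scaleN1r enormZ normrN1 mul1r.
have dE : edge_dir j i = - edge_dir i j :> 'rV[R]_d.
  have edE i' j' : edge_dir i' j' = (enorm (edge i' j' : 'rV[R]_d))^-1 *: edge i' j' by [].
  by rewrite !edE eE (edgeC i j) scalerN.
pose T (z : R -> 'rV[R]_d) :=
  sup [set enorm (x - z t) | t in [set t : R | 0 <= t /\ S (z t)]].
have H : T (fun t => x - t *: edge_dir i j) = enorm (edge i j : 'rV[R]_d) * bary x j.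
  rewrite -eE -(sup_edge_dist ji Sx) (_ : (fun t => _) = (fun t => x + t *: edge_dir j i))//.
  by apply/funext => t; rewrite dE scalerN.
rewrite [X in _ * X](_ : _ = enorm (edge i j : 'rV[R]_d) * bary x j); last exact: H.
by ring.
Qed.

(** The factor e^2 in [dtilde], e being the length of the edge, compensates the
two normalising factors 1 / e of the directional derivatives. *)
Lemma PD_osimplex (alpha : 'I_d.+1 -> R) (g : 'rV[R]_d -> R) D1 D2 x :
  (forall k, {within S, continuous (D1 k)}) ->
  (forall k k', {within S, continuous (D2 k k')}) ->
  (forall k y, O y -> is_derive y (delta_mx ord0 k : 'rV[R]_d) g (D1 k y)) ->
  (forall k k' y, O y -> is_derive y (delta_mx ord0 k' : 'rV[R]_d) (D1 k) (D2 k k' y)) ->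
  O x -> PD alpha g x = simplex_op (bexp alpha) (edge1 D1) (edge2 D2) x.
Proof.
move=> cD1 cD2 dD1 dD2 xO; rewrite /PD /simplex_op jacobi_weightE.
apply: eq_bigr => i _; apply: eq_bigr => j ij.
have {}ij : i != j by rewrite -(inj_eq val_inj) neq_ltn ij.
set e := enorm (edge i j : 'rV[R]_d); have e0 : 0 < e := enorm_edge_gt0 ij.
have w0 := bweight_gt0 (bexp alpha) xO.
have ed : edge_dir i j = e^-1 *: edge i j by [].
have d1 y : O y -> is_derive y (edge_dir i j : 'rV[R]_d) g (e^-1 * edge1 D1 i j y).
  by move=> yO; rewrite ed; apply: is_derive_scale_dir; exact: is_derive_edge.
rewrite (@near_eq_derive _ _ _ _ (fun y => e * (bary y i * bary y j * bweight (bexp alpha) y * edge1 D1 i j y))); last first.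
  have := @open_osimplex R d; rewrite openE => /(_ _ xO); apply: filterS => y yO.
  rewrite dtilde_edge//; last exact: osimplex_sub.
  have [_ ->] := d1 y yO; rewrite -/e; field.
  by rewrite gt_eqF.
have fl := is_derive_flux (bexp alpha) ij xO (is_derive_edge1 i j cD2 dD2 xO).
have := is_derive_scale_dir e^-1 (is_deriveZ e fl); rewrite -ed => -[_ ->].
rewrite /GRing.scale/= /edge_op; field.
by rewrite !gt_eqF.
Qed.
End edge_derivative.

(** * The estimate by the K-functional *)

Section jackson.
Context {R : realType} {d : nat} (hd : (0 < d)%N).
Variables (alpha : 'I_d.+1 -> R) (alpha1 : forall i, -1 < alpha i).
Implicit Types (x y : 'rV[R]_d) (f g : 'rV[R]_d -> R) (p : \bar R).
Local Notation mu := (lebesgue_rV R d).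
Local Notation S := (@simplex R d).
Local Notation O := (@osimplex R d).
Local Notation a := (bexp alpha).
Local Notation Mop := (durrmeyer a).

Let a1 : forall i, -1 < a i := bexp_gtN1 alpha1.

Lemma bernstein_durrmeyerE n f x : w_integrable a f ->
  bernstein_durrmeyer alpha n f x = Mop n f x.
Proof.
move=> fi; rewrite /bernstein_durrmeyer /durrmeyer jacobi_weightE -sum_bernstein.
apply: eq_bigr => k kn; rewrite -mulrA; congr (_ * _).
set m := full_index k; have c0 : multinom m != 0 :> R.
  by rewrite gt_eqF// /multinom divr_gt0 ?prodr_gt0// => *; rewrite ltr0n fact_gt0.
have bi : w_integrable a (bmon m) by apply: (w_integrable_within hd a1); exact: within_bmon.
rewrite /bmean /bmom.
rewrite (_ : (\int[mu]_(y in S) (bernstein k y * bweight a y)) = multinom m * w_int a (bmon m)); last first.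
  rewrite -w_intZ//; congr Rintegral; apply/funext => y.
  by rewrite bernsteinE.
rewrite (_ : (\int[mu]_(y in S) (f y * bernstein k y * bweight a y)) =
    multinom m * w_int a (fun y => f y * bmon m y)); last first.
  rewrite -w_intZ//; last exact: w_integrable_bmonM.
  by congr Rintegral; apply/funext => y; rewrite bernsteinE// mulrCA.
by have := bmom_gt0 hd a1 m; rewrite /bmom => m0; field; rewrite c0 gt_eqF.
Qed.

Section smooth.
Variables (p : \bar R) (p1 : (1 <= p)%E).
Variables (g : 'rV[R]_d -> R) (g1 g2 : 'I_d.+1 -> 'I_d.+1 -> 'rV[R]_d -> R).
Hypothesis cg : {within S, continuous g}.
Hypothesis cg1 : forall i j, {within S, continuous (g1 i j)}.
Hypothesis cg2 : forall i j, {within S, continuous (g2 i j)}.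
Hypothesis dg : forall i j x, O x -> is_derive x (edge i j : 'rV[R]_d) g (g1 i j x).
Hypothesis dg1 : forall i j x, O x ->
  is_derive x (edge i j : 'rV[R]_d) (g1 i j) (g2 i j x).
Local Notation Lg := (simplex_op a g1 g2).

Let mM k f : measurable_fun S (Mop k f).
Proof. by apply: measurable_within; exact: within_durrmeyer. Qed.

Let mMB k l f f' : measurable_fun S (fun x => Mop k f x - Mop l f' x).
Proof. exact: measurable_funB. Qed.

Let mLg : measurable_fun S Lg.
Proof. by apply: measurable_within; exact: within_simplex_op. Qed.

(** The step identity together with contractivity; the constant
1 / ((k + A) (k + 1)) is at most 1 / k - 1 / (k + 1) because A > 0. *)
Lemma wnorm_durrmeyer_step k : (0 < k)%N ->
  (wnorm alpha p (fun x => Mop k g x - Mop k.+1 g x)%R <=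
   (k%:R^-1 - k.+1%:R^-1)%:E * wnorm alpha p Lg)%E.
Proof.
move=> k0; have k0' : 0 < k%:R :> R by rewrite ltr0n.
have k1 : 0 < k.+1%:R :> R by rewrite ltr0n.
have A0 := wdim_gt0 a1; have kA : 0 < k%:R + wdim a by rewrite addr_gt0.
set c := ((k%:R + wdim a) * k.+1%:R)^-1.
have c0 : 0 <= c by rewrite invr_ge0 mulr_ge0 ?ltW.
rewrite (_ : (fun x => _) = (fun x => c * Mop k.+1 Lg x)); last first.
  apply/funext => x; rewrite (durrmeyer_step hd a1 cg cg1 cg2 dg dg1).
  by rewrite mulKf// mulf_neq0 ?gt_eqF.
apply: le_trans (wnormZ_le alpha p1 c0 (mM _ _)) _.
apply: (@le_trans _ _ (c%:E * wnorm alpha p Lg)%E).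
  by apply: lee_wpmul2l; [rewrite lee_fin|exact: wnorm_durrmeyer].
apply: lee_wpmul2r; [exact: wnorm_ge0|rewrite lee_fin].
rewrite (_ : k%:R^-1 - k.+1%:R^-1 = (k%:R * k.+1%:R)^-1); last first.
  by rewrite -natr1 in k1 *; field; rewrite !gt_eqF.
by rewrite lef_pV2 ?posrE ?mulr_gt0// ler_pM2r// lerDl ltW.
Qed.

Lemma wnorm_durrmeyer_telescope n m : (0 < n)%N ->
  (wnorm alpha p (fun x => Mop n g x - Mop (n + m) g x)%R <=
   (n%:R^-1 - (n + m)%:R^-1)%:E * wnorm alpha p Lg)%E.
Proof.
move=> n0; elim: m => [|m IH].
  rewrite addn0 subrr mul0e (_ : (fun x => _) = (fun x => 0 * Mop n g x)).
    by have := wnormZ_le alpha p1 (lexx 0) (mM n g); rewrite mul0e.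
  by apply/funext => x; rewrite subrr mul0r.
rewrite addnS (_ : (fun x => _) = (fun x => (Mop n g x - Mop (n + m) g x) +
    (Mop (n + m) g x - Mop (n + m).+1 g x))); last first.
  by apply/funext => x; ring.
apply: le_trans (wnorm_triangle alpha p1 (mMB _ _ _ _) (mMB _ _ _ _)) _.
have := wnorm_durrmeyer_step (ltn_addr m n0); move/(leeD IH) => /le_trans; apply.
have inv_le (k l : nat) : (0 < k)%N -> (k <= l)%N -> 0 <= k%:R^-1 - l%:R^-1 :> R.
  move=> k0 kl; rewrite subr_ge0 lef_pV2 ?posrE ?ltr0n ?ler_nat//.
  exact: leq_trans kl.
rewrite -ge0_muleDl ?lee_fin ?inv_le ?leq_addr ?ltn_addr//.
by rewrite -EFinD addrA subrK.
Qed.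

(** Let N tend to infinity in the telescoped bound; uniform convergence suffices,
since the norm of a bounded function is controlled by its bound. *)
Lemma wnorm_durrmeyer_sub n : (0 < n)%N ->
  (wnorm alpha p (fun x => Mop n g x - g x)%R <= (n%:R^-1)%:E * wnorm alpha p Lg)%E.
Proof.
move=> n0; have [K K0 HK] := wnorm_bounded hd alpha1 p1.
apply/lee_addgt0Pr => e e0.
have K1 : 0 < K + 1 by rewrite ltr_wpDl.
have [N nN HN] := durrmeyer_cvg hd a1 n cg (divr_gt0 e0 K1).
have mg := measurable_within cg.
rewrite (_ : (fun x => _) = (fun x => (Mop n g x - Mop N g x) + (Mop N g x - g x))); last first.
  by apply/funext => x; ring.
apply: le_trans (wnorm_triangle alpha p1 (mMB _ _ _ _) (measurable_funB (mM _ _) mg)) _.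
apply: leeD.
  have := wnorm_durrmeyer_telescope (N - n) n0; rewrite subnKC// => /le_trans; apply.
  by apply: lee_wpmul2r; [exact: wnorm_ge0|rewrite lee_fin gerBl invr_ge0].
apply: le_trans (HK _ _ (measurable_funB (mM _ _) mg) HN) _.
by rewrite lee_fin mulrAC ler_pdivrMr// ler_wpM2l ?(ltW e0)// lerDl.
Qed.
End smooth.

Lemma wnorm_durrmeyer_C2 p g n : (1 <= p)%E -> C2_simplex g -> (0 < n)%N ->
  (wnorm alpha p (fun x => Mop n g x - g x)%R <=
   (n%:R^-1)%:E * wnorm alpha p (PD alpha g))%E.
Proof.
move=> p1 [cg [D1 [D2 [cD1 cD2 dD1 dD2]]]] n0.
have {}dD1 k x : O x -> is_derive x (delta_mx ord0 k : 'rV[R]_d) g (D1 k x).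
  by move=> xO; apply: dD1; exact: osimplex_interior.
have {}dD2 k k' x : O x -> is_derive x (delta_mx ord0 k' : 'rV[R]_d) (D1 k) (D2 k k' x).
  by move=> xO; apply: dD2; exact: osimplex_interior.
rewrite (eq_wnorm_osimplex hd alpha p (fun x => PD_osimplex alpha cD1 cD2 dD1 dD2)).
apply: wnorm_durrmeyer_sub => //.
- by move=> i j; apply: within_sub; exact: within_vderiv.
- by move=> i j; apply: within_sub; apply: within_sub; exact: within_vderiv2.
- by move=> i j x xO; exact: is_derive_edge.
- by move=> i j x xO; exact: is_derive_edge1.
Qed.

(** The left-hand side is split as M_n (f - g) + (M_n g - g) - (f - g). *)
Lemma wnorm_durrmeyer_le p f g n : (1 <= p)%E -> measurable_fun S f ->
  C2_simplex g -> (0 < n)%N -> w_integrable a f ->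
  (wnorm alpha p (fun x => Mop n f x - f x)%R <=
   2%:E * (wnorm alpha p (fun x => f x - g x)%R +
           (n%:R^-1)%:E * wnorm alpha p (PD alpha g)))%E.
Proof.
move=> p1 mf gC n0 fi; have mg := measurable_within gC.1.
have gi : w_integrable a g := w_integrable_within hd a1 gC.1.
have mM k h : measurable_fun S (Mop k h).
  by apply: measurable_within; exact: within_durrmeyer.
have mfg := measurable_funB mf mg.
rewrite (_ : (fun x => _) = (fun x => Mop n (fun y => f y - g y) x +
    ((Mop n g x - g x) + - (f x - g x)))); last first.
  by apply/funext => x; rewrite durrmeyerB//; ring.
have mMg : measurable_fun S (fun x => Mop n g x - g x) by exact: measurable_funB.
have mN : measurable_fun S (fun x => - (f x - g x)) by exact: measurableT_comp.
apply: le_trans (wnorm_triangle alpha p1 (mM _ _) (measurable_funD mMg mN)) _.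
rewrite (_ : 2%:E = 1 + 1 :> \bar R)%E// ge0_muleDl// !mul1e.
have W0 : (0 <= (n%:R^-1)%:E * wnorm alpha p (PD alpha g))%E.
  by rewrite mule_ge0 ?lee_fin ?invr_ge0 ?wnorm_ge0.
apply: leeD.
  by apply: le_trans (wnorm_durrmeyer hd alpha1 n p1 mfg) _; rewrite leeDl.
apply: le_trans (wnorm_triangle alpha p1 mMg mN) _.
by rewrite wnormN addeC leeD2l// wnorm_durrmeyer_C2.
Qed.
End jackson.

Unset Implicit Arguments.

Theorem mainTheorem3 (R : realType) (d : nat) (hd : (1 <= d)%N)
  (p : \bar R) (hp : (1 <= p)%E)
  (alpha : 'I_d.+1 -> R) (halpha : forall i, -1 < alpha i)
  (f : 'rV[R]_d -> R) (hf : Lpw alpha p f)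
  (n : nat) (hn : (1 <= n)%N) :
  (wnorm alpha p (fun x => bernstein_durrmeyer alpha n f x - f x)%R
   <= 2%:E * Kfunctional alpha f n%:R^-1 p)%E.
Proof.
case: hf => mf foo.
have mS : measurable (simplex : set (matrix R 1 d)) by exact: measurable_simplex.
(* All the integrals involved are insensitive to null sets, so [f] may be
   replaced by a Borel function. *)
have [f' [N [mf' mN N0 ff']]] := lebesgue_measurable_borel mS mf.
have {}mf' : measurable_fun simplex f' := measurable_funTS mf'.
have f'i : w_integrable (bexp alpha) f'.
  by apply: (wnorm_integrable hd halpha hp mf'); rewrite -(eq_wnorm _ _ mN N0 ff').
have fE x : bernstein_durrmeyer alpha n f x = durrmeyer (bexp alpha) n f' x.
  rewrite -(bernstein_durrmeyerE hd halpha)//; apply: eq_bigr => k _; congr (_ * _).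
  congr fine; apply: (eq_integral_off_null mN N0) => y Sy Ny.
  by rewrite ff'.
have -> : wnorm alpha p (fun x => bernstein_durrmeyer alpha n f x - f x)%R =
    wnorm alpha p (fun x => durrmeyer (bexp alpha) n f' x - f' x)%R.
  by apply: (eq_wnorm _ _ mN N0) => x Sx Nx; rewrite fE ff'.
rewrite muleC -lee_pdivrMr//; apply: le_ereal_inf_tmp => _ [g gC <-].
rewrite lee_pdivrMr// muleC.
have -> : wnorm alpha p (fun x => f x - g x)%R = wnorm alpha p (fun x => f' x - g x)%R.
  by apply: (eq_wnorm _ _ mN N0) => x Sx Nx; rewrite ff'.
exact: wnorm_durrmeyer_le.
Qed.
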